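(* Let $F$ be a sufficiently computable subfield of $\mathbb{R}$. There is an algorithm which decides, given a formula $\varphi(x_1,\ldots,x_n)$ in the language of real closed fields (ordered fields, without parameters), whether the sentence $\exists x_1\in\mathbb{R}\setminus F\,\cdots\,\exists x_n\in\mathbb{R}\setminus F\;\varphi(x_1,\ldots,x_n)$ holds in the real numbers.
   Context: $F$ is called sufficiently computable if $F$ is a computable subfield of $\mathbb{R}$ and there is an algorithm that decides, given a real algebraic number $a$ (presented by a definition in the language of real closed fields), whether $a\in F$. *)

(* Defs.v *)
From Stdlib Require Import Reals List Arith.
Import ListNotations.
Open Scope R_scope.

Inductive term : Type :=
| TVar : nat -> term
| TZero : term
| TOne : term
| TAdd : term -> term -> term
| TMul : term -> term -> term
| TNeg : term -> term.

Inductive form : Type :=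
| FEq : term -> term -> form
| FLt : term -> term -> form
| FNot : form -> form
| FAnd : form -> form -> form
| FOr : form -> form -> form
| FEx : nat -> form -> form
| FAll : nat -> form -> form.

Fixpoint teval (env : nat -> R) (t : term) : R :=
  match t with
  | TVar i => env i
  | TZero => 0
  | TOne => 1
  | TAdd a b => teval env a + teval env b
  | TMul a b => teval env a * teval env b
  | TNeg a => - teval env a
  end.

Definition upd (env : nat -> R) (i : nat) (x : R) : nat -> R :=
  fun j => if Nat.eqb j i then x else env j.

Fixpoint holds (env : nat -> R) (f : form) : Prop :=
  match f with
  | FEq a b => teval env a = teval env b
  | FLt a b => teval env a < teval env b
  | FNot g => ~ holds env g
  | FAnd g h => holds env g /\ holds env h
  | FOr g h => holds env g \/ holds env h
  | FEx i g => exists x : R, holds (upd env i x) g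
  | FAll i g => forall x : R, holds (upd env i x) g
  end.

Close Scope R_scope.
Inductive prf : Type :=
| PZero : prf
| PSucc : prf
| PProj : nat -> prf
| PComp : prf -> list prf -> prf
| PRec : prf -> prf -> prf
| PMin : prf -> prf.

Inductive eval : prf -> list nat -> nat -> Prop :=
| eZero args : eval PZero args 0
| eSucc args : eval PSucc args (S (hd 0 args))
| eProj i args : eval (PProj i) args (nth i args 0)
| eComp f gs args ys y :
    evals gs args ys -> eval f ys y -> eval (PComp f gs) args y
| eRec0 f g args y :
    hd 0 args = 0 -> eval f (tl args) y -> eval (PRec f g) args y
| eRecS f g k rest r y :
    eval (PRec f g) (k :: rest) r -> eval g (k :: r :: rest) y ->
    eval (PRec f g) (S k :: rest) y
| eMin f args y :
    eval f (y :: args) 0%nat ->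
    (forall z, (z < y)%nat -> exists v, v <> 0%nat /\ eval f (z :: args) v) ->
    eval (PMin f) args y
with evals : list prf -> list nat -> list nat -> Prop :=
| esNil args : evals [] args []
| esCons g gs args y ys :
    eval g args y -> evals gs args ys -> evals (g :: gs) args (y :: ys).

Definition cpair (a b : nat) : nat := ((a + b) * (a + b + 1)) / 2 + b.

Fixpoint code_term (t : term) : nat :=
  match t with
  | TVar i => cpair 0 i
  | TZero => cpair 1 0
  | TOne => cpair 2 0
  | TAdd a b => cpair 3 (cpair (code_term a) (code_term b))
  | TMul a b => cpair 4 (cpair (code_term a) (code_term b))
  | TNeg a => cpair 5 (code_term a)
  end.

Fixpoint code_form (f : form) : nat :=
  match f with
  | FEq a b => cpair 0 (cpair (code_term a) (code_term b))
  | FLt a b => cpair 1 (cpair (code_term a) (code_term b))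
  | FNot g => cpair 2 (code_form g)
  | FAnd g h => cpair 3 (cpair (code_form g) (code_form h))
  | FOr g h => cpair 4 (cpair (code_form g) (code_form h))
  | FEx i g => cpair 5 (cpair i (code_form g))
  | FAll i g => cpair 6 (cpair i (code_form g))
  end.

Open Scope R_scope.
Definition computable_subfield (F : R -> Prop) : Prop :=
  exists (nu : nat -> R) (z o : nat) (eadd emul eneg einv eeq : prf),
    (forall x, F x <-> exists i, nu i = x) /\
    nu z = 0 /\ nu o = 1 /\
    (forall i j, exists k, eval eadd [i; j] k /\ nu k = nu i + nu j) /\
    (forall i j, exists k, eval emul [i; j] k /\ nu k = nu i * nu j) /\
    (forall i, exists k, eval eneg [i] k /\ nu k = - nu i) /\
    (forall i, nu i <> 0 -> exists k, eval einv [i] k /\ nu k = / nu i) /\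
    (forall i j, exists b, eval eeq [i; j] b /\ (b = 1%nat <-> nu i = nu j)).

Definition env1 (x : R) : nat -> R := fun i => if Nat.eqb i 0 then x else 0.

Definition sufficiently_computable (F : R -> Prop) : Prop :=
  computable_subfield F /\
  exists e : prf, forall (psi : form) (a : R),
    (forall x, holds (env1 x) psi <-> x = a) ->
    exists b, eval e [code_form psi] b /\ (b = 1%nat <-> F a).

(* Main.v *)
(** Let [S] be the set of solutions of [phi] in R^n, and call a real number special if some coordinate takes it
    constantly on a nonempty relatively open box of [S]. The special values form a definable set, which is countable
    because boxes with rational corners suffice, hence finite. Discarding the points of [S] that have a coordinate
    both special and in [F] leaves a relatively open subset S' of [S], so no coordinate is constant with a value in
    [F] on an open piece of S'. As S' is locally closed near one of its points and [F] is countable, the Baire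
    category theorem gives a point of S' without coordinates in [F] as soon as S' is nonempty. Thus the question is
    whether S' is empty; the k-th special value is defined by a formula, so the oracle for [F] tells which special
    values to discard, and a sentence about the reals remains.

    The theory of the reals is decided by a search. An instance of a clause describes the truth of a formula under
    an assignment of ground terms to its variables, with terms for witnesses and for roots of polynomials. A sentence
    is false if finitely many instances together with that sentence are propositionally contradictory. Conversely,
    if they never are, then by compactness the sentence holds in a term model, which is a real closed field, and
    all real closed fields satisfy the same sentences. The last fact is a semantic form of the Cohen-Hormander
    elimination procedure: the signs of finitely many polynomials in the parameters determine how the signs of given
    polynomials in one more variable alternate along the line. *)

From Pilot Require Import Defs.
From Stdlib Require Import Reals List Arith.
From Stdlib Require Import Lra Lia Wf_nat Classical ClassicalEpsilon FunctionalExtensionality.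
From HB Require structures.
From mathcomp Require all_boot all_order all_algebra polyrcf ring lra zify Rstruct.
Import ListNotations.
Open Scope R_scope.

Set Implicit Arguments.
Local Open Scope nat_scope.

(** * Codes *)

(** Membership in [F] matters only for special values: any other coordinate can be moved off a
    prescribed element of [F] by an arbitrarily small change inside the solution set. Each special
    value is pinned down by a formula, so the oracle can be asked about it. But the oracle is
    guaranteed to answer only on formulas that define exactly one real, so the special values have
    to be counted before it is consulted.

    Every algorithm must be exhibited as a [prf]. This is why the reals are decided by a search and
    not by running an elimination: the search handles codes only through pairing, addition and
    binary digits, while elimination, which manipulates lists of polynomials, is needed only as a
    theorem comparing two real closed fields. Witness and root terms make the clauses
    quantifier-free, so a finite truth assignment is just a number and refutations are found by
    brute force. *)

Definition tri (n : nat) : nat := nat_rect (fun _ => nat) 0 (fun k r => r + S k) n.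
(** Index of the last triangular number not exceeding [n]: it grows by one exactly when the next
    triangular number is reached. Like [tri] it is written with [nat_rect], the shape realized by
    [PRec]. *)
Definition troot (n : nat) : nat :=
  nat_rect (fun _ => nat) 0 (fun k r => if tri (S r) <=? S k then S r else r) n.
Definition unpairr (n : nat) : nat := n - tri (troot n).
Definition unpairl (n : nat) : nat := troot n - unpairr n.

Lemma tri_S n : tri (S n) = tri n + S n.
Proof. reflexivity. Qed.

Lemma tri_double n : 2 * tri n = n * (n + 1).
Proof. induction n; [reflexivity|rewrite tri_S; lia]. Qed.

Lemma cpair_tri a b : cpair a b = tri (a + b) + b.
Proof.
  unfold cpair. f_equal. rewrite <- tri_double, Nat.mul_comm. apply Nat.div_mul. lia.
Qed.

Lemma tri_mono m n : m <= n -> tri m <= tri n.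
Proof. induction 1; [lia|rewrite tri_S; lia]. Qed.

Lemma troot_spec n : tri (troot n) <= n < tri (S (troot n)).
Proof.
  induction n as [|n IH]; [cbv; lia|].
  change (troot (S n)) with (if tri (S (troot n)) <=? S n then S (troot n) else troot n).
  destruct (Nat.leb_spec (tri (S (troot n))) (S n)).
  - rewrite (tri_S (S (troot n))). lia.
  - lia.
Qed.

Lemma troot_cpair a b : troot (cpair a b) = a + b.
Proof.
  pose proof (troot_spec (cpair a b)) as [H1 H2]. rewrite cpair_tri in *.
  assert (H : ~ a + b < troot (tri (a + b) + b)).
  { intro h. pose proof (tri_mono h). rewrite tri_S in H. lia. }
  assert (H' : ~ troot (tri (a + b) + b) < a + b).
  { intro h. pose proof (tri_mono h). lia. }
  lia.
Qed.

Lemma unpairr_cpair a b : unpairr (cpair a b) = b.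
Proof. unfold unpairr. rewrite troot_cpair, cpair_tri. lia. Qed.

Lemma unpairl_cpair a b : unpairl (cpair a b) = a.
Proof. unfold unpairl. rewrite troot_cpair, unpairr_cpair. lia. Qed.

Lemma cpair_unpair n : cpair (unpairl n) (unpairr n) = n.
Proof.
  pose proof (troot_spec n) as [H1 H2]. rewrite tri_S in H2.
  rewrite cpair_tri. unfold unpairl, unpairr.
  replace (troot n - (n - tri (troot n)) + (n - tri (troot n))) with (troot n) by lia. lia.
Qed.

Lemma le_cpair_l a b : a <= cpair a b.
Proof. rewrite cpair_tri. pose proof (tri_double (a + b)). nia. Qed.
Lemma le_cpair_r a b : b <= cpair a b.
Proof. rewrite cpair_tri. lia. Qed.
Lemma lt_cpair_r a b : 0 < a -> b < cpair a b.
Proof. intro H. rewrite cpair_tri. pose proof (tri_double (a + b)). nia. Qed.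
Lemma unpairl_le n : unpairl n <= n.
Proof. rewrite <- (cpair_unpair n) at 2. apply le_cpair_l. Qed.
Lemma unpairr_le n : unpairr n <= n.
Proof. rewrite <- (cpair_unpair n) at 2. apply le_cpair_r. Qed.
Lemma unpairr_lt n : 0 < unpairl n -> unpairr n < n.
Proof. intro H. rewrite <- (cpair_unpair n) at 2. now apply lt_cpair_r. Qed.

Global Opaque cpair.

(* Codes not in the range of [code_term] or [code_form] are decoded to junk, so that every number denotes a formula. *)
Fixpoint decode_term_fuel (k n : nat) : term :=
  match k with
  | 0 => TZero
  | S k =>
    let p := unpairr n in
    match unpairl n with
    | 0 => TVar p
    | 1 => TZero
    | 2 => TOne
    | 3 => TAdd (decode_term_fuel k (unpairl p)) (decode_term_fuel k (unpairr p))
    | 4 => TMul (decode_term_fuel k (unpairl p)) (decode_term_fuel k (unpairr p))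
    | 5 => TNeg (decode_term_fuel k p)
    | _ => TZero
    end
  end.
Definition decode_term n := decode_term_fuel (S n) n.

Fixpoint decode_form_fuel (k n : nat) : form :=
  match k with
  | 0 => FEq TZero TZero
  | S k =>
    let p := unpairr n in
    match unpairl n with
    | 0 => FEq (decode_term (unpairl p)) (decode_term (unpairr p))
    | 1 => FLt (decode_term (unpairl p)) (decode_term (unpairr p))
    | 2 => FNot (decode_form_fuel k p)
    | 3 => FAnd (decode_form_fuel k (unpairl p)) (decode_form_fuel k (unpairr p))
    | 4 => FOr (decode_form_fuel k (unpairl p)) (decode_form_fuel k (unpairr p))
    | 5 => FEx (unpairl p) (decode_form_fuel k (unpairr p))
    | 6 => FAll (unpairl p) (decode_form_fuel k (unpairr p))
    | _ => FEq TZero TZero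
    end
  end.
Definition decode_form n := decode_form_fuel (S n) n.

Lemma decode_term_fuel_indep k k' n : n < k -> n < k' -> decode_term_fuel k n = decode_term_fuel k' n.
Proof.
  revert k' n; induction k as [|k IH]; intros [|k'] n H H'; try lia.
  simpl. pose proof (@unpairr_lt n). pose proof (unpairl_le (unpairr n)). pose proof (unpairr_le (unpairr n)).
  destruct (unpairl n) as [|[|[|[|[|[|]]]]]]; try reflexivity; rewrite ?(IH k') by lia; reflexivity.
Qed.

Lemma decode_form_fuel_indep k k' n : n < k -> n < k' -> decode_form_fuel k n = decode_form_fuel k' n.
Proof.
  revert k' n; induction k as [|k IH]; intros [|k'] n H H'; try lia.
  simpl. pose proof (@unpairr_lt n). pose proof (unpairl_le (unpairr n)). pose proof (unpairr_le (unpairr n)).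
  destruct (unpairl n) as [|[|[|[|[|[|[|]]]]]]]; try reflexivity; rewrite ?(IH k') by lia; reflexivity.
Qed.

Lemma decode_term_var i : decode_term (cpair 0 i) = TVar i.
Proof. unfold decode_term; simpl. now rewrite unpairl_cpair, unpairr_cpair. Qed.
Lemma decode_term_zero : decode_term (cpair 1 0) = TZero.
Proof. unfold decode_term; simpl. now rewrite unpairl_cpair. Qed.
Lemma decode_term_one : decode_term (cpair 2 0) = TOne.
Proof. unfold decode_term; simpl. now rewrite unpairl_cpair. Qed.
Lemma decode_term_add a b : decode_term (cpair 3 (cpair a b)) = TAdd (decode_term a) (decode_term b).
Proof.
  pose proof (le_cpair_l a b); pose proof (le_cpair_r a b); pose proof (@lt_cpair_r 3 (cpair a b)).
  unfold decode_term at 1. simpl. rewrite !unpairl_cpair, !unpairr_cpair, !unpairl_cpair.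
  f_equal; apply decode_term_fuel_indep; lia.
Qed.
Lemma decode_term_mul a b : decode_term (cpair 4 (cpair a b)) = TMul (decode_term a) (decode_term b).
Proof.
  pose proof (le_cpair_l a b); pose proof (le_cpair_r a b); pose proof (@lt_cpair_r 4 (cpair a b)).
  unfold decode_term at 1. simpl. rewrite !unpairl_cpair, !unpairr_cpair, !unpairl_cpair.
  f_equal; apply decode_term_fuel_indep; lia.
Qed.
Lemma decode_term_neg a : decode_term (cpair 5 a) = TNeg (decode_term a).
Proof.
  pose proof (@lt_cpair_r 5 a).
  unfold decode_term at 1. simpl. rewrite !unpairl_cpair, !unpairr_cpair.
  f_equal; apply decode_term_fuel_indep; lia.
Qed.

Lemma decode_form_eq a b : decode_form (cpair 0 (cpair a b)) = FEq (decode_term a) (decode_term b).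
Proof. unfold decode_form. simpl. now rewrite !unpairl_cpair, !unpairr_cpair, !unpairl_cpair. Qed.
Lemma decode_form_lt a b : decode_form (cpair 1 (cpair a b)) = FLt (decode_term a) (decode_term b).
Proof. unfold decode_form. simpl. now rewrite !unpairl_cpair, !unpairr_cpair, !unpairl_cpair. Qed.
Lemma decode_form_not a : decode_form (cpair 2 a) = FNot (decode_form a).
Proof.
  pose proof (@lt_cpair_r 2 a).
  unfold decode_form at 1. simpl. rewrite !unpairl_cpair, !unpairr_cpair.
  f_equal; apply decode_form_fuel_indep; lia.
Qed.
Lemma decode_form_and a b : decode_form (cpair 3 (cpair a b)) = FAnd (decode_form a) (decode_form b).
Proof.
  pose proof (le_cpair_l a b); pose proof (le_cpair_r a b); pose proof (@lt_cpair_r 3 (cpair a b)).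
  unfold decode_form at 1. simpl. rewrite !unpairl_cpair, !unpairr_cpair, !unpairl_cpair.
  f_equal; apply decode_form_fuel_indep; lia.
Qed.
Lemma decode_form_or a b : decode_form (cpair 4 (cpair a b)) = FOr (decode_form a) (decode_form b).
Proof.
  pose proof (le_cpair_l a b); pose proof (le_cpair_r a b); pose proof (@lt_cpair_r 4 (cpair a b)).
  unfold decode_form at 1. simpl. rewrite !unpairl_cpair, !unpairr_cpair, !unpairl_cpair.
  f_equal; apply decode_form_fuel_indep; lia.
Qed.
Lemma decode_form_ex i a : decode_form (cpair 5 (cpair i a)) = FEx i (decode_form a).
Proof.
  pose proof (le_cpair_r i a); pose proof (@lt_cpair_r 5 (cpair i a)).
  unfold decode_form at 1. simpl. rewrite !unpairl_cpair, !unpairr_cpair, !unpairl_cpair.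
  f_equal; apply decode_form_fuel_indep; lia.
Qed.
Lemma decode_form_all i a : decode_form (cpair 6 (cpair i a)) = FAll i (decode_form a).
Proof.
  pose proof (le_cpair_r i a); pose proof (@lt_cpair_r 6 (cpair i a)).
  unfold decode_form at 1. simpl. rewrite !unpairl_cpair, !unpairr_cpair, !unpairl_cpair.
  f_equal; apply decode_form_fuel_indep; lia.
Qed.

(* Codes of ground objects: environments are coded association lists, the code 0 being the empty one, and a
   closure pairs a term code with an environment. *)
Definition econs i e s := S (cpair (cpair i e) s).
Definition eclos t s := cpair 0 (cpair t s).
Definition eadd a b := cpair 1 (cpair a b).
Definition emul a b := cpair 2 (cpair a b).
Definition eneg a := cpair 3 a.
Definition einv a := cpair 4 a.
Definition ewit i g s := cpair 5 (cpair i (cpair g s)).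
Definition eroot t s a b := cpair 6 (cpair t (cpair s (cpair a b))).
Definition ezero := cpair 7 0.
Definition eone := cpair 8 0.
Definition aholds f s := cpair 0 (cpair f s).
Definition aeq a b := cpair 1 (cpair a b).
Definition alt a b := cpair 2 (cpair a b).

(** * Values of ground codes in the reals *)

Fixpoint env_fuel (v : nat -> R) (k s : nat) : nat -> R :=
  match k, s with
  | S k, S m => upd (env_fuel v k (unpairr m)) (unpairl (unpairl m)) (v (unpairr (unpairl m)))
  | _, _ => fun _ => 0%R
  end.

(** An environment asks for values only at codes strictly below its own, and its tail has a smaller
    code. Hence fuel equal to the code is enough, and values can be defined by recursion through
    environments. *)
Lemma env_fuel_indep v v' k k' s : s <= k -> s <= k' -> (forall m, m < s -> v m = v' m) ->
  env_fuel v k s = env_fuel v' k' s.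
Proof.
  revert k' s; induction k as [|k IH]; intros [|k'] [|m] H H' Hv; try lia; try reflexivity.
  simpl. pose proof (unpairr_le m). pose proof (unpairl_le m). pose proof (unpairr_le (unpairl m)).
  rewrite (IH k'), (Hv (unpairr (unpairl m))) by (intros; try apply Hv; lia). reflexivity.
Qed.

Definition pick (P : R -> Prop) : R := epsilon (inhabits 0%R) P.

(** The tags are those of [eclos], [eadd], [emul], [eneg], [einv], [ewit], [eroot], [ezero], [eone].
    Tags 5 and 6 are Skolem terms: they choose a witness if there is one and an arbitrary real
    otherwise. *)
Definition gval_step (n : nat) (v : nat -> R) : R :=
  let p := unpairr n in
  match unpairl n with
  | 0 => teval (env_fuel v n (unpairr p)) (decode_term (unpairl p))
  | 1 => v (unpairl p) + v (unpairr p)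
  | 2 => v (unpairl p) * v (unpairr p)
  | 3 => - v p
  | 4 => / v p
  | 5 => pick (fun x => holds (upd (env_fuel v n (unpairr (unpairr p))) (unpairl p) x)
                          (decode_form (unpairl (unpairr p))))
  | 6 => let q := unpairr p in let r := unpairr q in
         pick (fun x => v (unpairl r) <= x <= v (unpairr r) /\
                 teval (upd (env_fuel v n (unpairl q)) 0%nat x) (decode_term (unpairl p)) = 0)
  | 7 => 0
  | _ => 1
  end%R.

(** A positive tag makes the components smaller than [n]. With tag 0 the code of the environment may
    equal [n] (both 0), which is harmless because an environment only consults codes below its
    own. *)
Lemma gval_step_indep n v v' : (forall m, m < n -> v m = v' m) -> gval_step n v = gval_step n v'.
Proof.
  intro Hv. unfold gval_step. set (p := unpairr n).
  pose proof (unpairr_le n) as L. fold p in L.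
  pose proof (unpairl_le p). pose proof (unpairr_le p).
  pose proof (unpairr_le (unpairr p)). pose proof (unpairl_le (unpairr p)).
  pose proof (unpairl_le (unpairr (unpairr p))). pose proof (unpairr_le (unpairr (unpairr p))).
  assert (E : forall s, s <= n -> env_fuel v n s = env_fuel v' n s).
  { intros s Hs. apply env_fuel_indep; auto. intros; apply Hv; lia. }
  pose proof (@unpairr_lt n) as L'. fold p in L'.
  destruct (unpairl n) as [|[|[|[|[|[|[|[|]]]]]]]]; try reflexivity;
    rewrite ?E by lia; rewrite ?(Hv (unpairl p)), ?(Hv (unpairr p)), ?(Hv p) by lia; try reflexivity.
  rewrite (Hv (unpairl (unpairr (unpairr p)))), (Hv (unpairr (unpairr (unpairr p)))) by lia. reflexivity.
Qed.

(** The default [0] outside the range of the recursion is never consulted, by [gval_step_indep]. *)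
Definition gval : nat -> R :=
  Fix lt_wf (fun _ => R) (fun n rec => gval_step n (fun m => match lt_dec m n with left h => rec m h | right _ => 0%R end)).

Lemma gval_eq n : gval n = gval_step n gval.
Proof.
  unfold gval at 1. rewrite Fix_eq.
  - apply gval_step_indep. intros m Hm. destruct (lt_dec m n); [reflexivity|contradiction].
  - intros x f g Hfg. apply gval_step_indep. intros m Hm. destruct (lt_dec m x); auto.
Qed.

Definition genv (s : nat) : nat -> R := env_fuel gval s s.

Lemma genv_fuel n s : s <= n -> env_fuel gval n s = genv s.
Proof. intro. apply env_fuel_indep; auto. Qed.

Lemma genv_0 : genv 0 = fun _ => 0%R.
Proof. reflexivity. Qed.
Lemma genv_cons i e s : genv (econs i e s) = upd (genv s) i (gval e).
Proof.
  unfold genv at 1, econs. simpl. rewrite !unpairl_cpair, !unpairr_cpair.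
  rewrite genv_fuel; [reflexivity|apply le_cpair_r].
Qed.

Ltac gval_tac := rewrite gval_eq; unfold gval_step; rewrite !unpairl_cpair, ?unpairr_cpair, ?unpairl_cpair, ?unpairr_cpair, ?unpairl_cpair, ?unpairr_cpair, ?unpairl_cpair.

Lemma gval_clos t s : gval (eclos t s) = teval (genv s) (decode_term t).
Proof.
  unfold eclos. gval_tac. rewrite genv_fuel; [reflexivity|].
  etransitivity; [apply (le_cpair_r t s)|apply le_cpair_r].
Qed.
Lemma gval_add a b : gval (eadd a b) = (gval a + gval b)%R.
Proof. unfold eadd. gval_tac. reflexivity. Qed.
Lemma gval_mul a b : gval (emul a b) = (gval a * gval b)%R.
Proof. unfold emul. gval_tac. reflexivity. Qed.
Lemma gval_neg a : gval (eneg a) = (- gval a)%R.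
Proof. unfold eneg. gval_tac. reflexivity. Qed.
Lemma gval_inv a : gval (einv a) = (/ gval a)%R.
Proof. unfold einv. gval_tac. reflexivity. Qed.
Lemma gval_zero : gval ezero = 0%R.
Proof. unfold ezero. gval_tac. reflexivity. Qed.
Lemma gval_one : gval eone = 1%R.
Proof. unfold eone. gval_tac. reflexivity. Qed.
Lemma gval_wit i g s : gval (ewit i g s) = pick (fun x => holds (upd (genv s) i x) (decode_form g)).
Proof.
  unfold ewit. gval_tac. rewrite genv_fuel; [reflexivity|].
  etransitivity; [apply (le_cpair_r g s)|]. etransitivity; [|apply le_cpair_r]. apply le_cpair_r.
Qed.
Lemma gval_root t s a b : gval (eroot t s a b) =
  pick (fun x => gval a <= x <= gval b /\ teval (upd (genv s) 0%nat x) (decode_term t) = 0)%R.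
Proof.
  unfold eroot. gval_tac. rewrite genv_fuel; [reflexivity|].
  etransitivity; [apply (le_cpair_l s (cpair a b))|]. etransitivity; [|apply le_cpair_r]. apply le_cpair_r.
Qed.

Global Opaque gval genv decode_term decode_form.

(** * Ground clauses *)

(* Templates for ground clauses; [XVar i] stands for the i-th parameter of an instance. *)
Inductive tmpl : Type :=
| XVar : nat -> tmpl
| XCst : nat -> tmpl
| XSucc : tmpl -> tmpl
| XAdd : tmpl -> tmpl -> tmpl
| XPair : tmpl -> tmpl -> tmpl.

Fixpoint inst (ps : nat -> nat) (x : tmpl) : nat :=
  match x with
  | XVar i => ps i
  | XCst n => n
  | XSucc x => S (inst ps x)
  | XAdd x y => inst ps x + inst ps y
  | XPair x y => cpair (inst ps x) (inst ps y)
  end.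

Definition clause : Type := list (bool * tmpl).

Definition clause_sat (v : nat -> bool) (ps : nat -> nat) (c : clause) : Prop :=
  Exists (fun l => v (inst ps (snd l)) = fst l) c.

Definition xcons i e s := XSucc (XPair (XPair i e) s).
Definition xclos t s := XPair (XCst 0) (XPair t s).
Definition xadd a b := XPair (XCst 1) (XPair a b).
Definition xmul a b := XPair (XCst 2) (XPair a b).
Definition xneg a := XPair (XCst 3) a.
Definition xinv a := XPair (XCst 4) a.
Definition xwit i g s := XPair (XCst 5) (XPair i (XPair g s)).
Definition xroot t s a b := XPair (XCst 6) (XPair t (XPair s (XPair a b))).
Definition xzero := XPair (XCst 7) (XCst 0).
Definition xone := XPair (XCst 8) (XCst 0).
Definition xholds f s := XPair (XCst 0) (XPair f s).
Definition xeq a b := XPair (XCst 1) (XPair a b).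
Definition xlt a b := XPair (XCst 2) (XPair a b).
Definition pos (a : tmpl) : bool * tmpl := (true, a).
Definition neg (a : tmpl) : bool * tmpl := (false, a).

(** Tarski's conditions on truth, with Henkin witnesses for the quantifiers. The witness for the
    negated body of a universal formula is a counterexample if there is any, so truth at that single
    term gives the universal statement. *)
Definition logic_clauses : list clause :=
  let f := XVar 0 in let g := XVar 1 in let s := XVar 2 in let i := XVar 3 in let e := XVar 4 in
  let node n a := XPair (XCst n) a in
  let node2 n a b := XPair (XCst n) (XPair a b) in
  [ [neg (xholds (node 2 f) s); neg (xholds f s)];
    [pos (xholds (node 2 f) s); pos (xholds f s)];
    [neg (xholds (node2 3 f g) s); pos (xholds f s)];
    [neg (xholds (node2 3 f g) s); pos (xholds g s)];
    [neg (xholds f s); neg (xholds g s); pos (xholds (node2 3 f g) s)];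
    [neg (xholds (node2 4 f g) s); pos (xholds f s); pos (xholds g s)];
    [neg (xholds f s); pos (xholds (node2 4 f g) s)];
    [neg (xholds g s); pos (xholds (node2 4 f g) s)];
    [neg (xholds (node2 5 i f) s); pos (xholds f (xcons i (xwit i f s) s))];
    [neg (xholds f (xcons i e s)); pos (xholds (node2 5 i f) s)];
    [neg (xholds (node2 6 i f) s); pos (xholds f (xcons i e s))];
    [neg (xholds f (xcons i (xwit i (node 2 f) s) s)); pos (xholds (node2 6 i f) s)];
    [neg (xholds (node2 0 f g) s); pos (xeq (xclos f s) (xclos g s))];
    [pos (xholds (node2 0 f g) s); neg (xeq (xclos f s) (xclos g s))];
    [neg (xholds (node2 1 f g) s); pos (xlt (xclos f s) (xclos g s))];
    [pos (xholds (node2 1 f g) s); neg (xlt (xclos f s) (xclos g s))] ].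

(** Clauses carry no side conditions, so distinct variable indices are presented as [i] and
    [i + d + 1], with one clause for each order of the two. The empty environment gives every
    variable the value zero. *)
Definition term_clauses : list clause :=
  let t := XVar 0 in let u := XVar 1 in let s := XVar 2 in let i := XVar 3 in let e := XVar 4 in
  let d := XVar 0 in
  let var j := XPair (XCst 0) j in
  let far := XSucc (XAdd i d) in
  [ [pos (xeq (xclos (var i) (xcons i e s)) e)];
    [pos (xeq (xclos (var far) (xcons i e s)) (xclos (var far) s))];
    [pos (xeq (xclos (var i) (xcons far e s)) (xclos (var i) s))];
    [pos (xeq (xclos (var i) (XCst 0)) xzero)];
    [pos (xeq (xclos (XPair (XCst 1) (XCst 0)) s) xzero)];
    [pos (xeq (xclos (XPair (XCst 2) (XCst 0)) s) xone)];
    [pos (xeq (xclos (XPair (XCst 3) (XPair t u)) s) (xadd (xclos t s) (xclos u s)))];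
    [pos (xeq (xclos (XPair (XCst 4) (XPair t u)) s) (xmul (xclos t s) (xclos u s)))];
    [pos (xeq (xclos (XPair (XCst 5) t) s) (xneg (xclos t s)))] ].

(** These are the congruences by which addition, multiplication, negation and order descend to
    classes of codes. In the term model inverses are taken on canonical representatives. *)
Definition eq_clauses : list clause :=
  let a := XVar 0 in let b := XVar 1 in let c := XVar 2 in let d := XVar 3 in
  [ [pos (xeq a a)];
    [neg (xeq a b); pos (xeq b a)];
    [neg (xeq a b); neg (xeq b c); pos (xeq a c)];
    [neg (xeq a b); neg (xeq c d); pos (xeq (xadd a c) (xadd b d))];
    [neg (xeq a b); neg (xeq c d); pos (xeq (xmul a c) (xmul b d))];
    [neg (xeq a b); pos (xeq (xneg a) (xneg b))];
    [neg (xeq a b); neg (xeq c d); neg (xlt a c); pos (xlt b d)] ].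

Definition field_clauses : list clause :=
  let a := XVar 0 in let b := XVar 1 in let c := XVar 2 in
  [ [pos (xeq (xadd a (xadd b c)) (xadd (xadd a b) c))];
    [pos (xeq (xadd a b) (xadd b a))];
    [pos (xeq (xadd xzero a) a)];
    [pos (xeq (xadd (xneg a) a) xzero)];
    [pos (xeq (xmul a (xmul b c)) (xmul (xmul a b) c))];
    [pos (xeq (xmul a b) (xmul b a))];
    [pos (xeq (xmul xone a) a)];
    [pos (xeq (xmul (xadd a b) c) (xadd (xmul a c) (xmul b c)))];
    [neg (xeq xone xzero)];
    [pos (xeq a xzero); pos (xeq (xmul (xinv a) a) xone)] ].

(** The last three clauses are the intermediate value property. With the literals of [prem] read as
    negated premises they say: if [a <= b] and the polynomial [t], in variable 0 with coefficients
    in [s], is at most zero at [a] and at least zero at [b], then the root term lies in the interval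
    and is a zero of [t]. *)
Definition order_clauses : list clause :=
  let a := XVar 0 in let b := XVar 1 in let c := XVar 2 in
  let t := XVar 2 in let s := XVar 3 in
  let at_ x := xclos t (xcons (XCst 0) x s) in
  let prem := [pos (xlt b a); pos (xlt xzero (at_ a)); pos (xlt (at_ b) xzero)] in
  [ [neg (xlt a a)];
    [neg (xlt a b); neg (xlt b c); pos (xlt a c)];
    [pos (xlt a b); pos (xeq a b); pos (xlt b a)];
    [neg (xlt a b); pos (xlt (xadd a c) (xadd b c))];
    [neg (xlt xzero a); neg (xlt xzero b); pos (xlt xzero (xmul a b))];
    prem ++ [neg (xlt (xroot t s a b) a)];
    prem ++ [neg (xlt b (xroot t s a b))];
    prem ++ [pos (xeq (at_ (xroot t s a b)) xzero)] ].

Definition rcf_clauses : list clause :=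
  logic_clauses ++ term_clauses ++ eq_clauses ++ field_clauses ++ order_clauses.

Definition models (v : nat -> bool) : Prop :=
  forall ps, Forall (clause_sat v ps) rcf_clauses.

(** * Soundness: the reals satisfy all instances of the clauses *)

Definition atom_true (n : nat) : Prop :=
  let p := unpairr n in
  match unpairl n with
  | 0 => holds (genv (unpairr p)) (decode_form (unpairl p))
  | 1 => gval (unpairl p) = gval (unpairr p)
  | _ => (gval (unpairl p) < gval (unpairr p))%R
  end.

Definition real_model (n : nat) : bool := if excluded_middle_informative (atom_true n) then true else false.

Lemma real_model_spec n : real_model n = true <-> atom_true n.
Proof. unfold real_model. destruct excluded_middle_informative; split; intro; try easy. Qed.

Lemma real_model_spec' n : real_model n = false <-> ~ atom_true n.
Proof. unfold real_model. destruct excluded_middle_informative; split; intro; try easy. Qed.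

Lemma atom_true_holds f s : atom_true (aholds f s) <-> holds (genv s) (decode_form f).
Proof. unfold atom_true, aholds. now rewrite !unpairl_cpair, !unpairr_cpair, !unpairl_cpair. Qed.
Lemma atom_true_eq a b : atom_true (aeq a b) <-> gval a = gval b.
Proof. unfold atom_true, aeq. now rewrite !unpairl_cpair, !unpairr_cpair, !unpairl_cpair. Qed.
Lemma atom_true_lt a b : atom_true (alt a b) <-> (gval a < gval b)%R.
Proof. unfold atom_true, alt. now rewrite !unpairl_cpair, !unpairr_cpair, !unpairl_cpair. Qed.

Lemma pick_spec (P : R -> Prop) x : P x -> P (pick P).
Proof. intro H. unfold pick. apply epsilon_spec. now exists x. Qed.

Lemma teval_continuity env t : continuity (fun x => teval (upd env 0%nat x) t).
Proof.
  induction t as [j| | |a IHa b IHb|a IHa b IHb|a IHa]; simpl.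
  - unfold upd. destruct (Nat.eqb j 0).
    + apply derivable_continuous, derivable_id.
    + now apply continuity_const.
  - now apply continuity_const.
  - now apply continuity_const.
  - exact (continuity_plus _ _ IHa IHb).
  - exact (continuity_mult _ _ IHa IHb).
  - exact (continuity_opp _ IHa).
Qed.

Lemma upd_same env i x : upd env i x i = x.
Proof. unfold upd. now rewrite Nat.eqb_refl. Qed.
Lemma upd_other env i j x : j <> i -> upd env i x j = env j.
Proof. intro H. unfold upd. now rewrite (proj2 (Nat.eqb_neq j i) H). Qed.

Lemma gval_root_spec t s a b : (gval a <= gval b)%R ->
  (gval (eclos t (econs 0 a s)) <= 0)%R -> (0 <= gval (eclos t (econs 0 b s)))%R ->
  (gval a <= gval (eroot t s a b) <= gval b /\ gval (eclos t (econs 0 (eroot t s a b) s)) = 0)%R.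
Proof.
  rewrite !gval_clos, !genv_cons. intros ab ha hb.
  rewrite gval_root.
  destruct (IVT_cor (fun x => teval (upd (genv s) 0 x) (decode_term t)) (gval a) (gval b)) as [x Hx]; auto.
  - apply teval_continuity.
  - nra.
  - exact (@pick_spec (fun x => gval a <= x <= gval b /\ teval (upd (genv s) 0%nat x) (decode_term t) = 0)%R x Hx).
Qed.

Fixpoint clause_true (ps : nat -> nat) (c : clause) : Prop :=
  match c with
  | [] => False
  | (b, x) :: c => (if b : bool then atom_true (inst ps x) else ~ atom_true (inst ps x)) \/ clause_true ps c
  end.

(** The double negation turns the falsity of all literals of a clause into a hypothesis. *)
Lemma real_model_clause ps (c : clause) : (~ clause_true ps c -> False) -> clause_sat real_model ps c.
Proof.
  intro H. apply NNPP in H. induction c as [|[b x] c IH]; [contradiction|].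
  destruct H as [H|H].
  - apply Exists_cons_hd. destruct b; [now apply real_model_spec|now apply real_model_spec'].
  - apply Exists_cons_tl. now apply IH.
Qed.

Lemma forall_clauses_app v ps l1 l2 :
  Forall (clause_sat v ps) l1 -> Forall (clause_sat v ps) l2 -> Forall (clause_sat v ps) (l1 ++ l2).
Proof. intros. now apply Forall_app. Qed.

Lemma inst_codes ps :
  (forall i e s, inst ps (xcons i e s) = econs (inst ps i) (inst ps e) (inst ps s)) /\
  (forall t s, inst ps (xclos t s) = eclos (inst ps t) (inst ps s)) /\
  (forall a b, inst ps (xadd a b) = eadd (inst ps a) (inst ps b)) /\
  (forall a b, inst ps (xmul a b) = emul (inst ps a) (inst ps b)) /\
  (forall a, inst ps (xneg a) = eneg (inst ps a)) /\
  (forall a, inst ps (xinv a) = einv (inst ps a)) /\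
  (forall i g s, inst ps (xwit i g s) = ewit (inst ps i) (inst ps g) (inst ps s)) /\
  (forall t s a b, inst ps (xroot t s a b) = eroot (inst ps t) (inst ps s) (inst ps a) (inst ps b)) /\
  inst ps (xzero) = ezero /\
  inst ps (xone) = eone /\
  (forall f s, inst ps (xholds f s) = aholds (inst ps f) (inst ps s)) /\
  (forall a b, inst ps (xeq a b) = aeq (inst ps a) (inst ps b)) /\
  (forall a b, inst ps (xlt a b) = alt (inst ps a) (inst ps b)).
Proof. repeat split. Qed.

Ltac split_clauses ps :=
  destruct (inst_codes ps) as (?E1 & ?E2 & ?E3 & ?E4 & ?E5 & ?E6 & ?E7 & ?E8 & ?E9 & ?E10 & ?E11 & ?E12 & ?E13);
  repeat apply Forall_cons; try apply Forall_nil;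
  apply real_model_clause; unfold pos, neg; cbn [clause_true app];
  repeat match goal with
    | |- context [inst ps (xcons ?i ?e ?s)] => rewrite (E1 i e s)
    | |- context [inst ps (xclos ?t ?s)] => rewrite (E2 t s)
    | |- context [inst ps (xadd ?a ?b)] => rewrite (E3 a b)
    | |- context [inst ps (xmul ?a ?b)] => rewrite (E4 a b)
    | |- context [inst ps (xneg ?a)] => rewrite (E5 a)
    | |- context [inst ps (xinv ?a)] => rewrite (E6 a)
    | |- context [inst ps (xwit ?i ?g ?s)] => rewrite (E7 i g s)
    | |- context [inst ps (xroot ?t ?s ?a ?b)] => rewrite (E8 t s a b)
    | |- context [inst ps xzero] => rewrite E9
    | |- context [inst ps xone] => rewrite E10
    | |- context [inst ps (xholds ?f ?s)] => rewrite (E11 f s)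
    | |- context [inst ps (xeq ?a ?b)] => rewrite (E12 a b)
    | |- context [inst ps (xlt ?a ?b)] => rewrite (E13 a b)
    end;
  clear E1 E2 E3 E4 E5 E6 E7 E8 E9 E10 E11 E12 E13; cbn [inst];
  generalize gval_zero gval_one; generalize ezero eone; intros ?z ?o ?Z ?O;
  rewrite ?atom_true_holds, ?atom_true_eq, ?atom_true_lt;
  rewrite ?decode_form_eq, ?decode_form_lt, ?decode_form_not, ?decode_form_and, ?decode_form_or, ?decode_form_ex, ?decode_form_all;
  rewrite ?gval_clos, ?genv_cons, ?genv_0, ?gval_add, ?gval_mul, ?gval_neg, ?gval_inv;
  rewrite ?gval_add, ?gval_clos, ?Z, ?O;
  rewrite ?decode_term_var, ?decode_term_zero, ?decode_term_one, ?decode_term_add, ?decode_term_mul, ?decode_term_neg;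
  cbn [holds teval].

Lemma real_model_logic ps : Forall (clause_sat real_model ps) logic_clauses.
Proof.
  unfold logic_clauses. split_clauses ps; rewrite ?gval_wit; try tauto.
  - intro H; apply H; left; intros [x Hx]; apply H; right; left.
    exact (@pick_spec (fun y => holds (upd (genv (ps 2)) (ps 3) y) (decode_form (ps 0))) x Hx).
  - intro H; apply H; left; intro Hx; apply H; right; left; eauto.
  - intro H; apply H; left; intro Hx; apply H; right; left; auto.
  - intro H; apply H; right; left. intro x. apply NNPP; intro Hx. apply H; left.
    rewrite decode_form_not.
    exact (@pick_spec (fun y => holds (upd (genv (ps 2)) (ps 3) y) (FNot (decode_form (ps 0)))) x Hx).
Qed.

Lemma real_model_term ps : Forall (clause_sat real_model ps) term_clauses.
Proof.
  unfold term_clauses. split_clauses ps; rewrite ?gval_clos; try tauto.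
  - rewrite upd_same. tauto.
  - rewrite upd_other by lia. tauto.
  - rewrite upd_other by lia. tauto.
Qed.

Lemma real_model_eq ps : Forall (clause_sat real_model ps) eq_clauses.
Proof.
  unfold eq_clauses. split_clauses ps; intro H.
  all: repeat match type of H with ~ (_ \/ _) => apply not_or_and in H; destruct H as [?H H]; try apply NNPP in H0 end.
  all: repeat match goal with K : ~ ~ _ |- _ => apply NNPP in K end.
  all: try congruence.
  all: lra.
Qed.

Lemma real_model_field ps : Forall (clause_sat real_model ps) field_clauses.
Proof.
  unfold field_clauses. split_clauses ps; intro H.
  all: repeat match type of H with ~ (_ \/ _) => apply not_or_and in H; destruct H as [?H H] end.
  all: repeat match goal with K : ~ ~ _ |- _ => apply NNPP in K end.
  all: try (match goal with K : _ <> _ |- _ => apply K; ring end).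
  - lra.
  - match goal with K : (_ * _)%R <> _ |- _ => apply K end. now field.
Qed.

Lemma real_model_order ps : Forall (clause_sat real_model ps) order_clauses.
Proof.
  unfold order_clauses. split_clauses ps; intro H.
  all: repeat match type of H with ~ (_ \/ _) => apply not_or_and in H; destruct H as [?H H] end.
  all: repeat match goal with K : ~ ~ _ |- _ => apply NNPP in K end.
  1-4: lra.
  1: match goal with K : ~ (_ < _ * _)%R |- _ => apply K end; now apply Rmult_lt_0_compat.
  all: destruct (gval_root_spec (ps 2) (ps 3) (ps 0) (ps 1)) as [[G1 G2] G3];
    rewrite ?gval_clos, ?genv_cons in *; lra.
Qed.

Lemma real_model_models : models real_model.
Proof.
  intro ps. unfold rcf_clauses.
  repeat apply forall_clauses_app; auto using real_model_logic, real_model_term, real_model_eq, real_model_field, real_model_order.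
Qed.

(** * Computable functions *)

Definition computable (m : nat) (F : list nat -> nat) : Prop :=
  exists e, forall l, length l = m -> eval e l (F l).

Definition computable1 (f : nat -> nat) := exists e, forall x, eval e [x] (f x).
Definition computable2 (f : nat -> nat -> nat) := exists e, forall x y, eval e [x; y] (f x y).
Definition computable3 (f : nat -> nat -> nat -> nat) := exists e, forall x y z, eval e [x; y; z] (f x y z).

Lemma computable1_intro f : computable 1 (fun l => f (nth 0 l 0)) -> computable1 f.
Proof. intros [e He]. exists e. intro x. exact (He [x] eq_refl). Qed.
Lemma computable2_intro f : computable 2 (fun l => f (nth 0 l 0) (nth 1 l 0)) -> computable2 f.
Proof. intros [e He]. exists e. intros x y. exact (He [x; y] eq_refl). Qed.
Lemma computable3_intro f : computable 3 (fun l => f (nth 0 l 0) (nth 1 l 0) (nth 2 l 0)) -> computable3 f.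
Proof. intros [e He]. exists e. intros x y z. exact (He [x; y; z] eq_refl). Qed.

Lemma computable_arg m i : computable m (fun l => nth i l 0).
Proof. exists (PProj i). intros. constructor. Qed.

Lemma computable_app1 f m G : computable1 f -> computable m G -> computable m (fun l => f (G l)).
Proof.
  intros [e He] [g Hg]. exists (PComp e [g]). intros l Hl. econstructor; [|apply He].
  repeat constructor; auto.
Qed.
Lemma computable_app2 f m G H : computable2 f -> computable m G -> computable m H -> computable m (fun l => f (G l) (H l)).
Proof.
  intros [e He] [g Hg] [h Hh]. exists (PComp e [g; h]). intros l Hl. econstructor; [|apply He].
  repeat constructor; auto.
Qed.
Lemma computable_app3 f m G H K : computable3 f -> computable m G -> computable m H -> computable m K ->
  computable m (fun l => f (G l) (H l) (K l)).
Proof.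
  intros [e He] [g Hg] [h Hh] [k Hk]. exists (PComp e [g; h; k]). intros l Hl. econstructor; [|apply He].
  repeat constructor; auto.
Qed.

Lemma computable1_succ : computable1 S.
Proof. exists PSucc. intro x. apply (eSucc [x]). Qed.

Lemma computable_const n m : computable m (fun _ => n).
Proof.
  induction n as [|n IH]; [exists PZero; intros; constructor|].
  exact (computable_app1 computable1_succ IH).
Qed.

Lemma eval_rec m e f z s : (forall l, length l = m -> eval e l (z l)) ->
  (forall k r l, length l = m -> eval f (k :: r :: l) (s k r l)) ->
  forall n l, length l = m -> eval (PRec e f) (n :: l) (nat_rect (fun _ => nat) (z l) (fun k r => s k r l) n).
Proof.
  intros He Hf n l Hl. induction n as [|n IH]; simpl.
  - apply eRec0; [reflexivity|]. now apply He.
  - eapply eRecS; [exact IH|]. now apply Hf.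
Qed.

Lemma computable1_rec z s : computable2 s -> computable1 (fun x => nat_rect (fun _ => nat) z s x).
Proof.
  intros [f Hf]. destruct (computable_const z 0) as [e He]. exists (PRec e f). intro x.
  apply (@eval_rec 0 e f (fun _ => z) (fun k r _ => s k r)); auto.
  intros k r [|] H; [apply Hf|discriminate].
Qed.
Lemma computable2_rec z s : computable1 z -> computable3 s ->
  computable2 (fun x y => nat_rect (fun _ => nat) (z y) (fun k r => s k r y) x).
Proof.
  intros [e He] [f Hf]. exists (PRec e f). intros x y.
  apply (@eval_rec 1 e f (fun l => z (nth 0 l 0)) (fun k r l => s k r (nth 0 l 0))).
  - intros [|a [|]] H; try discriminate. apply He.
  - intros k r [|a [|]] H; try discriminate. apply Hf.
  - reflexivity.
Qed.
Lemma computable3_rec z s : computable2 z -> computable 4 (fun l => s (nth 0 l 0) (nth 1 l 0) (nth 2 l 0) (nth 3 l 0)) ->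
  computable3 (fun x y w => nat_rect (fun _ => nat) (z y w) (fun k r => s k r y w) x).
Proof.
  intros [e He] [f Hf]. exists (PRec e f). intros x y w.
  apply (@eval_rec 2 e f (fun l => z (nth 0 l 0) (nth 1 l 0)) (fun k r l => s k r (nth 0 l 0) (nth 1 l 0))).
  - intros [|a [|b [|]]] H; try discriminate. apply He.
  - intros k r [|a [|b [|]]] H; try discriminate. exact (Hf [k; r; a; b] eq_refl).
  - reflexivity.
Qed.

Create HintDb comp.
#[local] Hint Resolve computable1_succ : comp.

Ltac compute_fun :=
  repeat match goal with
  | |- computable1 (fun x => @?b x) => apply computable1_intro
  | |- computable2 (fun x y => @?b x y) => apply computable2_intro
  | |- computable3 (fun x y z => @?b x y z) => apply computable3_intro
  end; cbv beta;
  repeat first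
  [ apply computable_arg | apply computable_const
  | eapply computable_app3; [solve [eauto with comp]| | |]
  | eapply computable_app2; [solve [eauto with comp]| |]
  | eapply computable_app1; [solve [eauto with comp]|] ].

Lemma computable2_add : computable2 Nat.add.
Proof.
  destruct (@computable2_rec (fun y => y) (fun k r y => S r)) as [e He].
  - compute_fun.
  - compute_fun.
  - exists e. intros x y. replace (x + y) with (nat_rect (fun _ => nat) y (fun _ r => S r) x); [apply He|].
    induction x; simpl; congruence.
Qed.
#[local] Hint Resolve computable2_add : comp.

Lemma computable2_mul : computable2 Nat.mul.
Proof.
  destruct (@computable2_rec (fun y => 0) (fun k r y => y + r)) as [e He].
  - compute_fun.
  - compute_fun.
  - exists e. intros x y. replace (x * y) with (nat_rect (fun _ => nat) 0 (fun _ r => y + r) x); [apply He|].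
    induction x; simpl; congruence.
Qed.
#[local] Hint Resolve computable2_mul : comp.

Lemma computable1_pred : computable1 Nat.pred.
Proof.
  destruct (@computable1_rec 0 (fun k r => k)) as [e He].
  - compute_fun.
  - exists e. intro x. replace (Nat.pred x) with (nat_rect (fun _ => nat) 0 (fun k r => k) x); [apply He|].
    destruct x; reflexivity.
Qed.
#[local] Hint Resolve computable1_pred : comp.

Lemma computable2_sub : computable2 Nat.sub.
Proof.
  destruct (@computable2_rec (fun y => y) (fun k r y => Nat.pred r)) as [e He].
  - compute_fun.
  - compute_fun.
  - assert (H : computable2 (fun y x => nat_rect (fun _ => nat) y (fun _ r => Nat.pred r) x)).
    { assert (H : computable2 (fun x y => nat_rect (fun _ => nat) y (fun _ r => Nat.pred r) x)) by (exists e; exact He).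
      apply computable2_intro. apply (computable_app2 H); apply computable_arg. }
    destruct H as [e' He']. exists e'. intros y x.
    replace (y - x) with (nat_rect (fun _ => nat) y (fun _ r => Nat.pred r) x); [apply He'|].
    induction x; simpl; [lia|rewrite IHx; lia].
Qed.
#[local] Hint Resolve computable2_sub : comp.

Definition leq01 (a b : nat) : nat := 1 - (a - b).
Lemma leq01_spec a b : leq01 a b = if a <=? b then 1 else 0.
Proof. unfold leq01. destruct (Nat.leb_spec a b); lia. Qed.
Lemma computable2_leq01 : computable2 leq01.
Proof. unfold leq01. compute_fun. Qed.
#[local] Hint Resolve computable2_leq01 : comp.

Lemma computable1_tri : computable1 tri.
Proof. apply computable1_rec. compute_fun. Qed.
#[local] Hint Resolve computable1_tri : comp.

Lemma computable1_troot : computable1 troot.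
Proof.
  destruct (@computable1_rec 0 (fun k r => r + leq01 (tri (S r)) (S k))) as [e He]; [compute_fun|].
  exists e. intro x. replace (troot x) with (nat_rect (fun _ => nat) 0 (fun k r => r + leq01 (tri (S r)) (S k)) x); [apply He|].
  unfold troot. induction x as [|x IH]; [reflexivity|]. cbn [nat_rect]. rewrite IH, leq01_spec.
  destruct (_ <=? _); lia.
Qed.
#[local] Hint Resolve computable1_troot : comp.

Lemma computable1_unpairr : computable1 unpairr.
Proof. unfold unpairr. compute_fun. Qed.
#[local] Hint Resolve computable1_unpairr : comp.
Lemma computable1_unpairl : computable1 unpairl.
Proof. unfold unpairl. compute_fun. Qed.
#[local] Hint Resolve computable1_unpairl : comp.
Lemma computable2_cpair : computable2 cpair.
Proof.
  assert (H : computable2 (fun a b => tri (a + b) + b)) by compute_fun.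
  destruct H as [e He]. exists e. intros a b. rewrite cpair_tri. apply He.
Qed.
#[local] Hint Resolve computable2_cpair : comp.

(** * Truth assignments as binary expansions *)

(** The floors of k/2 and (k+1)/2 add up to k, which gives the recursion. A number [s] stores a
    truth assignment, with [bit i s] the value of atom [i]. *)
Definition half (n : nat) : nat := nat_rect (fun _ => nat) 0 (fun k r => k - r) n.
Definition odd01 (n : nat) : nat := n - (half n + half n).
Definition bit (i s : nat) : nat := odd01 (nat_rect (fun _ => nat) s (fun _ r => half r) i).
Definition pow2 (n : nat) : nat := nat_rect (fun _ => nat) 1 (fun _ r => r + r) n.

Lemma computable1_half : computable1 half.
Proof. apply computable1_rec. compute_fun. Qed.
#[local] Hint Resolve computable1_half : comp.
Lemma computable2_bit : computable2 bit.
Proof.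
  assert (H : computable2 (fun i s => nat_rect (fun _ => nat) s (fun _ r => half r) i)).
  { apply (@computable2_rec (fun s => s) (fun k r y => half r)); compute_fun. }
  unfold bit, odd01. apply computable2_intro.
  repeat first [eapply (computable_app2 computable2_sub)|eapply (computable_app2 computable2_add)|eapply (computable_app1 computable1_half)
    |apply (computable_app2 H)|apply computable_arg].
Qed.
#[local] Hint Resolve computable2_bit : comp.
Lemma computable1_pow2 : computable1 pow2.
Proof. apply computable1_rec. compute_fun. Qed.
#[local] Hint Resolve computable1_pow2 : comp.

Lemma half_spec n : n = half n + half n + odd01 n /\ odd01 n <= 1.
Proof.
  assert (H : 2 * half n <= n <= 2 * half n + 1).
  { induction n as [|n IH]; [cbv; lia|]. change (half (S n)) with (n - half n). lia. }
  unfold odd01. lia.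
Qed.

Lemma half_bit b s : b <= 1 -> half (s + s + b) = s /\ odd01 (s + s + b) = b.
Proof. intro Hb. pose proof (half_spec (s + s + b)). lia. Qed.

Lemma bit_S i s : bit (S i) s = bit i (half s).
Proof.
  unfold bit. f_equal. induction i; [reflexivity|]. cbn [nat_rect] in *. now rewrite IHi.
Qed.

Lemma bits_exist (v : nat -> bool) n : exists s, s < pow2 n /\ forall i, i < n -> bit i s = if v i then 1 else 0.
Proof.
  revert v; induction n as [|n IH]; intro v.
  - exists 0. split; [cbv; lia|intros; lia].
  - destruct (IH (fun i => v (S i))) as (s & Hs & Hb).
    destruct (@half_bit (if v 0 then 1 else 0) s) as [H1 H2]; [destruct (v 0); lia|].
    exists (s + s + (if v 0 then 1 else 0)). split.
    + change (pow2 (S n)) with (pow2 n + pow2 n). destruct (v 0); lia.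
    + intros [|i] Hi; [exact H2|]. rewrite bit_S, H1. apply Hb. lia.
Qed.

Lemma bit_le1 i s : bit i s <= 1.
Proof. unfold bit. apply half_spec. Qed.

(** * Search for a refutation *)

(** One number carries arbitrarily many parameters as an iterated pair, so running through [k] runs
    through all instances of a clause. *)
Fixpoint param (i k : nat) : nat := match i with 0 => unpairl k | S i => param i (unpairr k) end.
Definition params (k i : nat) : nat := param i k.

Definition lit_false (b : bool) (N s a : nat) : nat := leq01 (S a) N * (if b then 1 - bit a s else bit a s).

Fixpoint clause_false (c : clause) (N s k : nat) : nat :=
  match c with
  | [] => 1
  | (b, x) :: c => lit_false b N s (inst (params k) x) * clause_false c N s k
  end.

Fixpoint some_false (cs : list clause) (N s k : nat) : nat :=
  match cs with
  | [] => 0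
  | c :: cs => clause_false c N s k + some_false cs N s k
  end.

Definition conflict (N s : nat) : nat :=
  nat_rect (fun _ => nat) 0 (fun k r => r + some_false rcf_clauses N s k) N.

(* Nonzero when no truth assignment to the atoms below N satisfies the first N instances of the clauses
   and gives the sentence with code c the value b; literals on atoms beyond N count as satisfiable. *)
Definition refuted (b : bool) (N c : nat) : nat :=
  nat_rect (fun _ => nat) 1 (fun s r => r * (conflict N s + lit_false b N s (aholds c 0))) (pow2 N).

Lemma conflict_spec N s : conflict N s <> 0 <-> exists k c, k < N /\ In c rcf_clauses /\ clause_false c N s k <> 0.
Proof.
  assert (H : forall cs k, some_false cs N s k <> 0 <-> exists c, In c cs /\ clause_false c N s k <> 0).
  { intros cs k. induction cs as [|c cs IH]; simpl.
    - split; [lia|intros (? & [] & _)].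
    - split.
      + intro H. destruct (Nat.eq_dec (clause_false c N s k) 0) as [e|e].
        * destruct (proj1 IH) as (c' & h1 & h2); [lia|eauto].
        * eauto.
      + intros (c' & [->|h1] & h2); [lia|]. enough (some_false cs N s k <> 0) by lia. apply IH. eauto. }
  unfold conflict. enough (G : forall n, nat_rect (fun _ => nat) 0 (fun k r => r + some_false rcf_clauses N s k) n <> 0 <->
    exists k c, k < n /\ In c rcf_clauses /\ clause_false c N s k <> 0) by exact (G N).
  intro n. induction n as [|n IH]; cbn [nat_rect].
  - split; [lia|intros (? & ? & ? & _); lia].
  - split.
    + intro h. destruct (Nat.eq_dec (some_false rcf_clauses N s n) 0) as [e|e].
      * destruct (proj1 IH) as (k & c & h1 & h2); [lia|]. exists k, c. split; [lia|auto].
      * apply H in e. destruct e as (c & e). exists n, c. split; [lia|auto].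
    + intros (k & c & h1 & h2 & h3). destruct (Nat.eq_dec k n) as [->|e].
      * enough (some_false rcf_clauses N s n <> 0) by lia. apply H. eauto.
      * enough (nat_rect (fun _ => nat) 0 (fun k r => r + some_false rcf_clauses N s k) n <> 0) by lia.
        apply IH. exists k, c. split; [lia|auto].
Qed.

Lemma refuted_spec b N c : refuted b N c <> 0 <->
  forall s, s < pow2 N -> conflict N s <> 0 \/ lit_false b N s (aholds c 0) <> 0.
Proof.
  unfold refuted. generalize (pow2 N). intro n. induction n as [|n IH]; simpl.
  - split; [intros; lia|lia].
  - split.
    + intros h s hs. destruct (Nat.eq_dec s n) as [->|e]; [lia|]. apply IH; lia.
    + intro h. apply Nat.neq_mul_0. split.
      * apply IH. intros s hs. apply h. lia.
      * specialize (h n). lia.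
Qed.

Lemma lit_false_spec (v : nat -> bool) b N s a : (forall i, i < N -> bit i s = if v i then 1 else 0) ->
  lit_false b N s a <> 0 -> v a <> b.
Proof.
  unfold lit_false. rewrite leq01_spec. destruct (Nat.leb_spec (S a) N); [|lia].
  intros h. rewrite h by lia. destruct b, (v a); simpl; congruence || lia.
Qed.

Lemma lit_false_intro (v : nat -> bool) b N s a : a < N -> bit a s = (if v a then 1 else 0) ->
  v a <> b -> lit_false b N s a <> 0.
Proof.
  unfold lit_false. rewrite leq01_spec. intros h ->. destruct (Nat.leb_spec (S a) N); [|lia].
  destruct b, (v a); simpl; congruence || lia.
Qed.

(** The values of a model on the atoms below [N] form one of the assignments [s]. It satisfies every
    instance, so the contradiction found for it must lie in the literal of the sentence. *)
Lemma refuted_sound b N c v : models v -> refuted b N c <> 0 -> v (aholds c 0) <> b.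
Proof.
  intros Mv. rewrite refuted_spec. destruct (bits_exist v N) as (s & hs & hb). intro h.
  destruct (h s hs) as [h'|h']; [|exact (@lit_false_spec v b N s _ hb h')].
  apply conflict_spec in h'. destruct h' as (k & cl & _ & hin & hf). exfalso.
  pose proof (proj1 (Forall_forall _ _) (Mv (params k)) cl hin) as hsat.
  clear hin h. induction hsat as [[b' x] cl e|[b' x] cl hsat IH]; simpl in hf.
  - simpl in e. apply (@lit_false_spec v b' N s (inst (params k) x)); auto. lia.
  - apply IH. lia.
Qed.

(** * Compactness *)

Fixpoint tmpl_bound (x : tmpl) : nat :=
  match x with
  | XVar i => S i
  | XCst _ => 0
  | XSucc x => tmpl_bound x
  | XAdd x y | XPair x y => Nat.max (tmpl_bound x) (tmpl_bound y)
  end.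

Lemma inst_ext ps ps' x n : tmpl_bound x <= n -> (forall i, i < n -> ps i = ps' i) -> inst ps x = inst ps' x.
Proof.
  intros h e. induction x; simpl in *; rewrite ?IHx, ?IHx1, ?IHx2 by lia; auto.
Qed.

(** Parameters range over [XVar 0] to [XVar 4]. Five values of [ps] thus fix an instance, and a
    single number supplies them. *)
Lemma rcf_clauses_bound : forallb (forallb (fun l : bool * tmpl => tmpl_bound (snd l) <=? 5)) rcf_clauses = true.
Proof. reflexivity. Qed.

Lemma params_exist (ps : nat -> nat) n : exists k, forall i, i < n -> params k i = ps i.
Proof.
  revert ps; induction n as [|n IH]; intro ps.
  - exists 0. intros; lia.
  - destruct (IH (fun i => ps (S i))) as [k hk]. exists (cpair (ps 0) k). unfold params in *.
    intros [|i] hi; simpl; [apply unpairl_cpair|]. rewrite unpairr_cpair. apply hk. lia.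
Qed.

(** An instance involves finitely many atoms, so its failure under [v] would already show in a long
    enough approximation [s]. *)
Lemma limit_models b c (v : nat -> bool) :
  (forall m, exists N s, m <= N /\ (forall i, i < m -> bit i s = if v i then 1 else 0) /\
     conflict N s = 0 /\ lit_false b N s (aholds c 0) = 0) ->
  models v /\ v (aholds c 0) = b.
Proof.
  intro H. split.
  - intro ps. apply Forall_forall. intros cl hin. apply NNPP. intro hn.
    destruct (params_exist ps 5) as (k & hk).
    (* Above the number of the instance and above all its atoms, so that [N] cuts off neither. *)
    set (m := S (k + fold_right Nat.max 0 (map (fun l : bool * tmpl => inst ps (snd l)) cl))).
    destruct (H m) as (N & s & hm & hb & h0 & _).
    assert (hf : clause_false cl N s k <> 0); [|apply (proj2 (conflict_spec N s)); [exists k, cl; repeat split; auto; lia|assumption]].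
    clear h0. pose proof (proj1 (forallb_forall _ _) rcf_clauses_bound cl hin) as bd. clear hin H.
    assert (hmax : forall l : bool * tmpl, In l cl -> inst ps (snd l) < m).
    { intros l hl. unfold m. clear - hl. induction cl as [|l' cl IH]; [contradiction|].
      destruct hl as [->|hl]; simpl; [|specialize (IH hl)]; lia. }
    clearbody m. induction cl as [|[b' x] cl IH]; simpl; [lia|].
    simpl in bd. apply andb_prop in bd as [bd1 bd2]. apply Nat.leb_le in bd1.
    rewrite (@inst_ext (params k) ps x 5 bd1 hk).
    pose proof (hmax _ (or_introl eq_refl)) as hx. simpl in hx.
    apply Nat.neq_mul_0. split.
    + apply (@lit_false_intro v); [lia|auto|]. intro e. apply hn. now apply Exists_cons_hd.
    + apply IH; auto. * intro e. apply hn. now apply Exists_cons_tl. * intros l hl. apply hmax. now right.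
  - apply NNPP. intro hn. destruct (H (S (aholds c 0))) as (N & s & hm & hb & _ & h0).
    apply (@lit_false_intro v b N s (aholds c 0)); auto.
Qed.

(** Koenig's lemma for the binary tree: the prefix [pre m] agrees with pairs satisfying [P] for
    arbitrarily large [N]. It is prolonged by [true] if this property survives, and by [false]
    otherwise. *)
Lemma konig (P : nat -> nat -> Prop) : (forall n, exists N s, n <= N /\ P N s) ->
  exists v : nat -> bool, forall m, exists N s, m <= N /\ (forall i, i < m -> bit i s = if v i then 1 else 0) /\ P N s.
Proof.
  intro H.
  set (agree w m s := forall i, i < m -> bit i s = if (w i : bool) then 1 else 0).
  set (good m w := forall n, exists N s, n <= N /\ agree w m s /\ P N s).
  set (set w m b := fun i => if Nat.eqb i m then b else (w i : bool)).
  set (pre := fix pre m : nat -> bool := match m with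
    | 0 => fun _ => false
    | S m => let w := pre m in if excluded_middle_informative (good (S m) (set w m true)) then set w m true else set w m false
    end).
  assert (setE : forall w m b i, i < m -> set w m b i = w i).
  { intros w m b i hi. unfold set. destruct (Nat.eqb_spec i m); [lia|reflexivity]. }
  assert (setE' : forall w m b, set w m b m = b).
  { intros w m b. unfold set. now rewrite Nat.eqb_refl. }
  assert (Hgood : forall m, good m (pre m)).
  { induction m as [|m IH].
    - intro n. destruct (H n) as (N & s & h1 & h2). exists N, s. repeat split; auto. intros i hi; lia.
    - simpl. destruct (excluded_middle_informative _) as [g|g]; [exact g|].
      intro n. apply not_all_ex_not in g as [n0 g].
      (* From [n0] on nothing agrees with the extension by [true], so the next digit of [s] is 0. *)
      destruct (IH (Nat.max n n0)) as (N & s & h1 & h2 & h3). exists N, s.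
      split; [lia|split; [|exact h3]]. intros i hi. destruct (Nat.eq_dec i m) as [->|e].
      + rewrite setE'. pose proof (bit_le1 m s). destruct (Nat.eq_dec (bit m s) 1) as [e|e]; [|lia].
        exfalso. apply g. exists N, s. split; [lia|split; [|exact h3]].
        intros j hj. destruct (Nat.eq_dec j m) as [->|e'].
        * now rewrite setE'.
        * rewrite setE by lia. apply h2. lia.
      + rewrite setE by lia. apply h2. lia. }
  assert (Hpre : forall m i, i < m -> pre m i = pre (S i) i).
  { induction m as [|m IH]; intros i hi; [lia|]. destruct (Nat.eq_dec i m) as [->|e]; [reflexivity|].
    rewrite <- IH by lia. simpl. destruct (excluded_middle_informative _); apply setE; lia. }
  exists (fun i => pre (S i) i). intro m. destruct (Hgood m m) as (N & s & h1 & h2 & h3).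
  exists N, s. split; [lia|split; [|exact h3]]. intros i hi. rewrite (h2 i hi), (Hpre m i hi). reflexivity.
Qed.

Lemma refuted_complete b c : (forall v, models v -> v (aholds c 0) <> b) -> exists N, refuted b N c <> 0.
Proof.
  intro H. apply NNPP. intro hn.
  destruct (konig (fun N s => conflict N s = 0 /\ lit_false b N s (aholds c 0) = 0)) as [v hv].
  - intro n. exists n. assert (h : ~ refuted b n c <> 0) by eauto. rewrite refuted_spec in h.
    apply not_all_ex_not in h as [s h]. exists s. split; [lia|]. tauto || lia.
  - destruct (limit_models b c v) as [h1 h2]; [|exact (H v h1 h2)].
    intro m. destruct (hv m) as (N & s & h1 & h2 & h3 & h4). exists N, s. auto.
Qed.

Lemma computable1_param i : computable1 (param i).
Proof.
  induction i as [|i IH]; [exact computable1_unpairl|].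
  apply computable1_intro. simpl. apply (computable_app1 IH), (computable_app1 computable1_unpairr), computable_arg.
Qed.

Lemma computable1_inst x : computable1 (fun k => inst (params k) x).
Proof.
  induction x as [i|n|x IH|x IHx y IHy|x IHx y IHy]; simpl; apply computable1_intro.
  - apply (computable_app1 (computable1_param i)), computable_arg.
  - apply computable_const.
  - apply (computable_app1 computable1_succ), (computable_app1 IH), computable_arg.
  - apply (computable_app2 computable2_add); [apply (computable_app1 IHx)|apply (computable_app1 IHy)]; apply computable_arg.
  - apply (computable_app2 computable2_cpair); [apply (computable_app1 IHx)|apply (computable_app1 IHy)]; apply computable_arg.
Qed.

Lemma computable3_lit_false b : computable3 (lit_false b).
Proof. unfold lit_false. destruct b; compute_fun. Qed.

Lemma computable3_clause_false c : computable3 (clause_false c).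
Proof.
  induction c as [|[b x] c IH]; simpl; [compute_fun|].
  pose proof (computable3_lit_false b). pose proof (computable1_inst x). apply computable3_intro.
  apply (computable_app2 computable2_mul); apply computable_app3; auto using computable_arg.
  apply (computable_app1 (f := fun k => inst (params k) x)); auto using computable_arg.
Qed.

Lemma computable3_some_false cs : computable3 (some_false cs).
Proof.
  induction cs as [|c cs IH]; simpl; [compute_fun|].
  pose proof (computable3_clause_false c). compute_fun.
Qed.

Lemma computable2_conflict : computable2 conflict.
Proof.
  pose proof (computable3_some_false rcf_clauses).
  assert (H' : computable3 (fun n N s => nat_rect (fun _ => nat) 0 (fun k r => r + some_false rcf_clauses N s k) n)).
  { apply (@computable3_rec (fun _ _ => 0) (fun k r N s => r + some_false rcf_clauses N s k)); compute_fun. }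
  apply computable2_intro. unfold conflict. apply (computable_app3 H'); apply computable_arg.
Qed.

Lemma computable2_refuted b : computable2 (refuted b).
Proof.
  pose proof computable2_conflict. pose proof (computable3_lit_false b).
  assert (H' : computable3 (fun n N c => nat_rect (fun _ => nat) 1
     (fun s r => r * (conflict N s + lit_false b N s (aholds c 0))) n)).
  { apply (@computable3_rec (fun _ _ => 1) (fun s r N c => r * (conflict N s + lit_false b N s (aholds c 0))));
      unfold aholds; compute_fun. }
  apply computable2_intro. unfold refuted. apply (computable_app3 H'); [|apply computable_arg|apply computable_arg].
  apply (computable_app1 computable1_pow2), computable_arg.
Qed.

(** * Deciding sentences by unbounded search *)

Definition truth (f : form) : nat := if excluded_middle_informative (holds (fun _ => 0%R) f) then 1 else 0.

Lemma truth_spec f : truth f = 1 <-> holds (fun _ => 0%R) f.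
Proof. unfold truth. destruct (excluded_middle_informative _); split; intro; try easy. Qed.

Lemma least_nat (P : nat -> Prop) n : P n -> exists m, P m /\ forall k, k < m -> ~ P k.
Proof.
  induction n as [n IH] using (well_founded_induction lt_wf). intro h.
  destruct (classic (exists k, k < n /\ P k)) as [(k & h1 & h2)|hn]; [eauto|].
  exists n. split; [assumption|]. intros k hk hp. eauto.
Qed.

(** [refuted false] certifies truth and [refuted true] certifies falsity. By completeness one
    certificate appears for some [N], so the minimization halts; soundness in the real model
    excludes a wrong one. *)
Theorem truth_computable_of_completeness :
  (forall v, models v -> forall f, v (aholds (code_form f) 0) = true <-> holds (fun _ => 0%R) f) ->
  exists e, forall f, eval e [code_form f] (truth f).
Proof.
  intro complete.
  pose proof (computable2_refuted false) as Hf. pose proof (computable2_refuted true) as Ht.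
  (* Zero as soon as a refutation exists, which is where [PMin] stops. *)
  assert (Hg : computable2 (fun N c => 1 - (refuted false N c + refuted true N c))) by compute_fun.
  assert (Hs : computable2 (fun N c => 1 - (1 - refuted false N c))) by compute_fun.
  destruct Hg as [g Hg]. destruct Hs as [d Hd].
  exists (PComp d [PMin g; PProj 0]). intro f. set (c := code_form f).
  assert (Hex : exists N, refuted false N c + refuted true N c <> 0).
  { destruct (classic (holds (fun _ => 0%R) f)) as [h|h].
    - destruct (@refuted_complete false c) as [N hN]; [|exists N; lia].
      intros v Mv e. unfold c in e. rewrite (proj2 (complete v Mv f) h) in e. discriminate.
    - destruct (@refuted_complete true c) as [N hN]; [|exists N; lia].
      intros v Mv e. apply h. now apply (complete v Mv). }
  destruct Hex as [N0 HN0]. destruct (least_nat (fun N => refuted false N c + refuted true N c <> 0) N0 HN0) as (N & HN & Hmin).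
  replace (truth f) with (1 - (1 - refuted false N c)).
  - econstructor; [|apply Hd]. constructor; [|constructor; [apply (eProj 0)|constructor]].
    apply eMin.
    + replace 0 with (1 - (refuted false N c + refuted true N c)) by lia. apply Hg.
    + intros z hz. exists 1. split; [lia|]. specialize (Hmin z hz).
      pose proof (Hg z c) as G. replace (1 - (refuted false z c + refuted true z c)) with 1 in G by lia. exact G.
  - pose proof (@refuted_sound false N c _ real_model_models) as S1.
    pose proof (@refuted_sound true N c _ real_model_models) as S2.
    pose proof (complete _ real_model_models f) as S3. fold c in S3. unfold truth.
    destruct (excluded_middle_informative _) as [h|h].
    + apply S3 in h. destruct (Nat.eq_dec (refuted false N c) 0); [|lia].
      exfalso. apply S2; [lia|assumption].
    + destruct (Nat.eq_dec (refuted false N c) 0); [lia|].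
      exfalso. apply h, S3. specialize (S1 n). destruct (real_model _); congruence.
Qed.

Definition same_sign (a b : R) : Prop := ((a = 0 <-> b = 0) /\ (0 < a <-> 0 < b))%R.

Module RealClosed.
Import HB.structures.
Import all_boot all_order all_algebra polyrcf ring lra zify Rstruct.
Import Pilot.Defs.
Unset Strict Implicit.
Import Order.TTheory GRing.Theory Num.Theory.
Local Open Scope ring_scope.

(** * Sign-preserving matchings between real closed fields *)

Section Aux.
Variable K : rcfType.
Implicit Types (p q : {poly K}) (x y : K).

Lemma poly_nonroot p : p != 0 -> exists x, ~~ root p x.
Proof.
move=> p0; exists (cauchy_bound p); apply: (ge_cauchy_bound p0).
by rewrite in_itv /= lexx.
Qed.

Lemma sgz_segment p x y : x <= y -> {in `[x, y], forall u, ~~ root p u} ->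
  sgz p.[x] = sgz p.[y].
Proof.
move=> xy nr.
have [h|h] := leP (p.[x] * p.[y]) 0.
  by have [u ui ru] := polyrcf.poly_ivt xy h; move: (nr u ui); rewrite ru.
have : sgz (p.[x] * p.[y]) = 1 by rewrite gtr0_sgz.
by rewrite sgzM => /eqP; rewrite mulz_sg_eq1 => /andP[_ /eqP].
Qed.

Lemma sgz_ray p x : (forall u, x <= u -> ~~ root p u) ->
  forall y, x <= y -> sgz p.[y] = sgz p.[x].
Proof.
move=> nr y xy; apply/esym/sgz_segment => // u; rewrite in_itv /= => /andP[h _].
exact: nr.
Qed.

Lemma lead_coef_deriv p : (1 < size p)%N ->
  lead_coef p^`() = lead_coef p *+ (size p).-1.
Proof.
by move=> sp; rewrite !lead_coefE polyorder.size_deriv coef_deriv; case: (size p) sp => [|[|n]].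
Qed.

(** A negative leading coefficient would make the derivative negative far out. So the leading
    coefficient is positive and [p] tends to infinity. *)
Lemma deriv_pos_ray_pinfty p x : (1 < size p)%N ->
  (forall u, x <= u -> 0 < p^`().[u]) -> exists y, x < y /\ 0 < p.[y].
Proof.
move=> sp dp; have p0 : p != 0 by rewrite -size_poly_gt0; case: (size p) sp.
have lp : 0 < lead_coef p.
  rewrite lt_def lead_coef_eq0 p0 /= leNgt; apply/negP => ln.
  have : 0 < lead_coef (- p^`()).
    by rewrite lead_coefN lead_coef_deriv // oppr_gt0 pmulrn_llt0 //; case: (size p) sp => [|[]].
  move=> h; have [n hn] := poly_pinfty_gt_lc h.
  have := hn (Num.max n x); rewrite le_max lexx /= => /(_ isT).
  have := dp (Num.max n x); rewrite le_max lexx orbT => /(_ isT).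
  rewrite hornerN => h1 h2; have := lt_le_trans h h2.
  by rewrite oppr_gt0 ltNge (ltW h1).
have [n hn] := poly_lim_infty 1 lp sp.
exists (Num.max n (x + 1)); split; first by rewrite lt_max ltrDl ltr01 orbT.
by apply: lt_le_trans ltr01 (hn _ _); rewrite le_max lexx.
Qed.

Lemma roots_finite (qs : seq {poly K}) : exists s : seq K,
  forall q x, q \in qs -> q != 0 -> root q x -> x \in s.
Proof.
elim: qs => [|q qs [s hs]]; first by exists [::].
exists (rootsR q ++ s) => r x; rewrite inE mem_cat => /orP[/eqP ->|h] r0 rx.
  by rewrite -(roots_on_rootsR r0) in_itv /= rx.
by rewrite (hs r) ?orbT.
Qed.

Lemma min_above (s : seq K) x : {b | [/\ b \in s, x < b & forall c, c \in s -> x < c -> b <= c]}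
   + {forall c, c \in s -> c <= x}.
Proof.
elim: s => [|a s [[b [bs xb hb]]|IH]]; first by right.
- left; have [xa|ax] := ltP x a.
    have [ab|ba] := leP a b.
      exists a; rewrite inE eqxx; split=> // c; rewrite inE => /orP[/eqP -> //|cs xc].
      by apply: le_trans ab (hb _ cs xc).
    exists b; rewrite inE bs orbT; split=> // c; rewrite inE => /orP[/eqP -> _|cs xc]; first exact: ltW.
    exact: hb.
  exists b; rewrite inE bs orbT; split=> // c; rewrite inE => /orP[/eqP ->|cs xc]; last exact: hb.
  by rewrite ltNge ax.
- have [xa|ax] := ltP x a.
    left; exists a; rewrite inE eqxx; split=> // c; rewrite inE => /orP[/eqP -> //|cs xc].
    by have := IH _ cs; rewrite leNgt xc.
  by right=> c; rewrite inE => /orP[/eqP ->|/IH].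
Qed.
End Aux.

Section Matching.
Variables K K' : rcfType.

Definition rootOf (qs : seq ({poly K} * {poly K'})) x :=
  exists2 q, q \in qs & (q.1 != 0) /\ root q.1 x.

(** A matching expresses that the two families have the same sign diagram. A point between roots has
    no canonical partner, hence a relation total on both sides instead of a function. Order is
    compared only with roots, which makes the partner of a root unique. Zero polynomials, for which
    every point is a root, are excluded by [rootOf]. *)
Record matching (qs : seq ({poly K} * {poly K'})) (rho : K -> K' -> Prop) : Prop := Matching {
  match_tot : forall x, exists x', rho x x';
  match_tot' : forall x', exists x, rho x x';
  match_sgz : forall x x', rho x x' -> forall q, q \in qs -> sgz q.1.[x] = sgz q.2.[x'];
  match_ord : forall x x' z z', rho x x' -> rho z z' -> rootOf qs x -> sgz (z - x) = sgz (z' - x') }.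

(** A nonzero polynomial is nonzero at some point, and the partner of that point shows that the
    other polynomial is nonzero. *)
Lemma matching_eq0 qs rho q : matching qs rho -> q \in qs -> (q.1 == 0) = (q.2 == 0).
Proof.
move=> D qq; apply/eqP/eqP => q0; apply/eqP; apply/negPn/negP => /poly_nonroot[x].
  have [y xy] := match_tot' D x.
  by rewrite /root -sgz_eq0 -(match_sgz D xy qq) q0 horner0 sgz0 eqxx.
have [y xy] := match_tot D x.
by rewrite /root -sgz_eq0 (match_sgz D xy qq) q0 horner0 sgz0 eqxx.
Qed.

Lemma matching_root qs rho q x x' : matching qs rho -> q \in qs -> rho x x' ->
  root q.1 x = root q.2 x'.
Proof. by move=> D qq xx; rewrite /root -!(sgz_eq0 _.[_]) (match_sgz D xx qq). Qed.

End Matching.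

Lemma matching_sym (K K' : rcfType) (qs : seq ({poly K} * {poly K'})) rho :
  matching qs rho -> matching [seq (q.2, q.1) | q <- qs] (fun x y => rho y x).
Proof.
move=> D; split; [exact: match_tot' D|exact: match_tot D| |].
  by move=> x x' xx _ /mapP[q qq ->]; rewrite (match_sgz D xx qq).
move=> x x' z z' xx zz [_ /mapP[q qq ->] /= [q0 rq]].
rewrite (match_ord D xx zz) //; exists q => //; split.
  by rewrite (matching_eq0 D qq).
by rewrite (matching_root D qq xx).
Qed.

(** * Extending a matching by a polynomial whose derivative is already matched *)

Section Key.
Variables (K K' : rcfType) (qs : seq ({poly K} * {poly K'})) (rho : K -> K' -> Prop).
Variables (p : {poly K}) (p' : {poly K'}).

(** Moving along such a segment changes neither the signs of the family over [K'] nor the position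
    relative to its roots. *)
Definition freeseg (r s : K') := forall u', Num.min r s <= u' <= Num.max r s ->
   forall q, q \in qs -> q.2 != 0 -> ~~ root q.2 u'.

(** The sign of [p'] at [r'] is too low, so the search goes right, to a point [b'] where [p'] is
    positive and before which there are no roots. If a root of the family follows [x], then [b'] is
    the partner of the next one: there [p] is positive by monotonicity and the signs agree by
    hypothesis. Otherwise [p'] tends to infinity. The intermediate value theorem on the way to [b']
    gives the point. *)
Lemma match_right x r' :
  matching qs rho -> (p^`(), p'^`()) \in qs -> (1 < size p)%N -> (1 < size p')%N ->
  (forall x x', rho x x' -> rootOf qs x -> sgz p.[x] = sgz p'.[x']) ->
  rho x r' -> ~ rootOf qs x -> 0 < p^`().[x] -> sgz p'.[r'] < sgz p.[x] ->
  exists x', sgz p.[x] = sgz p'.[x'] /\ freeseg r' x'.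
Proof.
move=> D dq sp sp' hr xr nr dx lt.
have dr : 0 < p'^`().[r'] by rewrite -sgz_gt0 -(match_sgz D xr dq) sgz_gt0.
have key : exists b', [/\ r' < b', 0 < p'.[b'] &
    forall u', r' <= u' < b' -> forall q, q \in qs -> q.2 != 0 -> ~~ root q.2 u'].
  have [s hs] := roots_finite [seq q.1 | q <- qs].
  have rs u : rootOf qs u -> u \in s.
    by move=> [q qq [q0 rq]]; apply: (hs q.1) => //; apply: map_f.
  have rb u u' q : rho u u' -> q \in qs -> q.2 != 0 -> root q.2 u' -> rootOf qs u.
    by move=> uu qq q0 rq; exists q => //; rewrite (matching_eq0 D qq) (matching_root D qq uu).
  have dneq0 : p^`() != 0 by apply: contraTneq dx => ->; rewrite horner0 ltxx.
  have ordx u u' q : rho u u' -> q \in qs -> q.2 != 0 -> root q.2 u' -> sgz (x - u) = sgz (r' - u').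
    by move=> uu qq q0 rq; apply: (match_ord D uu xr); apply: rb uu qq q0 rq.
  pose Pb u := has (fun q : {poly K} * {poly K'} => (q.1 != 0) && root q.1 u) qs.
  have PbP u : reflect (rootOf qs u) (Pb u).
    by apply: (iffP hasP) => [[q qq /andP[]]|[q qq [q0 rq]]]; exists q => //; rewrite q0.
  have [[b [bs xb hb]]|none] := min_above (filter Pb s) x.
    have [b' bb] := match_tot D b.
    have rbt : rootOf qs b by apply/PbP; move: bs; rewrite mem_filter => /andP[].
    have nou u : x <= u < b -> ~ rootOf qs u.
      move=> /andP[xu ub] ru; have us := rs _ ru.
      have xlu : x < u by rewrite lt_neqAle xu andbT; apply: contra_not_neq nr => ->.
      have := hb u; rewrite mem_filter us andbT => /(_ _ xlu).
      by rewrite leNgt ub /= => /(_ _)/notF; apply; apply/PbP.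
    exists b'; split.
    - by have := match_ord D bb xr rbt; rewrite -subr_lt0 -sgz_lt0 => <-; rewrite sgz_lt0 subr_lt0.
    - have : 0 < p.[b].
        (* The sign at [x] exceeds another sign, so it is not -1. *)
        have px : 0 <= p.[x].
          rewrite -sgz_ge0; case: (sgzP p.[x]) lt; case: (sgzP p'.[r']) => //=.
        apply: le_lt_trans px _.
        apply: (@ltr_hornerW _ p x b); rewrite ?in_itv /= ?lexx ?(ltW xb) //.
        move=> u; rewrite in_itv /= => /andP[xu ub].
        rewrite -sgz_gt0 -(@sgz_segment _ _ x u) ?sgz_gt0 ?(ltW xu) //.
        move=> v; rewrite in_itv /= => /andP[xv vu]; apply/negP => rv.
        apply: (nou v); first by rewrite xv (le_lt_trans vu).
        by exists (p^`(), p'^`()).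
      by rewrite -sgz_gt0 (hr _ _ bb rbt) sgz_gt0.
    - move=> u' /andP[ru ub] q qq q0; apply/negP => rq.
      have [u uu] := match_tot' D u'; have ru1 := rb _ _ _ uu qq q0 rq.
      apply: (nou u) => //; apply/andP; split.
        by rewrite -subr_le0 -sgz_le0 (ordx _ _ _ uu qq q0 rq) sgz_le0 subr_le0.
      have := match_ord D bb uu rbt; rewrite -subr_lt0 -(sgz_lt0 (u - b)) => ->.
      by rewrite sgz_lt0 subr_lt0.
  have nor u' : r' <= u' -> forall q, q \in qs -> q.2 != 0 -> ~~ root q.2 u'.
    move=> ru q qq q0; apply/negP => rq.
    have [u uu] := match_tot' D u'; have ru1 := rb _ _ _ uu qq q0 rq.
    have := none u; rewrite mem_filter rs // andbT => h.
    have ux : u <= x by apply: h; apply/PbP.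
    have xu : x <= u by rewrite -subr_le0 -sgz_le0 (ordx _ _ _ uu qq q0 rq) sgz_le0 subr_le0.
    by apply: nr; have -> : x = u by apply/eqP; rewrite eq_le xu.
  have [|b' [rb' pb]] := @deriv_pos_ray_pinfty _ p' r' sp'.
    move=> u ru; rewrite -sgz_gt0 (@sgz_ray _ _ r') // ?sgz_gt0 //.
    by move=> v rv; apply: (nor v rv (p^`(), p'^`())); rewrite //= -(matching_eq0 D dq).
  by exists b'; split=> // u' /andP[h _]; apply: nor.
have [b' [rb pb nob]] := key.
have fr x' : r' <= x' < b' -> freeseg r' x'.
  move=> /andP[h1 h2] u'; rewrite (min_idPl h1) (max_idPr h1) => /andP[h3 h4].
  by apply: nob; rewrite h3 (le_lt_trans h4).
have pr : p'.[r'] <= 0.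
  by rewrite -sgz_le0; case: (sgzP p'.[r']) lt; case: (sgzP p.[x]).
case: (sgzP p.[x]) lt => [px|px|px] lt.
- have {}pr : p'.[r'] < 0 by rewrite -sgz_lt0.
  have [|x' x'i rx] := @polyrcf.poly_ivt _ p' r' b' (ltW rb).
    by apply: mulr_le0_ge0; apply: ltW.
  exists x'; move: rx; rewrite /root => /eqP px'; rewrite px' sgz0; split=> //.
  apply: fr; move: x'i; rewrite in_itv /= => /andP[-> h].
  by rewrite lt_neqAle h andbT; apply: contraTneq pb => <-; rewrite px' ltxx.
(* Half of the value at [b'] is positive and attained strictly before [b'], which may itself be a
   root. *)
- have p2 : 0 < p'.[b'] / 2%:R by rewrite divr_gt0 // ltr0n.
  have p3 : p'.[b'] / 2%:R < p'.[b'] by rewrite ltr_pdivrMr ?ltr0n // ltr_pMr // ltr1n.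
  have [|x' x'i rx] := @polyrcf.poly_ivt _ (p' - (p'.[b'] / 2%:R)%:P) r' b' (ltW rb).
    rewrite !hornerE; apply: mulr_le0_ge0; rewrite ?subr_ge0 ?subr_le0 ?(ltW p3) //.
    exact: le_trans pr (ltW p2).
  exists x'; move: rx; rewrite /root !hornerE subr_eq0 => /eqP px'.
  rewrite px' gtr0_sgz //; split=> //.
  apply: fr; move: x'i; rewrite in_itv /= => /andP[-> h].
  by rewrite lt_neqAle h andbT; apply: contraTneq p3 => e; rewrite -px' e ltxx.
- by move: lt; case: (sgzP p'.[r']).
Qed.
End Key.

Lemma sgz_outside (F : rcfType) (r s a : F) : ~ (Num.min r s <= a <= Num.max r s) ->
  sgz (r - a) = sgz (s - a).
Proof.
have [ar|ra] := ltP a r; have [as_|sa] := ltP a s.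
- by rewrite !gtr0_sgz ?subr_gt0.
- by case; rewrite le_max ge_min sa (ltW ar) orbT.
- by case; rewrite le_max ge_min ra (ltW as_) orbT.
have [->|rna] := eqVneq r a; first by case; rewrite le_max ge_min lexx.
have [->|sna] := eqVneq s a; first by case; rewrite le_max ge_min lexx !orbT.
by rewrite !ltr0_sgz // subr_lt0 lt_neqAle ?rna ?sna.
Qed.

Lemma sgz_between (F F' : rcfType) (x z c : F) (x' z' c' : F') :
  Num.min x z <= c <= Num.max x z -> x != c ->
  sgz (x - c) = sgz (x' - c') -> sgz (z - c) = sgz (z' - c') -> sgz (z - x) = sgz (z' - x').
Proof.
rewrite ge_min le_max => /andP[h1 h2] xc hx hz.
have [lt|gt|e] := ltgtP x c; last by rewrite e eqxx in xc.
  have cz : c <= z by case/orP: h2 => // h2; have := lt_le_trans lt h2; rewrite ltxx.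
  have x'c : x' < c' by rewrite -subr_lt0 -sgz_lt0 -hx sgz_lt0 subr_lt0.
  have c'z : c' <= z' by rewrite -subr_ge0 -sgz_ge0 -hz sgz_ge0 subr_ge0.
  by rewrite !gtr0_sgz // subr_gt0; [apply: lt_le_trans x'c _|apply: lt_le_trans lt _].
have cz : z <= c by case/orP: h1 => // h1; have := lt_le_trans gt h1; rewrite ltxx.
have x'c : c' < x' by rewrite -subr_gt0 -sgz_gt0 -hx sgz_gt0 subr_gt0.
have c'z : z' <= c' by rewrite -subr_le0 -sgz_le0 -hz sgz_le0 subr_le0.
by rewrite !ltr0_sgz // subr_lt0; [apply: le_lt_trans x'c|apply: le_lt_trans gt].
Qed.

Lemma between_transfer (F F' : rcfType) (x z c : F) (x' z' c' : F') :
  sgz (x - c) = sgz (x' - c') -> sgz (z - c) = sgz (z' - c') ->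
  Num.min x' z' <= c' <= Num.max x' z' -> Num.min x z <= c <= Num.max x z.
Proof.
have le_sgz (G : rcfType) (a b : G) : (a <= b) = (sgz (a - b) <= 0) by rewrite sgz_le0 subr_le0.
have ge_sgz (G : rcfType) (a b : G) : (b <= a) = (0 <= sgz (a - b)) by rewrite sgz_ge0 subr_ge0.
move=> hx hz; rewrite !ge_min !le_max.
by rewrite (le_sgz _ x' c') (le_sgz _ z' c') (ge_sgz _ x' c') (ge_sgz _ z' c') -hx -hz -!le_sgz -!ge_sgz.
Qed.

Lemma rootOf_refl (K K' : rcfType) (qs : seq ({poly K} * {poly K'})) x :
  rootOf [seq (q.1 \Po - 'X, q.2 \Po - 'X) | q <- qs] x <-> rootOf qs (- x).
Proof.
have sX : size (- 'X : {poly K}) = 2 by rewrite size_polyN size_polyX.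
split=> [[_ /mapP[q qq ->]]|[q qq]] /=.
  by rewrite comp_poly2_eq0 // root_comp !hornerE => -[q0 rq]; exists q.
move=> [q0 rq]; exists (q.1 \Po - 'X, q.2 \Po - 'X); first exact: map_f.
by rewrite comp_poly2_eq0 // root_comp !hornerE.
Qed.

(** Reflection of both lines at the origin, which trades a move to the left for a move to the
    right. *)
Lemma matching_refl (K K' : rcfType) (qs : seq ({poly K} * {poly K'})) rho :
  matching qs rho ->
  matching [seq (q.1 \Po - 'X, q.2 \Po - 'X) | q <- qs] (fun x x' => rho (- x) (- x')).
Proof.
move=> D; split.
- by move=> x; have [y xy] := match_tot D (- x); exists (- y); rewrite opprK.
- by move=> x; have [y xy] := match_tot' D (- x); exists (- y); rewrite opprK.
- by move=> x x' xx _ /mapP[q qq ->] /=; rewrite !horner_comp !hornerE (match_sgz D xx qq).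
- move=> x x' z z' xx zz /rootOf_refl h.
  have := match_ord D xx zz h; rewrite !opprK !(addrC (- _)) => e.
  by rewrite -(opprB x z) -(opprB x' z') !sgzN e.
Qed.

Lemma rootOf_opp (K K' : rcfType) (qs : seq ({poly K} * {poly K'})) x :
  rootOf [seq (- q.1, - q.2) | q <- qs] x <-> rootOf qs x.
Proof.
split=> [[_ /mapP[q qq ->]]|[q qq]] /=.
  by rewrite oppr_eq0 rootN => -[q0 rq]; exists q.
move=> [q0 rq]; exists (- q.1, - q.2); first exact: (map_f (fun q => (- q.1, - q.2))).
by rewrite oppr_eq0 rootN.
Qed.

Lemma matching_opp (K K' : rcfType) (qs : seq ({poly K} * {poly K'})) rho :
  matching qs rho -> matching [seq (- q.1, - q.2) | q <- qs] rho.
Proof.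
move=> D; split; [exact: match_tot D|exact: match_tot' D| |].
- by move=> x x' xx _ /mapP[q qq ->] /=; rewrite !hornerE !sgzN (match_sgz D xx qq).
- by move=> x x' z z' xx zz /rootOf_opp h; apply: match_ord D _ _ _ _ xx zz h.
Qed.

Section Extend.
Variables (K K' : rcfType) (qs : seq ({poly K} * {poly K'})) (rho : K -> K' -> Prop).
Variables (p : {poly K}) (p' : {poly K'}).
Hypothesis sp : (1 < size p)%N.
Hypothesis sp' : (1 < size p')%N.

(** If the sign at [r'] is too high, the search goes left. Passing to -p(-X) keeps the derivative
    positive and reverses the inequality of signs, so [match_right] applies. If the signs agree,
    [r'] itself serves. *)
Lemma match_posderiv x r' :
  matching qs rho -> (p^`(), p'^`()) \in qs ->
  (forall x x', rho x x' -> rootOf qs x -> sgz p.[x] = sgz p'.[x']) ->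
  rho x r' -> ~ rootOf qs x -> 0 < p^`().[x] ->
  exists x', sgz p.[x] = sgz p'.[x'] /\ freeseg qs r' x'.
Proof.
move=> D dq hr xr nr dx.
have sX (F : rcfType) : size (- 'X : {poly F}) = 2 by rewrite size_polyN size_polyX.
have dX (F : rcfType) (r : {poly F}) : (- (r \Po - 'X))^`() = r^`() \Po - 'X.
  by rewrite derivN deriv_comp derivN derivX mulrN1 opprK.
have hE (F : rcfType) (r : {poly F}) y : (- (r \Po - 'X)).[y] = - r.[- y].
  by rewrite hornerN horner_comp hornerN hornerX.
have [lt|lt|e] := ltgtP (sgz p.[x]) (sgz p'.[r']).
- have := @match_right _ _ _ _ (- (p \Po - 'X)) (- (p' \Po - 'X)) (- x) (- r') (matching_refl D).
  case.
  + by rewrite !dX; exact: (map_f (fun q : {poly K} * {poly K'} => (q.1 \Po - 'X, q.2 \Po - 'X)) dq).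
  + by rewrite size_polyN size_comp_poly2 ?sX.
  + by rewrite size_polyN size_comp_poly2 ?sX.
  + by move=> y y' yy /rootOf_refl h; rewrite !hE !sgzN (hr _ _ yy h).
  + by rewrite !opprK.
  + by move/rootOf_refl; rewrite opprK.
  + by rewrite dX horner_comp !hornerE opprK.
  + by rewrite !hE !sgzN !opprK ltrN2.
  move=> x' []; rewrite !hE !sgzN opprK => /oppr_inj e f.
  exists (- x'); split=> // u' hu q qq q0.
  have := f (- u') _ (q.1 \Po - 'X, q.2 \Po - 'X).
  rewrite /= (comp_poly2_eq0 _ (sX _)) root_comp hornerN hornerX opprK; apply=> //.
    move: hu; case: (leP r' (- x')) => h1; case: (leP (- r') x') => h2; lra.
  exact: (map_f (fun q : {poly K} * {poly K'} => (q.1 \Po - 'X, q.2 \Po - 'X))).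
- exact: (match_right D).
- exists r'; split=> // u'; rewrite minxx maxxx -eq_le => /eqP <- q qq q0; apply/negP => rq.
  by apply: nr; exists q => //; rewrite (matching_eq0 D qq) (matching_root D qq xr).
Qed.

End Extend.

(** The derivative belongs to the family and [x] is not a root of it, so the derivative has a strict
    sign at [x]. A negative sign is made positive by negating all polynomials. *)
Lemma match_any (K K' : rcfType) (qs : seq ({poly K} * {poly K'})) rho (p : {poly K}) (p' : {poly K'}) x r' :
  (1 < size p)%N -> (1 < size p')%N ->
  matching qs rho -> (p^`(), p'^`()) \in qs ->
  (forall x x', rho x x' -> rootOf qs x -> sgz p.[x] = sgz p'.[x']) ->
  rho x r' -> ~ rootOf qs x ->
  exists x', sgz p.[x] = sgz p'.[x'] /\ freeseg qs r' x'.
Proof.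
move=> sp sp' D dq hr xr nr.
have dx0 : p^`().[x] != 0.
  apply: contra_not_neq nr => e; exists (p^`(), p'^`()) => //=; split; last exact/eqP.
  by rewrite -size_poly_gt0 polyorder.size_deriv; case: (size p) sp => [|[]].
have [dx|dx] : 0 < p^`().[x] \/ p^`().[x] < 0 by move: dx0; rewrite neq_lt => /orP[]; [right|left].
  exact: (match_posderiv sp sp' D dq hr xr nr dx).
have [|||||||x'] := @match_posderiv _ _ _ rho (- p) (- p') _ _ x r' (matching_opp D); rewrite ?size_polyN //.

- by rewrite !derivN; apply: (map_f (fun q : {poly K} * {poly K'} => (- q.1, - q.2)) dq).
- by move=> y y' yy /rootOf_opp h; rewrite !hornerN !sgzN (hr _ _ yy h).
- by move/rootOf_opp.
- by rewrite derivN hornerN oppr_gt0.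
rewrite !hornerN !sgzN => -[/oppr_inj e f]; exists x'; split=> // u' hu q qq q0.
have := f u' hu (- q.1, - q.2); rewrite /= oppr_eq0 rootN; apply=> //.
exact: (map_f (fun q : {poly K} * {poly K'} => (- q.1, - q.2))).
Qed.

Section Refine.
Variables (K K' : rcfType) (qs : seq ({poly K} * {poly K'})) (rho : K -> K' -> Prop).
Variables (p : {poly K}) (p' : {poly K'}).

(** Positions relative to old roots are kept along with all signs, those of the new pair included.
    Partners under [refine] need not be partners under [rho], except at old roots. *)
Definition refine x x' :=
  (forall a a', rho a a' -> rootOf qs a -> sgz (x - a) = sgz (x' - a')) /\
  (forall q, q \in (p, p') :: qs -> sgz q.1.[x] = sgz q.2.[x']).

(** An old root keeps its partner. For any other point the partner is moved along a free segment,
    where old signs and positions persist, until the sign of [p'] is right. *)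
Lemma refine_tot : (1 < size p)%N -> (1 < size p')%N ->
  matching qs rho -> (p^`(), p'^`()) \in qs ->
  (forall x x', rho x x' -> rootOf qs x -> sgz p.[x] = sgz p'.[x']) ->
  forall x, exists x', refine x x'.
Proof.
move=> sp sp' D dq hr x; have [r' xr] := match_tot D x.
have [rx|rx] := classic (rootOf qs x).
  exists r'; split; first by move=> a a' aa ra; apply: match_ord D _ _ _ _ aa xr ra.
  by move=> q; rewrite inE => /orP[/eqP ->|qq]; [apply: hr|apply: match_sgz D _ _ xr _ qq].
have [x' [e f]] := match_any sp sp' D dq hr xr rx.
exists x'; split.
  move=> a a' aa ra; rewrite (match_ord D aa xr ra).
  have [q qq [q0 rq]] := ra.
  have nb : ~ (Num.min r' x' <= a' <= Num.max r' x').
    move=> h; have := f a' h q qq; rewrite -(matching_eq0 D qq) => /(_ q0).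
    by rewrite -(matching_root D qq aa) rq.
  exact: sgz_outside.
move=> q; rewrite inE => /orP[/eqP ->|qq] //.
rewrite (match_sgz D xr qq).
have [q0|q0] := eqVneq q.2 0; first by rewrite q0 !horner0.
have nb u' : Num.min r' x' <= u' <= Num.max r' x' -> ~~ root q.2 u' by move=> h; apply: f.
move: nb; case: (leP r' x') => rx' nb.
  by apply: sgz_segment => // u'; rewrite in_itv /=; apply: nb.
by apply/esym/sgz_segment => [|u']; rewrite ?ltW // in_itv /=; apply: nb.
Qed.

(** By the mean value theorem, the constant sign of the derivative governs [r] on either side of its
    zero. *)
Lemma sgz_mvt (F : rcfType) (r : {poly F}) x z : r.[x] = 0 ->
  (forall u, Num.min x z <= u <= Num.max x z -> ~~ root r^`() u) ->
  sgz r.[z] = sgz r^`().[x] * sgz (z - x).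
Proof.
move=> rx nb; have [xz|zx|xz] := ltgtP x z; last by rewrite -xz subrr sgz0 mulr0 rx sgz0.
  have [c ci e] := poly_mvt r xz; move: e; rewrite rx subr0 => ->; rewrite sgzM; congr (_ * _).
  move: ci; rewrite in_itv /= => /andP[xc cz].
  apply/esym/sgz_segment; first exact: ltW.
  move=> u; rewrite in_itv /= => /andP[xu uc]; apply: nb.
  by rewrite (min_idPl (ltW xz)) (max_idPr (ltW xz)) xu (le_trans uc (ltW cz)).
have [c ci e] := poly_mvt r zx; move: e; rewrite rx sub0r => /eqP; rewrite eqr_oppLR -mulrN opprB => /eqP ->.
rewrite sgzM; congr (_ * _).
move: ci; rewrite in_itv /= => /andP[zc cx].
apply/sgz_segment; first exact: ltW.
move=> u; rewrite in_itv /= => /andP[cu ux]; apply: nb.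
by rewrite (min_idPr (ltW zx)) (max_idPl (ltW zx)) ux (le_trans (ltW zc) cu).
Qed.

Lemma refine_rootOf x x' : matching qs rho -> refine x x' -> rootOf qs x -> rho x x'.
Proof.
move=> D xx rx; have [r' xr] := match_tot D x.
have := xx.1 _ _ xr rx; rewrite subrr sgz0 => /esym/eqP.
by rewrite sgz_eq0 subr_eq0 => /eqP ->.
Qed.

(** The new case is a root [x] of [p] that is not an old root. An old root between [x] and [z]
    decides their order. Without one the derivative has no zero between them, and the matched sign
    of [p] at [z] reveals on which side of [x] it lies. *)
Lemma refine_ord x x' z z' : (1 < size p)%N -> 
  matching qs rho -> (p^`(), p'^`()) \in qs ->
  refine x x' -> refine z z' -> rootOf ((p, p') :: qs) x -> sgz (z - x) = sgz (z' - x').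
Proof.
move=> sp D dq xx zz rpx.
have [rx|rx] := classic (rootOf qs x); first by apply: zz.1 => //; apply: refine_rootOf.
have px : p.[x] = 0.
  have [q] := rpx; rewrite inE => /orP[/eqP -> [_ /eqP]|qq h] //.
  by case: rx; exists q.
have p'x : p'.[x'] = 0.
  by apply/eqP; rewrite -sgz_eq0 -(xx.2 (p, p')) ?inE ?eqxx //= px sgz0.
have [[c rc xcz]|nb] := classic (exists2 c, rootOf qs c & Num.min x z <= c <= Num.max x z).
  have [c' cc] := match_tot D c.
  have xc : x != c by apply: contra_not_neq rx => ->.
  have := xx.1 _ _ cc rc; have := zz.1 _ _ cc rc.
  by move=> hz hx; apply: sgz_between xcz xc hx hz.
have nd : p^`() != 0 by rewrite -size_poly_gt0 polyorder.size_deriv; case: (size p) sp => [|[]].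
have h1 : sgz p.[z] = sgz p^`().[x] * sgz (z - x).
  apply: sgz_mvt => // u hu; apply/negP => ru; apply: nb; exists u => //.
  by exists (p^`(), p'^`()).
have h2 : sgz p'.[z'] = sgz p'^`().[x'] * sgz (z' - x').
  (* A zero of the derivative over [K'] would be carried back to an old root between [x] and [z]. *)
  apply: sgz_mvt => // u' hu; apply/negP => ru; apply: nb.
  have [u uu] := match_tot' D u'; have rou : rootOf qs u.
    by exists (p^`(), p'^`()) => //; rewrite (matching_root D dq uu).
  exists u => //; have := xx.1 _ _ uu rou; have := zz.1 _ _ uu rou.
  by move=> hz hx; apply: between_transfer hx hz hu.
have e0 : sgz p^`().[x] = sgz p'^`().[x'] by apply: (xx.2 (p^`(), p'^`())); rewrite inE dq orbT.
have e1 : sgz p.[z] = sgz p'.[z'] by apply: (zz.2 (p, p')); rewrite inE eqxx.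
move: e1; rewrite h1 h2 -e0; apply: mulfI.
by rewrite sgz_eq0; apply: contra_not_neq rx => e; exists (p^`(), p'^`()) => //=; split => //; apply/eqP.
Qed.
End Refine.
Lemma matching_extend (K K' : rcfType) (qs : seq ({poly K} * {poly K'})) rho (p : {poly K}) (p' : {poly K'}) :
  (1 < size p)%N -> (1 < size p')%N -> matching qs rho -> (p^`(), p'^`()) \in qs ->
  (forall x x', rho x x' -> rootOf qs x -> sgz p.[x] = sgz p'.[x']) ->
  exists rho2, matching ((p, p') :: qs) rho2.
Proof.
move=> sp sp' D dq hr; exists (refine qs rho p p'); split.
- exact: refine_tot.
- pose sw := [seq (q.2, q.1) | q <- qs].
  have rsw a a' : rho a a' -> rootOf sw a' <-> rootOf qs a.
    move=> aa; split=> [[_ /mapP[q qq ->] /= [q0 rq]]|[q qq [q0 rq]]].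
      by exists q => //; rewrite (matching_eq0 D qq) (matching_root D qq aa).
    exists (q.2, q.1); first exact: (map_f (fun q : {poly K} * {poly K'} => (q.2, q.1))).
    by rewrite /= -(matching_eq0 D qq) -(matching_root D qq aa).
  have dsw : (p'^`(), p^`()) \in sw by apply: (map_f (fun q : {poly K} * {poly K'} => (q.2, q.1)) dq).
  move=> x'; have [y y' yy /(rsw _ _ yy) h|x [h1 h2]] := refine_tot sp' sp (matching_sym D) dsw _ x'.
    by rewrite (hr _ _ yy h).
  exists x; split=> [a a' aa ra|q]; first by rewrite (h1 _ _ aa) //; apply/(rsw _ _ aa).
  rewrite inE => /orP[/eqP ->|qq]; first by rewrite (h2 (p', p)) // inE eqxx.
  by rewrite (h2 (q.2, q.1)) // inE (map_f (fun q : {poly K} * {poly K'} => (q.2, q.1))) // orbT.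
- by move=> x x' [_ h].
- by move=> x x' z z' xx zz; apply: (@refine_ord _ _ _ _ p p' _ _ _ _ sp D dq xx zz).
Qed.

Lemma matching_sub (K K' : rcfType) (qs1 qs2 : seq ({poly K} * {poly K'})) rho :
  {subset qs2 <= qs1} -> matching qs1 rho -> matching qs2 rho.
Proof.
move=> sub D; split; [exact: match_tot D|exact: match_tot' D| |].
  by move=> x x' xx q /sub; apply: match_sgz D _ _ xx _.
by move=> x x' z z' xx zz [q /sub qq h]; apply: match_ord D _ _ _ _ xx zz _; exists q.
Qed.

(** * Polynomials in one variable with terms as coefficients *)

Definition term_eq_dec (s t : term) : {s = t} + {s <> t}.
Proof. by decide equality; apply: PeanoNat.Nat.eq_dec. Defined.
HB.instance Definition _ := hasDecEq.Build term (compareP term_eq_dec).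

Fixpoint tval (K : rcfType) (e : nat -> K) (t : term) : K :=
  match t with
  | TVar i => e i
  | TZero => 0
  | TOne => 1
  | TAdd a b => tval e a + tval e b
  | TMul a b => tval e a * tval e b
  | TNeg a => - tval e a
  end.

Definition updv (K : Type) (e : nat -> K) (i : nat) (x : K) : nat -> K :=
  fun j => if Nat.eqb j i then x else e j.

Fixpoint sat (K : rcfType) (e : nat -> K) (f : form) : Prop :=
  match f with
  | FEq a b => tval e a = tval e b
  | FLt a b => tval e a < tval e b
  | FNot g => ~ sat e g
  | FAnd g h => sat e g /\ sat e h
  | FOr g h => sat e g \/ sat e h
  | FEx i g => exists x : K, sat (updv e i x) g
  | FAll i g => forall x : K, sat (updv e i x) g
  end.

(** The length of the list only bounds the degree: the last coefficient may vanish for some values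
    of the parameters. *)
Definition pval (K : rcfType) (e : nat -> K) (s : seq term) : {poly K} := Poly (map (tval e) s).

Fixpoint padd (s1 s2 : seq term) : seq term :=
  match s1, s2 with
  | [::], _ => s2
  | _, [::] => s1
  | a :: s1, b :: s2 => TAdd a b :: padd s1 s2
  end.
Fixpoint pmul (s1 s2 : seq term) : seq term :=
  if s1 is a :: s1 then padd (map (TMul a) s2) (TZero :: pmul s1 s2) else [::].
Fixpoint tpoly (i : nat) (t : term) : seq term :=
  match t with
  | TVar j => if Nat.eqb j i then [:: TZero; TOne] else [:: t]
  | TZero => [::]
  | TOne => [:: TOne]
  | TAdd a b => padd (tpoly i a) (tpoly i b)
  | TMul a b => pmul (tpoly i a) (tpoly i b)
  | TNeg a => map TNeg (tpoly i a)
  end.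
(** Based on (a + sX)' = s + s'X. The separate case of a constant makes the length drop, as the
    induction on lengths requires. *)
Fixpoint pderiv (s : seq term) : seq term :=
  if s is _ :: s' then (if s' is [::] then [::] else padd s' (TZero :: pderiv s')) else [::].
Definition pbut (s : seq term) : seq term := take (size s).-1 s.
Definition plast (s : seq term) : term := last TZero s.
(* At a root of [q] this evaluates to [plast q * p]. *)
Definition pelim (p q : seq term) : seq term :=
  padd (map (TMul (plast q)) (pbut p))
       (nseq (size p - size q) TZero ++ map (fun t => TNeg (TMul (plast p) t)) (pbut q)).

Section PvalLemmas.
Variables (K : rcfType) (e : nat -> K).
Local Notation pval := (pval e).

Lemma pval_nil : pval [::] = 0. Proof. by []. Qed.
Lemma pval_cons a s : pval (a :: s) = pval s * 'X + (tval e a)%:P.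
Proof. by rewrite /pval /= cons_poly_def. Qed.
Lemma pval_padd s1 s2 : pval (padd s1 s2) = pval s1 + pval s2.
Proof.
elim: s1 s2 => [|a s1 IH] [|b s2] //=; rewrite ?pval_nil ?add0r ?addr0 //.
by rewrite !pval_cons IH /= polyCD; ring.
Qed.
Lemma pval_scale a s : pval (map (TMul a) s) = tval e a *: pval s.
Proof.
elim: s => [|b s IH] /=; first by rewrite scaler0.
by rewrite !pval_cons IH /= -!mul_polyC polyCM; ring.
Qed.
Lemma pval_neg s : pval (map TNeg s) = - pval s.
Proof.
elim: s => [|b s IH] /=; first by rewrite oppr0.
by rewrite !pval_cons IH /= polyCN; ring.
Qed.
Lemma pval_pmul s1 s2 : pval (pmul s1 s2) = pval s1 * pval s2.
Proof.
elim: s1 => [|a s1 IH] /=; first by rewrite mul0r.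
by rewrite pval_padd pval_scale !pval_cons IH /= -mul_polyC polyC0; ring.
Qed.
Lemma pval_tpoly i t x : (pval (tpoly i t)).[x] = tval (updv e i x) t.
Proof.
elim: t => [j|||a IHa b IHb|a IHa b IHb|a IHa] /=.
- by rewrite /updv; case: Nat.eqb; rewrite !pval_cons pval_nil !hornerE.
- by rewrite horner0.
- by rewrite pval_cons pval_nil !hornerE.
- by rewrite pval_padd hornerD IHa IHb.
- by rewrite pval_pmul hornerM IHa IHb.
- by rewrite pval_neg hornerN IHa.
Qed.
Lemma pval_pderiv s : pval (pderiv s) = (pval s)^`().
Proof.
elim: s => [|a s IH] /=; first by rewrite /pval /= deriv0.
rewrite pval_cons derivD derivM derivX derivC mulr1 addr0 -IH.
case: s {IH} => [|b s]; first by rewrite /= !pval_nil mul0r addr0.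
by rewrite pval_padd [X in _ + X]pval_cons polyC0 addr0 addrC.
Qed.
Lemma pval_cat s1 s2 : pval (s1 ++ s2) = pval s1 + 'X^(size s1) * pval s2.
Proof.
elim: s1 => [|a s1 IH]; first by rewrite pval_nil expr0 mul1r add0r.
by rewrite cat_cons !pval_cons IH /= exprS; ring.
Qed.
Lemma pval_nseq0 n : pval (nseq n TZero) = 0.
Proof. by elim: n => [|n IH] //=; rewrite pval_cons IH /= mul0r add0r. Qed.
Lemma pval_rcons s a : pval (rcons s a) = pval s + tval e a *: 'X^(size s).
Proof. by rewrite -cats1 pval_cat pval_cons pval_nil mul0r add0r mulrC mul_polyC. Qed.
Lemma pbut_rcons s a : pbut (rcons s a) = s.
Proof. by rewrite /pbut size_rcons /= -cats1 take_size_cat. Qed.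
Lemma plast_rcons s a : plast (rcons s a) = a.
Proof. by rewrite /plast last_rcons. Qed.

(** At a root of [q] its leading term equals minus the remaining terms. After multiplication by the
    leading coefficient of [q], the top term of [p] can therefore be traded for lower ones. *)
Lemma pval_pelim p q x : (0 < size q <= size p)%N -> root (pval q) x ->
  (pval (pelim p q)).[x] = tval e (plast q) * (pval p).[x].
Proof.
case/lastP: q => // q b; case/lastP: p => [|p c]; first by rewrite size_rcons.
rewrite !size_rcons /= ltnS => qp /eqP; rewrite /pelim !pbut_rcons !plast_rcons !size_rcons.
rewrite pval_padd pval_scale pval_cat pval_nseq0 add0r size_nseq.
have -> : [seq TNeg (TMul c t) | t <- q] = map TNeg (map (TMul c) q) by rewrite -map_comp.
rewrite pval_neg pval_scale !pval_rcons !hornerE subSS => h.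
have -> : (pval q).[x] = - (tval e b * x ^+ size q) by apply/eqP; rewrite -addr_eq0 h.
have -> : x ^+ size p = x ^+ (size p - size q) * x ^+ size q by rewrite -exprD subnK.
ring.
Qed.

Lemma size_pval s : (size (pval s) <= size s)%N.
Proof. by rewrite -(size_map (tval e) s); apply: size_Poly. Qed.
Lemma coef_pval s i : (pval s)`_i = tval e (nth TZero s i).
Proof.
rewrite coef_Poly; have [h|h] := ltnP i (size s); first by rewrite (nth_map TZero).
by rewrite !nth_default ?size_map.
Qed.
End PvalLemmas.

Lemma size_padd s1 s2 : size (padd s1 s2) = maxn (size s1) (size s2).
Proof. by elim: s1 s2 => [|a s1 IH] [|b s2] //=; rewrite ?maxn0 // IH maxnSS. Qed.
Lemma size_pderiv s : size (pderiv s) = (size s).-1.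
Proof.
elim: s => [|a [|b s] IH] //.
have -> : pderiv [:: a, b & s] = padd (b :: s) (TZero :: pderiv (b :: s)) by [].
by rewrite size_padd /= -/(pderiv (b :: s)) IH /= maxnn.
Qed.
Lemma size_pbut s : size (pbut s) = (size s).-1.
Proof. by rewrite size_take; case: s => //= a s; rewrite ltnSn. Qed.
Lemma size_pelim p q : (0 < size q <= size p)%N -> size (pelim p q) = (size p).-1.
Proof.
move=> /andP[h1 h2]; rewrite size_padd size_cat size_nseq !size_map !size_pbut.
lia.
Qed.

(** * Semantic quantifier elimination *)

Definition agree (K K' : rcfType) (e : nat -> K) (e' : nat -> K') (Q : seq term) :=
  forall t, t \in Q -> sgz (tval e t) = sgz (tval e' t).

Lemma agree_sub (K K' : rcfType) (e : nat -> K) (e' : nat -> K') Q1 Q2 :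
  {subset Q1 <= Q2} -> agree e e' Q2 -> agree e e' Q1.
Proof. by move=> sub A t /sub; apply: A. Qed.

Lemma pval_ptrunc (K : rcfType) (e : nat -> K) s n : (size (pval e s) <= n)%N ->
  pval e (take n s) = pval e s.
Proof.
move=> h; apply/polyP => i; rewrite !coef_pval; have [hi|hi] := ltnP i n.
  by rewrite nth_take.
rewrite nth_default ?(leq_trans (size_take_min _ _ )) //=; last first.
  by rewrite size_take; case: ltnP => // h2; apply: leq_trans h2 hi.
by rewrite -(coef_pval e s) nth_default // (leq_trans h hi).
Qed.

(** If no member of [P] is longer than [p], all lists added are shorter than [p]. Every truncation
    [take j q] is used because the true degree of [q] depends on the parameters; [j] starts at 2
    because a nonzero constant has no root. *)
Definition reduct (p : seq term) (P : seq (seq term)) : seq (seq term) :=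
  P ++ [:: pderiv p; pbut p] ++
  flatten [seq [seq pelim p (take j q) | j <- iota 2 (size q).-1] | q <- pderiv p :: P].

(** If the leading coefficient of [p] vanishes, [p] has the same value as [pbut p]. Otherwise the
    sign of [p] at a root of [q] follows from [pelim] and the sign of the leading coefficient of
    [q], which is what [matching_extend] asks for. *)
Lemma matching_reduct (K K' : rcfType) (e : nat -> K) (e' : nat -> K') p P rho :
  (1 < size p)%N -> {in P, forall q, (size q <= size p)%N} ->
  agree e e' (p ++ flatten (pderiv p :: P)) ->
  matching [seq (pval e q, pval e' q) | q <- reduct p P] rho ->
  exists rho2, matching [seq (pval e q, pval e' q) | q <- p :: P] rho2.
Proof.
move=> sp hP A D.
pose f q := (pval e q, pval e' q).
have pE (F : rcfType) (g : nat -> F) : pval g p = pval g (pbut p) + tval g (plast p) *: 'X^((size p).-1).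
  by case/lastP: p sp {D A hP} => // s a _; rewrite pbut_rcons plast_rcons pval_rcons size_rcons.
have Ap : sgz (tval e (plast p)) = sgz (tval e' (plast p)).
  by apply: A; rewrite mem_cat /plast; case: p sp {D hP pE} => //= a s _; rewrite mem_last.
have [c0|c0] := eqVneq (tval e (plast p)) 0.
  have c0' : tval e' (plast p) = 0 by apply/eqP; rewrite -sgz_eq0 -Ap c0 sgz0.
  exists rho; apply: matching_sub D => _ /mapP[q qP ->].
  move: qP; rewrite inE => /orP[/eqP ->|qP]; last by apply: (map_f f); rewrite mem_cat qP.
  rewrite (pE _ e) (pE _ e') c0 c0' !scale0r !addr0; apply: (map_f f).
  by rewrite mem_cat !inE eqxx !orbT.
have c0' : tval e' (plast p) != 0 by rewrite -sgz_eq0 -Ap sgz_eq0.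
have sz (F : rcfType) (g : nat -> F) : tval g (plast p) != 0 -> size (pval g p) = size p.
  move=> h; apply/eqP; rewrite eqn_leq size_pval /= -[X in (X <= _)%N](@prednK (size p)) ?(ltnW sp) //.
  rewrite ltnNge; apply/negP => le; move: h.
  by rewrite /plast -nth_last -coef_pval nth_default ?eqxx.
have D' : matching [seq f q | q <- pderiv p :: P] rho.
  apply: matching_sub D => _ /mapP[q qP ->]; apply: (map_f f).
  by move: qP; rewrite inE mem_cat !inE => /orP[/eqP ->|->]; rewrite ?eqxx ?orbT.
have [||||rho2 D2] := @matching_extend _ _ _ _ (pval e p) (pval e' p) _ _ D'.
- by rewrite sz.
- by rewrite sz.
- by rewrite -!pval_pderiv (map_f f) // inE eqxx.
- move=> x x' xx [_ /mapP[q qP ->] /= [q0 rq]].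
  (* The true length of [q] under [e]; since the coefficients have equal signs, truncation at [j] is
     also harmless under [e']. *)
  set j := size (pval e q).
  have j2 : (1 < j)%N by apply: root_size_gt1 rq.
  have jq : (j <= size q)%N by apply: size_pval.
  have qp : (size q <= size p)%N.
    by move: qP; rewrite inE => /orP[/eqP ->|/hP //]; rewrite size_pderiv leq_pred.
  have t1 : pval e (take j q) = pval e q by apply: pval_ptrunc.
  have Aq i : sgz (tval e (nth TZero q i)) = sgz (tval e' (nth TZero q i)).
    have [iq|iq] := ltnP i (size q); last by rewrite nth_default //= !sgz0.
    apply: A; rewrite mem_cat; apply/orP; right; apply/flattenP; exists q => //; exact: mem_nth.
  have t2 : pval e' (take j q) = pval e' q.
    apply: pval_ptrunc; apply/leq_sizeP => i ji; apply/eqP.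
    by rewrite coef_pval -sgz_eq0 -Aq -(coef_pval e) nth_default // sgz0.
  have st : size (take j q) = j by rewrite size_take; case: ltngtP jq.
  have sj : (0 < size (take j q) <= size p)%N by rewrite st (ltnW j2) (leq_trans jq).
  have mem : f (pelim p (take j q)) \in [seq f q | q <- reduct p P].
    apply: (map_f f); rewrite /reduct catA mem_cat; apply/orP; right.
    apply/flatten_mapP; exists q => //; apply/mapP; exists j => //.
    by rewrite mem_iota j2 add2n ltnS prednK // (leq_trans _ jq) // ltnW.
  have := match_sgz D xx mem; rewrite /f /= !pval_pelim ?t1 ?t2 //; last first.
    by rewrite -(matching_root D' (q := f q) _ xx) //; apply: (map_f f).
  rewrite !sgzM.
  have lE : plast (take j q) = nth TZero q j.-1 by rewrite /plast -nth_last st nth_take // ltn_predL ltnW.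
  rewrite lE -Aq; apply: mulfI.
  by rewrite sgz_eq0 -coef_pval -lead_coefE lead_coef_eq0.
by exists rho2; apply: matching_sub D2 => q; rewrite /= !inE => /orP[->|->]; rewrite ?orbT.
Qed.

(** Induction on a bound for the lengths, then on the number of lists attaining it: [reduct]
    replaces one of them by shorter ones. [Q] collects the coefficients met on the way. *)
Lemma sign_matching (P : seq (seq term)) : exists Q : seq term,
  forall (K K' : rcfType) (e : nat -> K) (e' : nat -> K'), agree e e' Q ->
  exists rho, matching [seq (pval e q, pval e' q) | q <- P] rho.
Proof.
suff main L k : forall P, {in P, forall q, (size q <= L)%N} -> (count (fun q => size q == L) P <= k)%N ->
  exists Q : seq term, forall (K K' : rcfType) (e : nat -> K) (e' : nat -> K'), agree e e' Q ->
    exists rho, matching [seq (pval e q, pval e' q) | q <- P] rho.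
  apply: (main (\max_(q <- P) size q)%N _ P _ (leqnn _)) => q qP.
  by rewrite (big_rem q) //= leq_maxl.
clear P; elim: L k => [|L IHL] k P.
  move=> hP _; exists [::] => K K' e e' _; exists (fun _ _ => True).
  have p0 q : q \in P -> q = [::] by move/hP; rewrite leqn0 => /nilP.
  split; [by exists 0|by exists 0| |].
    by move=> x x' _ _ /mapP[q /p0 -> ->] /=; rewrite !horner0 !sgz0.
  by move=> x x' z z' _ _ [_ /mapP[q /p0 -> ->] [/=]]; rewrite eqxx.
have [->|L0] := posnP L.
  (* Lists of length at most one are constants, for which the full relation is a matching. *)
  move=> hP _; exists (flatten P) => K K' e e' A; exists (fun _ _ => True).
  have p1 q : q \in P -> exists a, [/\ pval e q = (tval e a)%:P, pval e' q = (tval e' a)%:P & sgz (tval e a) = sgz (tval e' a)].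
    move=> qP; have := hP _ qP; case: q qP => [|a [|b q]] // qP _.
      by exists TZero; rewrite /= !sgz0.
    exists a; rewrite !pval_cons !pval_nil !mul0r !add0r; split=> //.
    by apply: A; apply/flattenP; exists [:: a]; rewrite // inE.
  split; [by exists 0|by exists 0| |].
    by move=> x x' _ _ /mapP[q /p1[a [e1 e2 e3]] ->] /=; rewrite e1 e2 !hornerC.
  move=> x x' z z' _ _ [_ /mapP[q /p1[a [e1 e2 e3]] ->] [/=]].
  by rewrite e1 polyC_eq0 rootC => /negbTE ->.
elim: k P => [|k IHk] P hP; last first.
  rewrite leq_eqVlt => /orP[/eqP ck|]; last exact: IHk.
  have /hasP[p pP /eqP sp] : has (fun q => size q == L.+1) P by rewrite has_count ck.
  have PP := perm_to_rem pP.
  have cr : count (fun q => size q == L.+1) (rem p P) = k.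
    by move/permP: PP => /(_ (fun q => size q == L.+1)); rewrite ck /= sp eqxx add1n => -[].
  have hrem : {in rem p P, forall q, (size q <= L.+1)%N} by move=> q /mem_rem; apply: hP.
  have small q : q \in [:: pderiv p; pbut p] ++ flatten [seq [seq pelim p (take j q) | j <- iota 2 (size q).-1] | q <- pderiv p :: rem p P] ->
     (size q <= L)%N.
    rewrite mem_cat !inE => /orP[/orP[] /eqP ->|]; rewrite ?size_pderiv ?size_pbut ?sp //.
    move=> /flatten_mapP[r rP /mapP[j]]; rewrite mem_iota => /andP[j2 jr] ->.
    have {}jr : (j <= size r)%N by move: jr; case: (size r) => [|n]; rewrite ?addn0 ?ltnS //; case: j j2 => [|[]].
    have sr : (size r <= L.+1)%N.
      by move: rP; rewrite inE => /orP[/eqP ->|/hrem //]; rewrite size_pderiv sp.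
    have sj : size (take j r) = j by rewrite size_take; case: ltngtP jr.
    by rewrite size_pelim ?sj ?sp ?(ltnW j2) ?(leq_trans jr).
  have [|| Q hQ] := IHk (reduct p (rem p P)).
  - by move=> q; rewrite /reduct mem_cat => /orP[/hrem //|/small h]; apply: leqW.
  - rewrite /reduct count_cat cr (_ : count _ _ = 0%N) ?addn0 //.
    by apply/eqP; rewrite -leqn0 leqNgt -has_count; apply/hasPn => q /small h; rewrite neq_ltn ltnS h.
  exists (Q ++ (p ++ flatten (pderiv p :: rem p P))) => K K' e e' A.
  have [|rho D] := hQ _ _ e e'.
    by apply: agree_sub A => t ht; rewrite mem_cat ht.
  have [|q qr||rho2 D2] := matching_reduct _ _ _ D; rewrite ?sp //; first exact: hrem.
    by apply: agree_sub A => t ht; rewrite mem_cat ht orbT.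
  exists rho2; apply: matching_sub D2 => q /mapP[r rP ->].
  by apply: (map_f (fun q => (pval e q, pval e' q))); rewrite -(perm_mem PP).
(* No list of maximal length is left, so the bound drops; [size P] is a crude bound for the new
   count. *)
rewrite leqn0 => /eqP c0; apply: (IHL (size P) P); last exact: count_size.
move=> q qP; have := hP _ qP; rewrite leq_eqVlt => /orP[/eqP sq|//].
have : has (fun q => size q == L.+1) P by apply/hasP; exists q => //; apply/eqP.
by rewrite has_count c0.
Qed.

(** A matching of the polynomials in the quantified variable is a back-and-forth step: each value on
    one side has a partner giving the relevant terms the same signs, hence satisfying the same
    body. *)
Theorem sat_signs (f : form) : exists Q : seq term,
  forall (K K' : rcfType) (e : nat -> K) (e' : nat -> K'), agree e e' Q -> sat e f -> sat e' f.
Proof.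
suff [Q hQ] : exists Q : seq term, forall (K K' : rcfType) (e : nat -> K) (e' : nat -> K'),
    agree e e' Q -> sat e f <-> sat e' f.
  by exists Q => K K' e e' /hQ[].
have asym (K K' : rcfType) (e : nat -> K) (e' : nat -> K') Q : agree e e' Q -> agree e' e Q.
  by move=> A t /A.
have ex i g : (exists Q : seq term, forall (K K' : rcfType) (e : nat -> K) (e' : nat -> K'),
    agree e e' Q -> sat e g <-> sat e' g) ->
  exists Q : seq term, forall (K K' : rcfType) (e : nat -> K) (e' : nat -> K'), agree e e' Q ->
    exists rho : K -> K' -> Prop, [/\ forall x, exists x', rho x x', forall x', exists x, rho x x' &
      forall x x', rho x x' -> sat (updv e i x) g <-> sat (updv e' i x') g].
  move=> [Q hQ]; have [Q' hQ'] := sign_matching [seq tpoly i t | t <- Q].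
  exists Q' => K K' e e' /hQ'[rho D]; exists rho; split; [exact: match_tot D|exact: match_tot' D|].
  move=> x x' xx; apply: hQ => t tQ; rewrite -!pval_tpoly.
  apply: (match_sgz D xx (q := (pval e (tpoly i t), pval e' (tpoly i t)))).
  by apply: (map_f (fun q => (pval e q, pval e' q))); apply: map_f.
elim: f => [a b|a b|g [Q IH]|g [Q IHg] h [Q' IHh]|g [Q IHg] h [Q' IHh]|i g /(ex i)[Q IH]|i g /(ex i)[Q IH]].
- exists [:: TAdd a (TNeg b)] => K K' e e' /(_ (TAdd a (TNeg b))).
  rewrite inE eqxx => /(_ isT) /eqP; rewrite sgz_eq /= !subr_eq0 => /andP[/eqP h _].
  by split=> /eqP; [rewrite h|rewrite -h] => /eqP.
- exists [:: TAdd b (TNeg a)] => K K' e e' /(_ (TAdd b (TNeg a))).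
  by rewrite inE eqxx => /(_ isT) /eqP; rewrite sgz_eq /= !subr_gt0 => /andP[_ /eqP ->].
- by exists Q => K K' e e' /IH h /=; rewrite h.
- exists (Q ++ Q') => K K' e e' A /=; rewrite (IHg _ _ e e') ?(IHh _ _ e e') //.
    by apply: agree_sub A => t ht; rewrite mem_cat ht orbT.
  by apply: agree_sub A => t ht; rewrite mem_cat ht.
- exists (Q ++ Q') => K K' e e' A /=; rewrite (IHg _ _ e e') ?(IHh _ _ e e') //.
    by apply: agree_sub A => t ht; rewrite mem_cat ht orbT.
  by apply: agree_sub A => t ht; rewrite mem_cat ht.
- exists Q => K K' e e' /IH[rho [h1 h2 h3]] /=; split=> -[x hx].
    by have [x' xx] := h1 x; exists x'; apply/(h3 _ _ xx).
  by have [x' xx] := h2 x; exists x'; apply/(h3 _ _ xx).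
- exists Q => K K' e e' /IH[rho [h1 h2 h3]] /=; split=> hx x.
    by have [x' xx] := h2 x; apply/(h3 _ _ xx).
  by have [x' xx] := h1 x; apply/(h3 _ _ xx).
Qed.

(** Under the zero environment a term takes an integer value independent of the field, and integers
    have the same sign in all ordered fields. *)
Corollary sat_sentence (K K' : rcfType) (f : form) :
  sat (fun _ => 0 : K) f <-> sat (fun _ => 0 : K') f.
Proof.
have [Q hQ] := sat_signs f.
have A (F F' : rcfType) : agree (fun _ => 0 : F) (fun _ => 0 : F') Q.
  move=> t _.
  pose z := fix z (t : term) : int := match t with TVar _ => 0 | TZero => 0 | TOne => 1
    | TAdd a b => z a + z b | TMul a b => z a * z b | TNeg a => - z a end.
  have zE (G : rcfType) s : tval (fun _ => 0 : G) s = (z s)%:~R.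
    by elim: s => //= [a -> b ->|a -> b ->|a ->]; rewrite ?rmorphD ?rmorphM ?rmorphN.
  by rewrite !zE !sgz_int.
by split; apply: hQ.
Qed.

(** * The term model of a set of clauses *)

Definition clause_satb (v : nat -> bool) (ps : nat -> nat) (c : clause) : bool :=
  has (fun l : bool * tmpl => v (inst ps l.2) == l.1) c.

Record model := Model { mval : nat -> bool; mvalP : models mval }.

(** Clauses are addressed by position: 0 to 15 logic, 16 to 24 terms, 25 to 31 equality, 32 to 41
    field, 42 to 49 order and roots. *)
Lemma model_clause (M : model) (ps : seq nat) k : (k < size rcf_clauses)%N ->
  clause_satb (mval M) (nth 0%N ps) (nth [::] rcf_clauses k).
Proof.
move=> h; have := mvalP M (nth 0%N ps); elim: rcf_clauses k h => // c cs IH k h H.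
inversion_clear H as [|? ? H1 H2]; case: k h => [_|k h] /=; last exact: IH.
elim: H1 => [[b x] l /= ->|x l _ IHl] /=; first by rewrite eqxx.
by rewrite IHl orbT.
Qed.

Section ModelAxioms.
Variable M : model.
Local Notation v := (mval M).
Local Notation ax ps k := (model_clause M ps (isT : (k < size rcf_clauses)%N)).
Implicit Types a b c d s t i f g e : nat.

Lemma model_not f s : v (aholds (cpair 2 f) s) = ~~ v (aholds f s).
Proof.
have : [|| v (aholds (cpair 2 f) s) == false, v (aholds f s) == false | false] := ax [:: f; 0; s]%N 0.
have : [|| v (aholds (cpair 2 f) s) == true, v (aholds f s) == true | false] := ax [:: f; 0; s]%N 1%N.
by do 2![case: v].
Qed.

Lemma model_and f g s : v (aholds (cpair 3 (cpair f g)) s) = v (aholds f s) && v (aholds g s).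
Proof.
have : [|| v (aholds (cpair 3 (cpair f g)) s) == false, v (aholds f s) == true | false] := ax [:: f; g; s] 2%N.
have : [|| v (aholds (cpair 3 (cpair f g)) s) == false, v (aholds g s) == true | false] := ax [:: f; g; s] 3%N.
have : [|| v (aholds f s) == false, v (aholds g s) == false, v (aholds (cpair 3 (cpair f g)) s) == true | false] := ax [:: f; g; s] 4%N.
by do 3![case: v].
Qed.

Lemma model_or f g s : v (aholds (cpair 4 (cpair f g)) s) = v (aholds f s) || v (aholds g s).
Proof.
have : [|| v (aholds (cpair 4 (cpair f g)) s) == false, v (aholds f s) == true, v (aholds g s) == true | false] := ax [:: f; g; s] 5%N.
have : [|| v (aholds f s) == false, v (aholds (cpair 4 (cpair f g)) s) == true | false] := ax [:: f; g; s] 6%N.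
have : [|| v (aholds g s) == false, v (aholds (cpair 4 (cpair f g)) s) == true | false] := ax [:: f; g; s] 7%N.
by do 3![case: v].
Qed.

Lemma model_ex i f s : v (aholds (cpair 5 (cpair i f)) s) -> v (aholds f (econs i (ewit i f s) s)).
Proof.
have : [|| v (aholds (cpair 5 (cpair i f)) s) == false, v (aholds f (econs i (ewit i f s) s)) == true | false] := ax [:: f; 0; s; i]%N 8%N.
by do 2![case: v].
Qed.

Lemma model_exI i f s e : v (aholds f (econs i e s)) -> v (aholds (cpair 5 (cpair i f)) s).
Proof.
have : [|| v (aholds f (econs i e s)) == false, v (aholds (cpair 5 (cpair i f)) s) == true | false] := ax [:: f; 0; s; i; e]%N 9%N.
by do 2![case: v].
Qed.

Lemma model_all i f s e : v (aholds (cpair 6 (cpair i f)) s) -> v (aholds f (econs i e s)).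
Proof.
have : [|| v (aholds (cpair 6 (cpair i f)) s) == false, v (aholds f (econs i e s)) == true | false] := ax [:: f; 0; s; i; e]%N 10%N.
by do 2![case: v].
Qed.

Lemma model_allI i f s : v (aholds f (econs i (ewit i (cpair 2 f) s) s)) -> v (aholds (cpair 6 (cpair i f)) s).
Proof.
have : [|| v (aholds f (econs i (ewit i (cpair 2 f) s) s)) == false, v (aholds (cpair 6 (cpair i f)) s) == true | false] := ax [:: f; 0; s; i]%N 11%N.
by do 2![case: v].
Qed.

Lemma model_feq f g s : v (aholds (cpair 0 (cpair f g)) s) = v (aeq (eclos f s) (eclos g s)).
Proof.
have : [|| v (aholds (cpair 0 (cpair f g)) s) == false, v (aeq (eclos f s) (eclos g s)) == true | false] := ax [:: f; g; s] 12%N.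
have : [|| v (aholds (cpair 0 (cpair f g)) s) == true, v (aeq (eclos f s) (eclos g s)) == false | false] := ax [:: f; g; s] 13%N.
by do 2![case: v].
Qed.

Lemma model_flt f g s : v (aholds (cpair 1 (cpair f g)) s) = v (alt (eclos f s) (eclos g s)).
Proof.
have : [|| v (aholds (cpair 1 (cpair f g)) s) == false, v (alt (eclos f s) (eclos g s)) == true | false] := ax [:: f; g; s] 14%N.
have : [|| v (aholds (cpair 1 (cpair f g)) s) == true, v (alt (eclos f s) (eclos g s)) == false | false] := ax [:: f; g; s] 15%N.
by do 2![case: v].
Qed.

Let pos1 (b : bool) : [|| b == true | false] -> b. Proof. by case: b. Qed.

Lemma model_var i e s : v (aeq (eclos (cpair 0 i) (econs i e s)) e).
Proof. exact: (pos1 (ax [:: 0; 0; s; i; e]%N 16%N)). Qed.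
Lemma model_var_far i j e s : j != i ->
  v (aeq (eclos (cpair 0 j) (econs i e s)) (eclos (cpair 0 j) s)).
Proof.
rewrite neq_ltn => /orP[h|h].
  have /pos1 := ax [:: (i - j.+1)%N; 0; s; j; e]%N 18%N.
  by rewrite /= -/(aeq _ _); have -> : (j + (i - j.+1)).+1 = i by rewrite -addSn subnKC.
have /pos1 := ax [:: (j - i.+1)%N; 0; s; i; e]%N 17%N.
by rewrite /= -/(aeq _ _); have -> : (i + (j - i.+1)).+1 = j by rewrite -addSn subnKC.
Qed.
Lemma model_var0 i : v (aeq (eclos (cpair 0 i) 0) ezero).
Proof. exact: (pos1 (ax [:: 0; 0; 0; i]%N 19%N)). Qed.
Lemma model_tzero s : v (aeq (eclos (cpair 1 0) s) ezero).
Proof. exact: (pos1 (ax [:: 0; 0; s]%N 20%N)). Qed.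
Lemma model_tone s : v (aeq (eclos (cpair 2 0) s) eone).
Proof. exact: (pos1 (ax [:: 0; 0; s]%N 21%N)). Qed.
Lemma model_tadd t u s : v (aeq (eclos (cpair 3 (cpair t u)) s) (eadd (eclos t s) (eclos u s))).
Proof. exact: (pos1 (ax [:: t; u; s]%N 22%N)). Qed.
Lemma model_tmul t u s : v (aeq (eclos (cpair 4 (cpair t u)) s) (emul (eclos t s) (eclos u s))).
Proof. exact: (pos1 (ax [:: t; u; s]%N 23%N)). Qed.
Lemma model_tneg t s : v (aeq (eclos (cpair 5 t) s) (eneg (eclos t s))).
Proof. exact: (pos1 (ax [:: t; 0; s]%N 24%N)). Qed.

Lemma model_refl a : v (aeq a a).
Proof. exact: (pos1 (ax [:: a] 25%N)). Qed.
Lemma model_sym a b : v (aeq a b) -> v (aeq b a).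
Proof.
have : [|| v (aeq a b) == false, v (aeq b a) == true | false] := ax [:: a; b] 26%N.
by do 2![case: v].
Qed.
Lemma model_trans a b c : v (aeq a b) -> v (aeq b c) -> v (aeq a c).
Proof.
have : [|| v (aeq a b) == false, v (aeq b c) == false, v (aeq a c) == true | false] := ax [:: a; b; c] 27%N.
by do 3![case: v].
Qed.
Lemma model_cadd a b c d : v (aeq a b) -> v (aeq c d) -> v (aeq (eadd a c) (eadd b d)).
Proof.
have : [|| v (aeq a b) == false, v (aeq c d) == false, v (aeq (eadd a c) (eadd b d)) == true | false] := ax [:: a; b; c; d] 28%N.
by do 3![case: v].
Qed.
Lemma model_cmul a b c d : v (aeq a b) -> v (aeq c d) -> v (aeq (emul a c) (emul b d)).
Proof.
have : [|| v (aeq a b) == false, v (aeq c d) == false, v (aeq (emul a c) (emul b d)) == true | false] := ax [:: a; b; c; d] 29%N.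
by do 3![case: v].
Qed.
Lemma model_cneg a b : v (aeq a b) -> v (aeq (eneg a) (eneg b)).
Proof.
have : [|| v (aeq a b) == false, v (aeq (eneg a) (eneg b)) == true | false] := ax [:: a; b] 30%N.
by do 2![case: v].
Qed.
Lemma model_clt a b c d : v (aeq a b) -> v (aeq c d) -> v (alt a c) -> v (alt b d).
Proof.
have : [|| v (aeq a b) == false, v (aeq c d) == false, v (alt a c) == false, v (alt b d) == true | false] := ax [:: a; b; c; d] 31%N.
by do 4![case: v].
Qed.

Lemma model_addA a b c : v (aeq (eadd a (eadd b c)) (eadd (eadd a b) c)).
Proof. exact: (pos1 (ax [:: a; b; c] 32%N)). Qed.
Lemma model_addC a b : v (aeq (eadd a b) (eadd b a)).
Proof. exact: (pos1 (ax [:: a; b] 33%N)). Qed.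
Lemma model_add0 a : v (aeq (eadd ezero a) a).
Proof. exact: (pos1 (ax [:: a] 34%N)). Qed.
Lemma model_addN a : v (aeq (eadd (eneg a) a) ezero).
Proof. exact: (pos1 (ax [:: a] 35%N)). Qed.
Lemma model_mulA a b c : v (aeq (emul a (emul b c)) (emul (emul a b) c)).
Proof. exact: (pos1 (ax [:: a; b; c] 36%N)). Qed.
Lemma model_mulC a b : v (aeq (emul a b) (emul b a)).
Proof. exact: (pos1 (ax [:: a; b] 37%N)). Qed.
Lemma model_mul1 a : v (aeq (emul eone a) a).
Proof. exact: (pos1 (ax [:: a] 38%N)). Qed.
Lemma model_mulD a b c : v (aeq (emul (eadd a b) c) (eadd (emul a c) (emul b c))).
Proof. exact: (pos1 (ax [:: a; b; c] 39%N)). Qed.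
Lemma model_neq10 : ~~ v (aeq eone ezero).
Proof.
have : [|| v (aeq eone ezero) == false | false] := ax [::] 40%N.
by case: v.
Qed.
Lemma model_inv a : v (aeq a ezero) || v (aeq (emul (einv a) a) eone).
Proof.
have : [|| v (aeq a ezero) == true, v (aeq (emul (einv a) a) eone) == true | false] := ax [:: a] 41%N.
by do 2![case: v].
Qed.

Lemma model_ltxx a : ~~ v (alt a a).
Proof.
have : [|| v (alt a a) == false | false] := ax [:: a] 42%N.
by case: v.
Qed.
Lemma model_lt_trans a b c : v (alt a b) -> v (alt b c) -> v (alt a c).
Proof.
have : [|| v (alt a b) == false, v (alt b c) == false, v (alt a c) == true | false] := ax [:: a; b; c] 43%N.
by do 3![case: v].
Qed.
Lemma model_lt_total a b : [|| v (alt a b), v (aeq a b) | v (alt b a)].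
Proof.
have : [|| v (alt a b) == true, v (aeq a b) == true, v (alt b a) == true | false] := ax [:: a; b] 44%N.
by do 3![case: v].
Qed.
Lemma model_lt_add a b c : v (alt a b) -> v (alt (eadd a c) (eadd b c)).
Proof.
have : [|| v (alt a b) == false, v (alt (eadd a c) (eadd b c)) == true | false] := ax [:: a; b; c] 45%N.
by do 2![case: v].
Qed.
Lemma model_lt_mul a b : v (alt ezero a) -> v (alt ezero b) -> v (alt ezero (emul a b)).
Proof.
have : [|| v (alt ezero a) == false, v (alt ezero b) == false, v (alt ezero (emul a b)) == true | false] := ax [:: a; b] 46%N.
by do 3![case: v].
Qed.
Lemma model_ivt a b t s (r := eroot t s a b) : ~~ v (alt b a) -> ~~ v (alt ezero (eclos t (econs 0 a s))) ->
  ~~ v (alt (eclos t (econs 0 b s)) ezero) ->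
  [/\ ~~ v (alt r a), ~~ v (alt b r) & v (aeq (eclos t (econs 0 r s)) ezero)].
Proof.
have : [|| v (alt b a) == true, v (alt ezero (eclos t (econs 0 a s))) == true, v (alt (eclos t (econs 0 b s)) ezero) == true, v (alt r a) == false | false] := ax [:: a; b; t; s] 47%N.
have : [|| v (alt b a) == true, v (alt ezero (eclos t (econs 0 a s))) == true, v (alt (eclos t (econs 0 b s)) ezero) == true, v (alt b r) == false | false] := ax [:: a; b; t; s] 48%N.
have : [|| v (alt b a) == true, v (alt ezero (eclos t (econs 0 a s))) == true, v (alt (eclos t (econs 0 b s)) ezero) == true, v (aeq (eclos t (econs 0 r s)) ezero) == true | false] := ax [:: a; b; t; s] 49%N.
by do 6![case: v].
Qed.
End ModelAxioms.

(** * Classes of codes form a real closed field *)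

Section TermModel.
Variable M : model.
Local Notation v := (mval M).

Lemma rep_ex n : exists m, v (aeq n m). Proof. by exists n; apply: model_refl. Qed.
(** The least code of a class represents it, so the quotient is a subtype of [nat] and inherits its
    choice structure. *)
Definition rep n := ex_minn (rep_ex n).

Lemma rep_aeq n : v (aeq n (rep n)).
Proof. by rewrite /rep; case: ex_minnP. Qed.

Lemma rep_eqP a b : reflect (rep a = rep b) (v (aeq a b)).
Proof.
apply: (iffP idP) => [ab|e]; last first.
  by apply: model_trans (rep_aeq a) _; rewrite e; apply: model_sym; apply: rep_aeq.
apply/eqP; rewrite eqn_leq; apply/andP; split; rewrite {1}/rep; case: ex_minnP => m _; apply.
  exact: model_trans ab (rep_aeq b).
exact: model_trans (model_sym ab) (rep_aeq a).
Qed.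

Lemma rep_idem n : rep (rep n) == rep n.
Proof. by apply/eqP/esym/rep_eqP/rep_aeq. Qed.

Record elt := Elt { elt_code : nat; elt_codeP : rep elt_code == elt_code }.
HB.instance Definition _ := [isSub for elt_code].
HB.instance Definition _ := [Choice of elt by <:].

Definition cls n : elt := Elt (rep_idem n).

Lemma clsK x : cls (elt_code x) = x.
Proof. by apply: val_inj; apply/eqP; exact: elt_codeP x. Qed.

Lemma cls_eq a b : (cls a == cls b) = v (aeq a b).
Proof. by rewrite -val_eqE /=; apply/eqP/idP => [/rep_eqP|/rep_eqP]. Qed.

Lemma cls_eqP a b : v (aeq a b) -> cls a = cls b.
Proof. by rewrite -cls_eq => /eqP. Qed.

Lemma cls_code n : v (aeq (elt_code (cls n)) n).
Proof. by apply: model_sym; apply: rep_aeq. Qed.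

Definition elt_add x y := cls (eadd (elt_code x) (elt_code y)).
Definition elt_mul x y := cls (emul (elt_code x) (elt_code y)).
Definition elt_opp x := cls (eneg (elt_code x)).
Definition elt_lt x y := v (alt (elt_code x) (elt_code y)).
Definition elt_inv x := if x == cls ezero then cls ezero else cls (einv (elt_code x)).

Lemma cls_add a b : cls (eadd a b) = elt_add (cls a) (cls b).
Proof. by apply: cls_eqP; apply: model_cadd; apply: rep_aeq. Qed.
Lemma cls_mul a b : cls (emul a b) = elt_mul (cls a) (cls b).
Proof. by apply: cls_eqP; apply: model_cmul; apply: rep_aeq. Qed.
Lemma cls_opp a : cls (eneg a) = elt_opp (cls a).
Proof. by apply: cls_eqP; apply: model_cneg; apply: rep_aeq. Qed.
Lemma cls_lt a b : elt_lt (cls a) (cls b) = v (alt a b).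
Proof. by apply/idP/idP; apply: model_clt; rewrite ?cls_code // model_sym ?cls_code. Qed.

Lemma elt_addA : associative elt_add.
Proof. by move=> x y z; rewrite -(clsK x) -(clsK y) -(clsK z) -!cls_add; apply/cls_eqP/model_addA. Qed.
Lemma elt_addC : commutative elt_add.
Proof. by move=> x y; rewrite -(clsK x) -(clsK y) -!cls_add; apply/cls_eqP/model_addC. Qed.
Lemma elt_add0 : left_id (cls ezero) elt_add.
Proof. by move=> x; rewrite -(clsK x) -!cls_add; apply/cls_eqP/model_add0. Qed.
Lemma elt_addN : left_inverse (cls ezero) elt_opp elt_add.
Proof. by move=> x; rewrite -(clsK x) -cls_opp -!cls_add; apply/cls_eqP/model_addN. Qed.
HB.instance Definition _ := GRing.isZmodule.Build elt elt_addA elt_addC elt_add0 elt_addN.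

Lemma elt_mulA : associative elt_mul.
Proof. by move=> x y z; rewrite -(clsK x) -(clsK y) -(clsK z) -!cls_mul; apply/cls_eqP/model_mulA. Qed.
Lemma elt_mulC : commutative elt_mul.
Proof. by move=> x y; rewrite -(clsK x) -(clsK y) -!cls_mul; apply/cls_eqP/model_mulC. Qed.
Lemma elt_mul1 : left_id (cls eone) elt_mul.
Proof. by move=> x; rewrite -(clsK x) -!cls_mul; apply/cls_eqP/model_mul1. Qed.
Lemma elt_mulDl : left_distributive elt_mul elt_add.
Proof.
by move=> x y z; rewrite -(clsK x) -(clsK y) -(clsK z) -(cls_add _ (elt_code y)) -!cls_mul -cls_add; apply/cls_eqP/model_mulD.
Qed.
Lemma elt_neq10 : cls eone != 0.
Proof. by rewrite cls_eq model_neq10. Qed.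
HB.instance Definition _ := GRing.Zmodule_isComNzRing.Build elt elt_mulA elt_mulC elt_mul1 elt_mulDl elt_neq10.

Lemma elt_mulVf (x : elt) : x != 0 -> elt_inv x * x = 1.
Proof.
rewrite /elt_inv; have -> : 0 = cls ezero by [].
move=> x0; rewrite (negbTE x0) -{2}(clsK x); rewrite -[LHS]/(elt_mul _ _) -cls_mul; apply: cls_eqP.
by move: x0; rewrite -{1}(clsK x) cls_eq => /negbTE x0; have := model_inv M (elt_code x); rewrite x0.
Qed.
Lemma elt_inv0 : elt_inv 0 = 0.
Proof. by rewrite /elt_inv eqxx. Qed.
HB.instance Definition _ := GRing.ComNzRing_isField.Build elt elt_mulVf elt_inv0.

Definition elt_le (x y : elt) := (x == y) || elt_lt x y.
Definition elt_norm (x : elt) := if elt_lt x 0 then - x else x.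

Lemma elt_lt_irr x : ~~ elt_lt x x.
Proof. exact: model_ltxx. Qed.
Lemma elt_lt_trans y x z : elt_lt x y -> elt_lt y z -> elt_lt x z.
Proof. exact: model_lt_trans. Qed.
Lemma elt_lt_total x y : [|| elt_lt x y, x == y | elt_lt y x].
Proof. by have := model_lt_total M (elt_code x) (elt_code y); rewrite -cls_eq !clsK. Qed.
Lemma elt_lt_addr (x y z : elt) : elt_lt x y -> elt_lt (x + z) (y + z).
Proof.
rewrite -(clsK x) -(clsK y) -(clsK z) -![_ + _]/(elt_add _ _) -!cls_add !cls_lt.
exact: model_lt_add.
Qed.
Lemma elt_lt0_add (x y : elt) : elt_lt 0 x -> elt_lt 0 y -> elt_lt 0 (x + y).
Proof.
by move=> h1 h2; apply: elt_lt_trans h2 _; have := elt_lt_addr y h1; rewrite add0r.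
Qed.
Lemma elt_lt0_mul (x y : elt) : elt_lt 0 x -> elt_lt 0 y -> elt_lt 0 (x * y).
Proof.
have -> : 0 = cls ezero by [].
rewrite -(clsK x) -(clsK y) -![_ * _]/(elt_mul _ _) -!cls_mul !cls_lt.
exact: model_lt_mul.
Qed.
Lemma elt_lt0_ngt0 (x : elt) : elt_lt 0 x -> ~~ elt_lt x 0.
Proof. by move=> h; apply/negP => /(elt_lt_trans h); rewrite (negbTE (elt_lt_irr 0)). Qed.
Lemma elt_sub_gt0 (x y : elt) : elt_lt 0 (y - x) = elt_lt x y.
Proof.
apply/idP/idP => h; first by have := elt_lt_addr x h; rewrite add0r subrK.
by have := elt_lt_addr (- x) h; rewrite subrr.
Qed.
Lemma elt_lt0_total (x : elt) : x != 0 -> elt_lt 0 x || elt_lt x 0.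
Proof. by move=> x0; have := elt_lt_total 0 x; rewrite eq_sym (negbTE x0). Qed.
Lemma elt_normN (x : elt) : elt_norm (- x) = elt_norm x.
Proof.
rewrite /elt_norm -(elt_sub_gt0 (- x)) opprK add0r -(elt_sub_gt0 x) add0r.
case: (boolP (elt_lt 0 x)) => hx; case: (boolP (elt_lt 0 (- x))) => hnx; rewrite ?opprK //.
  by have := elt_lt0_add hx hnx; rewrite subrr (negbTE (elt_lt_irr _)).
have := elt_lt_total 0 x; rewrite (negbTE hx) /= => /orP[/eqP <-|]; first by rewrite oppr0.
by rewrite -elt_sub_gt0 add0r (negbTE hnx).
Qed.
Lemma elt_ge0_norm (x : elt) : elt_le 0 x -> elt_norm x = x.
Proof.
rewrite /elt_norm /elt_le => /orP[/eqP <-|h]; first by rewrite (negbTE (elt_lt_irr _)).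
by rewrite (negbTE (elt_lt0_ngt0 h)).
Qed.
HB.instance Definition _ := Num.IntegralDomain_isLtReal.Build elt
  elt_lt0_add elt_lt0_mul elt_lt0_ngt0 elt_sub_gt0 elt_lt0_total elt_normN elt_ge0_norm (fun x y => erefl).

Fixpoint cenv (k s : nat) : nat -> elt :=
  match k, s with
  | k.+1, m.+1 => updv (cenv k (unpairr m)) (unpairl (unpairl m)) (cls (unpairr (unpairl m)))
  | _, _ => fun _ => 0
  end.

(* [tval] and [sat] apply to a [rcfType] only, so closed terms are evaluated by [kval] until [elt] is known to be real closed. *)
Fixpoint kval (e : nat -> elt) (t : term) : elt :=
  match t with
  | TVar i => e i
  | TZero => 0
  | TOne => 1
  | TAdd a b => kval e a + kval e b
  | TMul a b => kval e a * kval e b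
  | TNeg a => - kval e a
  end.

Definition env_rel (s : nat) (e : nat -> elt) := forall i, cls (eclos (cpair 0 i) s) = e i.

Lemma env_rel0 : env_rel 0 (fun _ => 0).
Proof. by move=> i; apply: cls_eqP; apply: model_var0. Qed.

Lemma env_rel_cons i x s e : env_rel s e -> env_rel (econs i x s) (updv e i (cls x)).
Proof.
move=> h j; rewrite /updv; have [->|ji] := eqVneq j i.
  by rewrite PeanoNat.Nat.eqb_refl; apply/cls_eqP/model_var.
rewrite (introF (PeanoNat.Nat.eqb_spec j i)); last exact/eqP.
by rewrite -h; apply/cls_eqP/model_var_far.
Qed.

Lemma cls_clos s e t : env_rel s e -> cls (eclos (code_term t) s) = kval e t.
Proof.
move=> h; elim: t => [i|||a IHa b IHb|a IHa b IHb|a IHa] //=.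
- exact/cls_eqP/model_tzero.
- exact/cls_eqP/model_tone.
- by rewrite -IHa -IHb (cls_eqP (model_tadd M _ _ _)) cls_add.
- by rewrite -IHa -IHb (cls_eqP (model_tmul M _ _ _)) cls_mul.
- by rewrite -IHa (cls_eqP (model_tneg M _ _)) cls_opp.
Qed.

(** The root clauses speak of coded terms. An arbitrary polynomial is therefore written in Horner
    form, with its argument in variable 0 and its coefficients supplied by the environment from
    variable [i] on. *)
Fixpoint horner_term (i n : nat) : term :=
  if n is n'.+1 then TAdd (TVar i) (TMul (TVar 0) (horner_term i.+1 n')) else TZero.

Fixpoint coef_env (i : nat) (cs : seq elt) : nat :=
  if cs is c :: cs' then econs i (elt_code c) (coef_env i.+1 cs') else 0.

Lemma horner_term_val x i cs : exists2 e, env_rel (coef_env i.+1 cs) e &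
  (forall e', (forall j, (i < j)%N -> e' j = e j) -> e' 0%N = x -> kval e' (horner_term i.+1 (size cs)) = (Poly cs).[x]).
Proof.
elim: cs i => [|c cs IH] i.
  by exists (fun _ => 0); [exact: env_rel0|move=> e' _ _ /=; rewrite horner0].
have [e h1 h2] := IH i.+1.
exists (updv e i.+1 c); first by have := env_rel_cons i.+1 (elt_code c) h1; rewrite clsK.
move=> e' he e0 /=; rewrite cons_poly_def hornerD hornerM hornerX hornerC (h2 e') //.
  by rewrite he // /updv PeanoNat.Nat.eqb_refl e0 addrC mulrC.
move=> j ij; rewrite he ?(ltn_trans _ ij) // /updv (introF (PeanoNat.Nat.eqb_spec j i.+1)) //.
by apply/eqP; rewrite gtn_eqF.
Qed.

Lemma elt_ivt : Num.real_closed_axiom elt.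
Proof.
move=> p a b ab /andP[pa pb].
pose s := coef_env 1 p; pose t := code_term (horner_term 1 (size p)).
have tE x : cls (eclos t (econs 0 x s)) = p.[cls x].
  have [e h1 h2] := horner_term_val (cls x) 0 p.
  rewrite (cls_clos _ (env_rel_cons 0 x h1)) h2 ?polyseqK //.
  by move=> j j0; rewrite /updv; case: j j0.
have ltE x y : v (alt x y) = (cls x < cls y) by rewrite -cls_lt.
have := @model_ivt M (elt_code a) (elt_code b) t s.
cbv zeta.
rewrite !ltE !tE -!leNgt -!cls_eq !tE !clsK => /(_ ab pa pb) [h1 h2 /eqP h3].
by exists (cls (eroot t s (elt_code a) (elt_code b))); [rewrite h1|apply/eqP].
Qed.
HB.instance Definition _ := Num.RealField_isClosed.Build elt elt_ivt.

Lemma kvalE e t : kval e t = tval e t.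
Proof. by elim: t => //= [a -> b ->|a -> b ->|a ->]. Qed.

(** The truth lemma of the Henkin construction: witness clauses handle the quantifiers, and every
    element is the class of a code. *)
Lemma model_sat f s e : env_rel s e -> v (aholds (code_form f) s) <-> sat e f.
Proof.
have val t s' e' : env_rel s' e' -> cls (eclos (code_term t) s') = tval e' t.
  by move=> h; rewrite (cls_clos t h) kvalE.
elim: f s e => [a b|a b|g IH|g IHg h IHh|g IHg h IHh|i g IH|i g IH] s e r /=.
- by rewrite model_feq -cls_eq !(val _ _ _ r); split=> /eqP.
- by rewrite model_flt -cls_lt !(val _ _ _ r).
- by rewrite model_not -(IH _ _ r); split=> /negP.
- by rewrite model_and -(IHg _ _ r) -(IHh _ _ r); split=> /andP.
- by rewrite model_or -(IHg _ _ r) -(IHh _ _ r); split=> /orP.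
- split=> [/model_ex h|[x hx]].
    by exists (cls (ewit i (code_form g) s)); apply/(IH _ _ (env_rel_cons i _ r)).
  apply: (@model_exI _ _ _ _ (elt_code x)); apply/(IH _ _ (env_rel_cons i _ r)).
  by rewrite clsK.
- split=> [h x|h].
    by rewrite -(clsK x); apply/(IH _ _ (env_rel_cons i _ r)); apply: model_all.
  by apply: model_allI; apply/(IH _ _ (env_rel_cons i _ r)).
Qed.
End TermModel.

Theorem model_sentence (M : model) (K : rcfType) (f : form) :
  mval M (aholds (code_form f) 0) <-> sat (fun _ => 0 : K) f.
Proof. rewrite (model_sat f (env_rel0 M)); exact: sat_sentence. Qed.

(** * Transfer to the standard reals *)

Lemma tval_teval (e : nat -> R) (t : term) : tval e t = teval e t.
Proof. by elim: t => //= [a -> b ->|a -> b ->|a ->]. Qed.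

Lemma sat_holds (f : form) (e : nat -> R) : sat e f <-> holds e f.
Proof.
elim: f e => [a b|a b|g IH|g IHg h IHh|g IHg h IHh|i g IH|i g IH] e /=.
- by rewrite !tval_teval.
- by rewrite !tval_teval; split=> /RltP.
- by rewrite IH.
- by rewrite IHg IHh.
- by rewrite IHg IHh.
- by split=> -[x hx]; exists x; apply/IH.
- by split=> h x; apply/IH.
Qed.

Theorem truth_computable : exists e, forall f, Defs.eval e [:: code_form f] (truth f).
Proof.
apply: truth_computable_of_completeness => v Mv f.
by rewrite -sat_holds; apply: (model_sentence (Model Mv)).
Qed.

Theorem holds_signs (f : form) : exists Q : list term, forall e e' : nat -> R,
  (forall t, List.In t Q -> same_sign (teval e t) (teval e' t)) ->
  holds e f -> holds e' f.
Proof.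
have [Q hQ] := sat_signs f; exists Q => e e' h; rewrite -!sat_holds; apply: hQ => t tQ.
have InQ : List.In t Q by elim: Q {h} tQ => //= a Q IH; rewrite inE => /orP[/eqP ->|/IH]; [left|right].
have [h0 h1] := h t InQ; rewrite !tval_teval; apply/eqP; rewrite sgz_eq.
apply/andP; split; apply/eqP; apply/idP/idP.
- by move=> /eqP /h0 /eqP.
- by move=> /eqP /h0 /eqP.
- by move=> /RltP /h1 /RltP.
- by move=> /RltP /h1 /RltP.
Qed.

Lemma teval_roots (t : term) (e : nat -> R) (i : nat) :
  (forall x, teval (upd e i x) t = IZR Z0) \/ exists s : list R, forall x, teval (upd e i x) t = IZR Z0 -> List.In x s.
Proof.
have E x : (pval e (tpoly i t)).[x] = teval (upd e i x) t by rewrite pval_tpoly tval_teval.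
have [p0|p0] := eqVneq (pval e (tpoly i t)) 0; first by left=> x; rewrite -E p0 horner0.
right; have [s hs] := roots_finite [:: pval e (tpoly i t)].
exists s => x; rewrite -E => h; have := hs _ x (mem_head _ _) p0; rewrite /root; have -> : (pval e (tpoly i t)).[x] = 0 by exact: h.
rewrite eqxx => /(_ isT).
by elim: s {hs} => //= a s IH; rewrite inE => /orP[/eqP ->|/IH]; [left|right].
Qed.

End RealClosed.

Local Open Scope R_scope.

(** * Solution sets *)

(** R^n is represented by the environments that vanish from index [n] on, so that its points can be
    fed to [holds] directly. *)
Definition supported (n : nat) (x : nat -> R) := forall i, (n <= i)%nat -> x i = 0.
Definition near (n : nat) (r : R) (x y : nat -> R) := forall i, (i < n)%nat -> Rabs (x i - y i) < r.

Lemma near_refl n r x : 0 < r -> near n r x x.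
Proof. intros hr i _. rewrite Rminus_diag, Rabs_R0. assumption. Qed.
Lemma near_mono n r r' x y : r <= r' -> near n r x y -> near n r' x y.
Proof. intros h H i hi. specialize (H i hi). lra. Qed.

Lemma teval_continuous n t x eps : 0 < eps -> exists d, 0 < d /\
  forall y, supported n x -> supported n y -> near n d x y -> Rabs (teval x t - teval y t) < eps.
Proof.
  revert eps; induction t as [i| | |a IHa b IHb|a IHa b IHb|a IHa]; intros eps he; simpl.
  - exists eps. split; [assumption|]. intros y hx hy h. destruct (lt_dec i n) as [hi|hi]; [auto|].
    rewrite hx, hy by lia. rewrite Rminus_diag, Rabs_R0. assumption.
  - exists 1. split; [lra|]. intros. rewrite Rminus_diag, Rabs_R0. assumption.
  - exists 1. split; [lra|]. intros. rewrite Rminus_diag, Rabs_R0. assumption.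
  - destruct (IHa (eps / 2)) as (d1 & h1 & H1); [lra|]. destruct (IHb (eps / 2)) as (d2 & h2 & H2); [lra|].
    exists (Rmin d1 d2). split; [now apply Rmin_glb_lt|]. intros y hx hy h.
    specialize (H1 y hx hy (near_mono (Rmin_l _ _) h)). specialize (H2 y hx hy (near_mono (Rmin_r _ _) h)).
    apply Rabs_def2 in H1, H2. apply Rabs_def1; lra.
  - set (A := teval x a) in *. set (B := teval x b) in *.
    assert (hA : 0 <= Rabs A) by apply Rabs_pos. assert (hB : 0 <= Rabs B) by apply Rabs_pos.
    destruct (IHa (eps / (2 * (Rabs B + 1)))) as (d1 & h1 & H1); [apply Rdiv_lt_0_compat; lra|].
    (* The bound 1 keeps the second factor at [y] below [Rabs B + 1]. *)
    destruct (IHb (Rmin 1 (eps / (2 * (Rabs A + 1))))) as (d2 & h2 & H2);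
      [apply Rmin_glb_lt; [lra|apply Rdiv_lt_0_compat; lra]|].
    exists (Rmin d1 d2). split; [now apply Rmin_glb_lt|]. intros y hx hy h.
    specialize (H1 y hx hy (near_mono (Rmin_l _ _) h)). specialize (H2 y hx hy (near_mono (Rmin_r _ _) h)).
    pose proof (Rlt_le_trans _ _ _ H2 (Rmin_l _ _)) as H3. pose proof (Rlt_le_trans _ _ _ H2 (Rmin_r _ _)) as H4.
    set (A' := teval y a) in *. set (B' := teval y b) in *.
    replace (A * B - A' * B') with (A * (B - B') + B' * (A - A')) by ring.
    eapply Rle_lt_trans; [apply Rabs_triang|]. rewrite !Rabs_mult.
    assert (hB' : Rabs B' < Rabs B + 1).
    { replace B' with (B + (B' - B)) by ring. eapply Rle_lt_trans; [apply Rabs_triang|].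
      rewrite (Rabs_minus_sym B' B). lra. }
    assert (e1 : eps / (2 * (Rabs A + 1)) * (Rabs A + 1) = eps / 2) by (field; lra).
    assert (e2 : eps / (2 * (Rabs B + 1)) * (Rabs B + 1) = eps / 2) by (field; lra).
    assert (p1 : 0 < eps / (2 * (Rabs A + 1))) by (apply Rdiv_lt_0_compat; lra).
    assert (p2 : 0 < eps / (2 * (Rabs B + 1))) by (apply Rdiv_lt_0_compat; lra).
    assert (Rabs A * Rabs (B - B') <= Rabs A * (eps / (2 * (Rabs A + 1)))) by (apply Rmult_le_compat_l; lra).
    assert (Rabs B' * Rabs (A - A') <= (Rabs B + 1) * (eps / (2 * (Rabs B + 1)))).
    { apply Rmult_le_compat; try apply Rabs_pos; lra. }
    nra.
  - destruct (IHa eps he) as (d & h & H). exists d. split; [assumption|]. intros y hx hy hn.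
    replace (- teval x a - - teval y a) with (- (teval x a - teval y a)) by ring. rewrite Rabs_Ropp. auto.
Qed.

Lemma teval_sign_open n Q x : supported n x -> exists d, 0 < d /\ forall t y, In t Q -> supported n y -> near n d x y ->
  (0 < teval x t -> 0 < teval y t) /\ (teval x t < 0 -> teval y t < 0).
Proof.
  intro hx. induction Q as [|t Q (d & hd & H)].
  - exists 1. split; [lra|]. intros t y [].
  - destruct (Rtotal_order (teval x t) 0) as [h|[h|h]].
    + destruct (@teval_continuous n t x (- teval x t)) as (d' & hd' & H'); [lra|].
      exists (Rmin d d'). split; [now apply Rmin_glb_lt|]. intros t' y [<-|ht] hy hn.
      * specialize (H' y hx hy (near_mono (Rmin_r _ _) hn)). apply Rabs_def2 in H'. lra.
      * exact (H t' y ht hy (near_mono (Rmin_l _ _) hn)).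
    + exists d. split; [assumption|]. intros t' y [<-|ht] hy hn; [lra|auto].
    + destruct (@teval_continuous n t x (teval x t)) as (d' & hd' & H'); [lra|].
      exists (Rmin d d'). split; [now apply Rmin_glb_lt|]. intros t' y [<-|ht] hy hn.
      * specialize (H' y hx hy (near_mono (Rmin_r _ _) hn)). apply Rabs_def2 in H'. lra.
      * exact (H t' y ht hy (near_mono (Rmin_l _ _) hn)).
Qed.

Definition solution (n : nat) (f : form) (x : nat -> R) : Prop := supported n x /\ holds x f.

Definition zerob (x : nat -> R) (t : term) : bool := if Req_EM_T (teval x t) 0 then true else false.

Lemma zerob_spec x t : zerob x t = true <-> teval x t = 0.
Proof. unfold zerob. destruct Req_EM_T; split; intro; try easy. Qed.

(** A subset with at least as many elements is the whole set; to be applied to sets of vanishing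
    polynomials. *)
Lemma filter_length_incl {A} (p q : A -> bool) l :
  (forall a, In a l -> q a = true -> p a = true) -> (length (filter p l) <= length (filter q l))%nat ->
  forall a, In a l -> p a = true -> q a = true.
Proof.
  intro H. assert (G : forall l, (forall a, In a l -> q a = true -> p a = true) ->
    (length (filter q l) <= length (filter p l))%nat).
  { clear. intros l H. induction l as [|a l IH]; [simpl; lia|]. simpl.
    assert (IH' : (length (filter q l) <= length (filter p l))%nat) by (apply IH; intros; apply H; simpl; auto).
    specialize (H a (or_introl eq_refl)). destruct (q a), (p a); simpl; try lia; discriminate (H eq_refl). }
  induction l as [|b l IH]; simpl; [easy|]. intros hl a.
  assert (H' : forall a, In a l -> q a = true -> p a = true) by (intros; apply H; simpl; auto).
  specialize (G l H'). pose proof (H b (or_introl eq_refl)) as hb.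
  intros [<-|ha] pa.
  - destruct (q b); [reflexivity|]. rewrite pa in hl. simpl in hl. lia.
  - apply (IH H'); auto. destruct (q b), (p b); simpl in hl; try lia; discriminate (hb eq_refl).
Qed.

(* At a solution where the fewest of the relevant polynomials vanish, the vanishing pattern is locally constant on
   the solution set, which is therefore locally closed there. *)
Lemma solution_locally_closed n f x0 : solution n f x0 -> exists x1 r Z, solution n f x1 /\ 0 < r /\
  forall y, supported n y -> near n r x1 y -> (solution n f y <-> forall t, In t Z -> teval y t = 0).
Proof.
  intro h0. destruct (RealClosed.holds_signs f) as [Q hQ].
  destruct (@least_nat (fun k => exists x, solution n f x /\ length (filter (zerob x) Q) = k) _ (ex_intro _ x0 (conj h0 eq_refl)))
    as (k & (x1 & h1 & hk) & hmin).
  destruct (teval_sign_open Q (proj1 h1)) as (r & hr & H).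
  exists x1, r, (filter (zerob x1) Q). split; [assumption|split; [assumption|]].
  intros y hy hn.
  (* A polynomial nonzero at [x1] stays nonzero nearby, so no new zeros appear; minimality forbids a
     solution with fewer. *)
  assert (Hz : forall t, In t Q -> teval y t = 0 -> teval x1 t = 0).
  { intros t ht e. destruct (H t y ht hy hn) as [H1 H2]. destruct (Rtotal_order (teval x1 t) 0) as [h|[h|h]]; [|assumption|].
    - specialize (H2 h). lra.
    - specialize (H1 h). lra. }
  split.
  - intros sy t ht. apply filter_In in ht as [ht e].
    apply zerob_spec. revert t ht e. apply filter_length_incl.
    + intros t ht e. apply zerob_spec in e. apply zerob_spec. auto.
    + destruct (le_lt_dec (length (filter (zerob x1) Q)) (length (filter (zerob y) Q))) as [h|h]; [assumption|].
      exfalso. rewrite hk in h. apply (hmin _ h). eauto.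
  - intro hz. split; [assumption|]. apply (hQ x1 y); [|exact (proj2 h1)].
    intros t ht. specialize (Hz t ht). destruct (H t y ht hy hn) as [H1 H2].
    assert (Hz' : teval x1 t = 0 -> teval y t = 0).
    { intro e. apply hz, filter_In. split; [assumption|]. now apply zerob_spec. }
    unfold same_sign. split; [tauto|]. destruct (Rtotal_order (teval x1 t) 0) as [h|[h|h]].
    + specialize (H2 h). lra.
    + specialize (Hz' h). lra.
    + specialize (H1 h). lra.
Qed.

(** * Baire category in solution sets *)

Lemma near_room n r x y : 0 < r -> near n r x y -> exists d, 0 < d /\ forall i, (i < n)%nat -> Rabs (x i - y i) + d <= r.
Proof.
  intros hr. induction n as [|n IH]; intro H.
  - exists 1. split; [lra|]. intros; lia.
  - destruct IH as (d & hd & Hd); [intros i hi; apply H; lia|].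
    assert (hn : Rabs (x n - y n) < r) by (apply H; lia).
    exists (Rmin d (r - Rabs (x n - y n))). split; [apply Rmin_glb_lt; lra|].
    intros i hi. destruct (Nat.eq_dec i n) as [->|e].
    + pose proof (Rmin_r d (r - Rabs (x n - y n))). lra.
    + pose proof (Rmin_l d (r - Rabs (x n - y n))). specialize (Hd i ltac:(lia)). lra.
Qed.

Lemma dependent_choice {A} (inv : A -> Prop) (rel : nat -> A -> A -> Prop) a0 : inv a0 ->
  (forall k a, inv a -> exists b, inv b /\ rel k a b) ->
  exists s : nat -> A, s 0%nat = a0 /\ forall k, inv (s k) /\ rel k (s k) (s (S k)).
Proof.
  intros h0 H.
  set (step := fun k (a : {a | inv a}) =>
    let (b, hb) := constructive_indefinite_description _ (H k (proj1_sig a) (proj2_sig a)) in exist inv b (proj1 hb)).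
  set (s := nat_rect (fun _ => {a | inv a}) (exist inv a0 h0) step).
  exists (fun k => proj1_sig (s k)). split; [reflexivity|]. intro k. split; [exact (proj2_sig (s k))|].
  change (s (S k)) with (step k (s k)). unfold step.
  destruct (constructive_indefinite_description _ _) as [b hb]. exact (proj2 hb).
Qed.

Lemma nested_intervals (u rho : nat -> R) : (forall k, 0 < rho k) ->
  (forall k, Rabs (u k - u (S k)) + rho (S k) <= rho k) -> exists x, forall k, Rabs (x - u k) <= rho k.
Proof.
  intros hr H.
  assert (Hn : forall k m, u k - rho k <= u (k + m)%nat - rho (k + m)%nat /\ u (k + m)%nat + rho (k + m)%nat <= u k + rho k).
  { intros k m. induction m as [|m IH]; [rewrite Nat.add_0_r; lra|].
    specialize (H (k + m)%nat). rewrite Nat.add_succ_r.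
    pose proof (Rle_abs (u (k + m)%nat - u (S (k + m)))). pose proof (Rle_abs (- (u (k + m)%nat - u (S (k + m))))).
    rewrite Rabs_Ropp in *. lra. }
  assert (Hkm : forall k m, u k - rho k <= u m + rho m).
  { intros k m. destruct (le_lt_dec k m) as [h|h].
    - destruct (Hn k (m - k)%nat) as [h1 h2]. replace (k + (m - k))%nat with m in * by lia. specialize (hr m). lra.
    - destruct (Hn m (k - m)%nat) as [h1 h2]. replace (m + (k - m))%nat with k in * by lia. specialize (hr k). lra. }
  destruct (completeness (fun z => exists k, z = u k - rho k)) as [x [hx1 hx2]].
  - exists (u 0%nat + rho 0%nat). intros z [k ->]. apply Hkm.
  - exists (u 0%nat - rho 0%nat). eauto.
  - exists x. intro k. apply Rabs_le. split.
    + assert (u k - rho k <= x) by (apply hx1; eauto). lra.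
    + assert (x <= u k + rho k) by (apply hx2; intros z [m ->]; apply Hkm). lra.
Qed.

(** In the ball of radius [r] about [x1] the set [D] is the zero set of [Z], so limits inside the
    ball stay in [D]. Nested balls with centres in [D] are chosen, the k-th choice avoiding the
    hyperplane where coordinate [j k] equals [c k]. *)
Lemma baire n (D : (nat -> R) -> Prop) x1 r Z (c : nat -> R) (j : nat -> nat) :
  (forall x, D x -> supported n x) -> D x1 -> 0 < r ->
  (forall y, supported n y -> near n r x1 y -> (forall t, In t Z -> teval y t = 0) -> D y) ->
  (forall y t, D y -> near n r x1 y -> In t Z -> teval y t = 0) ->
  (forall k, (j k < n)%nat) ->
  (forall k y rho, D y -> near n r x1 y -> 0 < rho -> exists z, D z /\ near n rho y z /\ z (j k) <> c k) ->
  exists x, D x /\ forall k, x (j k) <> c k.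
Proof.
  intros Dsupp D1 hr Dclosed Dzero hj Hloc.
  set (inv := fun p : (nat -> R) * R => D (fst p) /\ 0 < snd p /\ forall i, (i < n)%nat -> Rabs (x1 i - fst p i) + snd p < r).
  set (rel := fun k (p q : (nat -> R) * R) => (forall i, (i < n)%nat -> Rabs (fst p i - fst q i) + snd q <= snd p) /\
     snd q < Rabs (fst q (j k) - c k) /\ snd q <= / INR (S k)).
  assert (nearI : forall p, inv p -> near n r x1 (fst p)).
  { intros p (_ & h1 & h2) i hi. specialize (h2 i hi). lra. }
  (* Half the radius leaves a margin, so that the limit still lies in the ball where [D] is
     closed. *)
  destruct (@dependent_choice _ inv rel (x1, r / 2)) as (s & s0 & Hs).
  - split; [exact D1|split; [simpl; lra|]]. intros i _. simpl. rewrite Rminus_diag, Rabs_R0. lra.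
  - intros k [y rho] hp. pose proof (nearI _ hp) as hn. destruct hp as (h1 & h2 & h3). simpl in *.
    destruct (Hloc k y rho h1 hn h2) as (z & hz1 & hz2 & hz3).
    destruct (near_room h2 hz2) as (d & hd & Hd).
    assert (hne : 0 < Rabs (z (j k) - c k)) by (apply Rabs_pos_lt; lra).
    assert (hk : 0 < / INR (S k)) by (apply Rinv_0_lt_compat, lt_0_INR; lia).
    (* Below the distance to the hyperplane, so that even the closed ball avoids it, and at most
       [/ INR (S k)], so that the centres converge. *)
    set (d' := Rmin d (Rmin (Rabs (z (j k) - c k) / 2) (/ INR (S k)))).
    pose proof (Rmin_l d (Rmin (Rabs (z (j k) - c k) / 2) (/ INR (S k)))) as m1.
    pose proof (Rmin_r d (Rmin (Rabs (z (j k) - c k) / 2) (/ INR (S k)))) as m2.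
    pose proof (Rmin_l (Rabs (z (j k) - c k) / 2) (/ INR (S k))) as m3.
    pose proof (Rmin_r (Rabs (z (j k) - c k) / 2) (/ INR (S k))) as m4. fold d' in m1, m2.
    assert (hd' : 0 < d') by (repeat apply Rmin_glb_lt; lra).
    exists (z, d'). split; [split; [exact hz1|split; [exact hd'|]]|split; [|split]]; simpl.
    + intros i hi. specialize (Hd i hi). specialize (h3 i hi).
      replace (x1 i - z i) with ((x1 i - y i) + (y i - z i)) by ring.
      pose proof (Rabs_triang (x1 i - y i) (y i - z i)). lra.
    + intros i hi. specialize (Hd i hi). lra.
    + lra.
    + change (d' <= / INR (S k)). lra.
  - assert (Hlim : forall i, exists x, if lt_dec i n then forall k, Rabs (x - fst (s k) i) <= snd (s k) else x = 0).
    { intro i. destruct (lt_dec i n) as [hi|hi]; [|eauto].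
      apply (nested_intervals (fun k => fst (s k) i) (fun k => snd (s k))).
      - intro k. apply (proj1 (Hs k)).
      - intro k. apply (proj2 (Hs k)). assumption. }
    set (x := fun i => proj1_sig (constructive_indefinite_description _ (Hlim i))).
    assert (hx : forall i, if lt_dec i n then forall k, Rabs (x i - fst (s k) i) <= snd (s k) else x i = 0)
      by (intro i; exact (proj2_sig (constructive_indefinite_description _ (Hlim i)))).
    assert (hxs : supported n x).
    { intros i hi. specialize (hx i). destruct (lt_dec i n); [lia|assumption]. }
    assert (hxn : forall k i, (i < n)%nat -> Rabs (x i - fst (s k) i) <= snd (s k)).
    { intros k i hi. specialize (hx i). destruct (lt_dec i n); [auto|lia]. }
    exists x. split.
    + apply Dclosed; [assumption| |].
      * intros i hi. specialize (hxn 0%nat i hi). destruct (proj1 (Hs 0%nat)) as (_ & _ & h). specialize (h i hi).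
        rewrite Rabs_minus_sym. replace (x i - x1 i) with ((x i - fst (s 0%nat) i) + - (x1 i - fst (s 0%nat) i)) by ring.
        pose proof (Rabs_triang (x i - fst (s 0%nat) i) (- (x1 i - fst (s 0%nat) i))). rewrite Rabs_Ropp in *. lra.
      * intros t ht. apply NNPP. intro hne.
        (* A nonzero value of [t] at the limit would persist at a late centre, where [t]
           vanishes. *)
        destruct (@teval_continuous n t x (Rabs (teval x t))) as (d & hd & Hd); [now apply Rabs_pos_lt|].
        destruct (archimed_cor1 d hd) as (N & hN1 & hN2).
        destruct N as [|N]; [lia|].
        assert (hsN : snd (s (S N)) < d) by (destruct (proj2 (Hs N)) as (_ & _ & h); lra).
        destruct (Hs (S N)) as [hi _].
        specialize (Hd (fst (s (S N))) hxs (Dsupp _ (proj1 hi))).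
        rewrite (Dzero _ t (proj1 hi) (nearI _ hi) ht), Rminus_0_r in Hd.
        apply (Rlt_irrefl (Rabs (teval x t))), Hd.
        intros i hin. specialize (hxn (S N) i hin). lra.
    + intros k e. destruct (proj2 (Hs k)) as (_ & h & _). specialize (hxn (S k) (j k) (hj k)).
      rewrite e, Rabs_minus_sym in hxn. lra.
Qed.

(** * Special values *)

Definition in_box (n : nat) (l u y : nat -> R) := forall i, (i < n)%nat -> l i < y i < u i.

Definition special (n : nat) (f : form) (c : R) : Prop :=
  exists l u, (exists y, solution n f y /\ in_box n l u y) /\
    exists j, (j < n)%nat /\ forall z, solution n f z -> in_box n l u z -> z j = c.

Definition rational (k : nat) : R :=
  (INR (unpairl (unpairl k)) - INR (unpairr (unpairl k))) / INR (S (unpairr k)).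

Lemma rational_dense x y : x < y -> exists k, x < rational k < y.
Proof.
  intro h. destruct (archimed_cor1 (y - x)) as (N & h1 & h2); [lra|]. destruct N as [|N]; [lia|].
  assert (hN : 0 < INR (S N)) by (apply lt_0_INR; lia).
  assert (e1 : / INR (S N) * INR (S N) = 1) by (field; lra).
  destruct (archimed (x * INR (S N))) as [a1 a2]. set (m := up (x * INR (S N))) in *.
  exists (cpair (cpair (Z.to_nat m) (Z.to_nat (- m))) N). unfold rational.
  rewrite !unpairl_cpair, !unpairr_cpair.
  assert (em : INR (Z.to_nat m) - INR (Z.to_nat (- m)) = IZR m).
  { rewrite !INR_IZR_INZ, <- minus_IZR. f_equal. lia. }
  rewrite em. split.
  - apply (Rmult_lt_reg_r (INR (S N))); [assumption|]. unfold Rdiv. rewrite Rmult_assoc, e1. lra.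
  - apply (Rmult_lt_reg_r (INR (S N))); [assumption|]. unfold Rdiv. rewrite Rmult_assoc, e1.
    assert (1 < (y - x) * INR (S N)) by (rewrite <- e1; apply Rmult_lt_compat_r; lra). lra.
Qed.

Lemma finite_choice (P : nat -> nat -> Prop) n : (forall i, (i < n)%nat -> exists k, P i k) ->
  exists k, forall i, (i < n)%nat -> P i (params k i).
Proof.
  intro H.
  assert (H' : forall i, exists k, (i < n)%nat -> P i k).
  { intro i. destruct (lt_dec i n) as [h|h]; [destruct (H i h); eauto|exists 0%nat; tauto]. }
  destruct (params_exist (fun i => proj1_sig (constructive_indefinite_description _ (H' i))) n) as [k hk].
  exists k. intros i hi. rewrite hk by assumption.
  exact (proj2_sig (constructive_indefinite_description _ (H' i)) hi).
Qed.

Lemma special_countable n f : exists s : nat -> R, forall c, special n f c -> exists m, s m = c.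
Proof.
  set (P := fun m c =>
    let l i := rational (params (unpairl (unpairl m)) i) in let u i := rational (params (unpairr (unpairl m)) i) in
    (exists y, solution n f y /\ in_box n l u y) /\
    forall z, solution n f z -> in_box n l u z -> z (unpairr m) = c).
  exists (fun m => pick (P m)). intros c (l & u & (y & hy & hb) & j & hj & H).
  (* The corners move to rational positions between the old ones and [y]; the smaller box still
     contains [y] and so still determines the value. *)
  destruct (@finite_choice (fun i k => l i < rational k < y i) n) as [kl hl]; [intros; apply rational_dense; apply hb; assumption|].
  destruct (@finite_choice (fun i k => y i < rational k < u i) n) as [ku hu]; [intros; apply rational_dense; apply hb; assumption|].
  exists (cpair (cpair kl ku) j).
  assert (Hc : P (cpair (cpair kl ku) j) c).
  { unfold P. rewrite !unpairl_cpair, !unpairr_cpair. split.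
    - exists y. split; [assumption|]. intros i hi. specialize (hl i hi). specialize (hu i hi). lra.
    - intros z hz hbz. apply H; [assumption|]. intros i hi. specialize (hl i hi). specialize (hu i hi). specialize (hbz i hi). lra. }
  pose proof (pick_spec _ _ Hc) as Hp. revert Hp. generalize (pick (P (cpair (cpair kl ku) j))). intros c' [_ H1].
  destruct Hc as [(y0 & h1 & h2) H2]. now rewrite <- (H1 y0 h1 h2), <- (H2 y0 h1 h2).
Qed.

(** Baire category on the line, with the open interval as [D] and no equations. *)
Lemma interval_uncountable c d (s : nat -> R) : 0 < d -> exists x, Rabs (c - x) < d /\ forall m, x <> s m.
Proof.
  intro hd.
  destruct (@baire 1 (fun x => supported 1 x /\ Rabs (c - x 0%nat) < d) (upd (fun _ => 0) 0 c) d [] s (fun _ => 0%nat))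
    as (x & (_ & hx) & H).
  - now intros x [].
  - split.
    + intros i hi. rewrite upd_other by lia. reflexivity.
    + rewrite upd_same, Rminus_diag, Rabs_R0. assumption.
  - assumption.
  - intros y hy hn _. split; [assumption|]. specialize (hn 0%nat ltac:(lia)). now rewrite upd_same in hn.
  - now intros y t _ _ [].
  - intros; lia.
  - intros k y rho [hy1 hy2] _ hr. destruct (Req_EM_T (y 0%nat) (s k)) as [e|e].
    + set (eps := Rmin rho (d - Rabs (c - y 0%nat)) / 2).
      assert (he : 0 < Rmin rho (d - Rabs (c - y 0%nat))) by (apply Rmin_glb_lt; lra).
      pose proof (Rmin_l rho (d - Rabs (c - y 0%nat))) as m1. pose proof (Rmin_r rho (d - Rabs (c - y 0%nat))) as m2.
      exists (upd y 0 (y 0%nat + eps)). split; [split|split].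
      * intros i hi. rewrite upd_other by lia. auto.
      * rewrite upd_same. replace (c - (y 0%nat + eps)) with ((c - y 0%nat) + - eps) by ring.
        eapply Rle_lt_trans; [apply Rabs_triang|]. rewrite Rabs_Ropp, (Rabs_pos_eq eps); unfold eps; lra.
      * intros i hi. replace i with 0%nat by lia. rewrite upd_same.
        replace (y 0%nat - (y 0%nat + eps)) with (- eps) by ring. rewrite Rabs_Ropp, Rabs_pos_eq; unfold eps; lra.
      * rewrite upd_same. unfold eps. lra.
    + exists y. repeat split; auto. now apply near_refl.
  - eauto.
Qed.

(** Away from the roots of the finitely many nonzero polynomials governing [h], all signs are
    locally constant. A point of [P] that is not such a root would have a whole interval in [P],
    against countability. *)
Lemma definable_countable_finite (P : R -> Prop) (h : form) (v : nat) (s : nat -> R) :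
  (forall c, P c <-> holds (upd (fun _ => 0) v c) h) -> (forall c, P c -> exists m, s m = c) ->
  exists l, forall c, P c -> In c l.
Proof.
  intros Hh Hs. destruct (RealClosed.holds_signs h) as [Q hQ]. set (e := fun c => upd (fun _ : nat => 0) v c).
  assert (HL : exists l, forall t c, In t Q -> teval (e c) t = 0 -> In c l \/ forall c', teval (e c') t = 0).
  { clear. induction Q as [|t Q [l IH]]; [exists []; intros t c []|].
    destruct (RealClosed.teval_roots t (fun _ => 0) v) as [h|[l' h]].
    - exists l. intros t' c [<-|ht] H; [right; exact h|auto].
    - exists (l' ++ l). intros t' c [<-|ht] H.
      + left. apply in_or_app. left. auto.
      + destruct (IH t' c ht H); [left; apply in_or_app|]; auto. }
  destruct HL as [l hl]. exists l. intros c hc. apply NNPP. intro hn.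
  assert (es : forall c, supported (S v) (e c)) by (intros c' i hi; unfold e; now rewrite upd_other by lia).
  destruct (teval_sign_open Q (es c)) as (d & hd & Hd).
  destruct (interval_uncountable c s hd) as (x & hx & Hx).
  destruct (Hs x) as [m hm]; [|exact (Hx m (eq_sym hm))].
  apply Hh. apply (hQ (e c)); [|now apply Hh].
  assert (hnear : near (S v) d (e c) (e x)).
  { intros i hi. unfold e, upd. destruct (Nat.eqb i v); [assumption|]. rewrite Rminus_diag, Rabs_R0. assumption. }
  intros t ht. destruct (Hd t (e x) ht (es x) hnear) as [H1 H2]. pose proof (hl t c ht) as H3. fold (e x). unfold same_sign.
  destruct (Rtotal_order (teval (e c) t) 0) as [h0|[h0|h0]].
  - specialize (H2 h0). lra.
  - destruct (H3 h0) as [H4|H4]; [contradiction|]. rewrite !H4. tauto.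
  - specialize (H1 h0). lra.
Qed.

Lemma list_gap (l : list R) v : exists d, 0 < d /\ forall a, In a l -> Rabs (v - a) < d -> a = v.
Proof.
  induction l as [|b l (d & hd & IH)]; [exists 1; split; [lra|intros a []]|].
  destruct (Req_EM_T b v) as [->|e].
  - exists d. split; [assumption|]. intros a [<-|h]; auto.
  - exists (Rmin d (Rabs (v - b))). split; [apply Rmin_glb_lt; [assumption|apply Rabs_pos_lt; lra]|].
    intros a [<-|h] ha.
    + pose proof (Rmin_r d (Rabs (v - b))). lra.
    + apply IH; [assumption|]. pose proof (Rmin_l d (Rabs (v - b))). lra.
Qed.

(** Close to [y] a coordinate can take a value from the list only if [y] already has it there. This
    makes the reduced solution set open in the full one. *)
Lemma point_gap (l : list R) n (y : nat -> R) : exists d, 0 < d /\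
  forall i a, (i < n)%nat -> In a l -> Rabs (y i - a) < d -> a = y i.
Proof.
  induction n as [|n (d & hd & IH)]; [exists 1; split; [lra|intros; lia]|].
  destruct (list_gap l (y n)) as (d' & hd' & H). exists (Rmin d d'). split; [now apply Rmin_glb_lt|].
  intros i a hi ha hlt. pose proof (Rmin_l d d'). pose proof (Rmin_r d d').
  destruct (Nat.eq_dec i n) as [->|e]; [apply H|apply IH]; auto; lra || lia.
Qed.

Theorem solution_avoiding n f f' (F : R -> Prop) (nu : nat -> R) (l : list R) :
  (forall x, F x <-> exists i, nu i = x) -> (forall c, special n f c -> In c l) ->
  (forall x, supported n x -> (holds x f' <-> holds x f /\ forall j, (j < n)%nat -> ~ (special n f (x j) /\ F (x j)))) ->
  (exists x, solution n f x /\ forall j, (j < n)%nat -> ~ F (x j)) <-> (exists x, solution n f' x).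
Proof.
  intros HF Hl Hf'. split.
  - intros (x & [h1 h2] & h3). exists x. split; [assumption|]. apply Hf'; [assumption|]. split; [assumption|].
    intros j hj [_ h]. exact (h3 j hj h).
  - intros (x0 & h0).
    assert (sub : forall x, solution n f' x -> solution n f x /\ forall j, (j < n)%nat -> ~ (special n f (x j) /\ F (x j))).
    { intros x [h1 h2]. apply Hf' in h2; [|assumption]. split; [split|]; tauto. }
    (* In dimension zero there is no coordinate to avoid, and reduction modulo [n] would yield no
       index. *)
    destruct n as [|n'].
    { exists x0. split; [now apply sub|]. intros; lia. }
    set (n := S n') in *.
    destruct (solution_locally_closed h0) as (x1 & r & Z & h1 & hr & HZ).
    (* The index [k] runs through all pairs of a coordinate and an element of [F]; the remainder
       modulo [n] turns any number into a coordinate. *)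
    destruct (@baire n (solution n f') x1 r Z (fun k => nu (unpairr k)) (fun k => unpairl k mod n)) as (x & hx & Hx); auto.
    + now intros x [].
    + intros y hy hn. now apply HZ.
    + intros y t hy hn. apply HZ; auto. apply hy.
    + intro k. apply Nat.mod_upper_bound. unfold n. lia.
    + intros k y rho hy _ hrho. set (j := unpairl k mod n). set (c := nu (unpairr k)). apply NNPP. intro hno.
      assert (hconst : forall z, solution n f' z -> near n rho y z -> z j = c).
      { intros z hz hn. apply NNPP. intro. apply hno. eauto. }
      assert (hj : (j < n)%nat) by (apply Nat.mod_upper_bound; unfold n; lia).
      assert (hyc : y j = c) by (apply hconst; [assumption|now apply near_refl]).
      destruct (sub y hy) as [hyf hyG]. apply (hyG j hj). rewrite hyc. split; [|apply HF; unfold c; eauto].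
      destruct (point_gap l n y) as (d & hd & Hd).
      (* On this box about [y] no solution of [f] is discarded, since [y] is not. So the coordinate
         is constant on all solutions of [f] in the box, which makes [c] special. *)
      set (d' := Rmin d rho). assert (hd' : 0 < d') by now apply Rmin_glb_lt.
      exists (fun i => y i - d'), (fun i => y i + d'). split.
      * exists y. split; [assumption|]. intros i _. lra.
      * exists j. split; [assumption|]. intros z hz hb.
        assert (hn : near n d' y z).
        { intros i hi. specialize (hb i hi). simpl in hb. apply Rabs_def1; lra. }
        apply hconst; [|now apply (near_mono (Rmin_r d rho))].
        split; [apply hz|]. apply Hf'; [apply hz|]. split; [apply hz|].
        intros i hi [hs hF]. apply (hyG i hi). rewrite <- (Hd i (z i) hi (Hl _ hs)); [tauto|].
        exact (near_mono (Rmin_l d rho) hn hi).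
    + exists x. split; [now apply sub|]. intros j hj hF. apply HF in hF as [i hi].
      apply (Hx (cpair j i)). rewrite unpairl_cpair, unpairr_cpair, Nat.mod_small by assumption. now rewrite hi.
Qed.

(** * Special values in the formal language *)

(** Pairing dominates both components, so a code bounds the indices of the variables in the formula.
    A fresh variable is thus computable from the code alone. *)
Lemma holds_code_local f e e' : (forall i, (i <= code_form f)%nat -> e i = e' i) -> holds e f <-> holds e' f.
Proof.
  assert (Ht : forall t e e', (forall i, (i <= code_term t)%nat -> e i = e' i) -> teval e t = teval e' t).
  { clear. induction t as [j| | |a IHa b IHb|a IHa b IHb|a IHa]; intros e e' H; simpl in *; auto.
    - apply H, le_cpair_r.
    - pose proof (le_cpair_r 3 (cpair (code_term a) (code_term b))).
      pose proof (le_cpair_l (code_term a) (code_term b)). pose proof (le_cpair_r (code_term a) (code_term b)).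
      f_equal; [apply IHa|apply IHb]; intros; apply H; lia.
    - pose proof (le_cpair_r 4 (cpair (code_term a) (code_term b))).
      pose proof (le_cpair_l (code_term a) (code_term b)). pose proof (le_cpair_r (code_term a) (code_term b)).
      f_equal; [apply IHa|apply IHb]; intros; apply H; lia.
    - pose proof (le_cpair_r 5 (code_term a)). f_equal. apply IHa. intros; apply H; lia. }
  revert e e'; induction f as [a b|a b|g IH|g IHg h IHh|g IHg h IHh|j g IH|j g IH]; intros e e' H; simpl in *.
  1,2: match type of H with context [cpair ?k (cpair ?a ?b)] =>
      pose proof (le_cpair_r k (cpair a b)); pose proof (le_cpair_l a b); pose proof (le_cpair_r a b) end;
    rewrite (Ht a e e'), (Ht b e e') by (intros; apply H; lia); reflexivity.
  - pose proof (le_cpair_r 2 (code_form g)). rewrite (IH e e') by (intros; apply H; lia). reflexivity.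
  - pose proof (le_cpair_r 3 (cpair (code_form g) (code_form h))).
    pose proof (le_cpair_l (code_form g) (code_form h)). pose proof (le_cpair_r (code_form g) (code_form h)).
    rewrite (IHg e e'), (IHh e e') by (intros; apply H; lia). reflexivity.
  - pose proof (le_cpair_r 4 (cpair (code_form g) (code_form h))).
    pose proof (le_cpair_l (code_form g) (code_form h)). pose proof (le_cpair_r (code_form g) (code_form h)).
    rewrite (IHg e e'), (IHh e e') by (intros; apply H; lia). reflexivity.
  - pose proof (le_cpair_r 5 (cpair j (code_form g))). pose proof (le_cpair_r j (code_form g)).
    assert (E : forall x, holds (upd e j x) g <-> holds (upd e' j x) g).
    { intro x. apply IH. intros i hi. unfold upd. destruct (Nat.eqb i j); [reflexivity|apply H; lia]. }
    split; intros [x hx]; exists x; now apply E.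
  - pose proof (le_cpair_r 6 (cpair j (code_form g))). pose proof (le_cpair_r j (code_form g)).
    assert (E : forall x, holds (upd e j x) g <-> holds (upd e' j x) g).
    { intro x. apply IH. intros i hi. unfold upd. destruct (Nat.eqb i j); [reflexivity|apply H; lia]. }
    split; intros hx x; apply E, hx.
Qed.

Definition block (a k : nat) (y e : nat -> R) : nat -> R :=
  fun i => if ((a <=? i)%nat && (i <? a + k)%nat)%bool then y i else e i.

Lemma block_in a k y e i : (a <= i < a + k)%nat -> block a k y e i = y i.
Proof. intro H. unfold block. destruct (Nat.leb_spec a i); [|lia]. destruct (Nat.ltb_spec i (a + k)); [reflexivity|lia]. Qed.
Lemma block_out a k y e i : ~ (a <= i < a + k)%nat -> block a k y e i = e i.
Proof. intro H. unfold block. destruct (Nat.leb_spec a i), (Nat.ltb_spec i (a + k)); simpl; reflexivity || lia. Qed.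

Fixpoint ex_block (a k : nat) (g : form) : form :=
  match k with 0%nat => g | S k => FEx (a + k)%nat (ex_block a k g) end.

Lemma holds_ex_block a k g e : holds e (ex_block a k g) <-> exists y, holds (block a k y e) g.
Proof.
  revert e; induction k as [|k IH]; intro e; simpl.
  - assert (E : forall y, block a 0 y e = e).
    { intro y. apply functional_extensionality. intro i. apply block_out. lia. }
    split; [intro h; exists e; now rewrite E|intros [y h]; now rewrite E in h].
  - split.
    + intros [x h]. apply IH in h as [y h]. exists (upd y (a + k)%nat x).
      replace (block a (S k) (upd y (a + k)%nat x) e) with (block a k y (upd e (a + k)%nat x)); [assumption|].
      apply functional_extensionality. intro i. destruct (lt_dec i a); [rewrite !block_out, upd_other by lia; reflexivity|].
      destruct (lt_dec i (a + k)); [rewrite !block_in, upd_other by lia; reflexivity|].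
      destruct (Nat.eq_dec i (a + k)) as [->|]; [rewrite block_out, block_in, !upd_same by lia; reflexivity|].
      rewrite !block_out, upd_other by lia. reflexivity.
    + intros [y h]. exists (y (a + k)%nat). apply IH. exists y.
      replace (block a k y (upd e (a + k)%nat (y (a + k)%nat))) with (block a (S k) y e); [assumption|].
      apply functional_extensionality. intro i. destruct (lt_dec i a); [rewrite !block_out, upd_other by lia; reflexivity|].
      destruct (lt_dec i (a + k)); [rewrite !block_in by lia; reflexivity|].
      destruct (Nat.eq_dec i (a + k)) as [->|]; [rewrite block_in, block_out, upd_same by lia; reflexivity|].
      rewrite !block_out, upd_other by lia. reflexivity.
Qed.

Definition FTrue : form := FEq TZero TZero.
Definition FFalse : form := FLt TZero TZero.
Definition FEqv (i j : nat) : form := FEq (TVar i) (TVar j).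
Definition FLtv (i j : nat) : form := FLt (TVar i) (TVar j).

Section Builders.
Variables (n : nat) (phi : form).

(* The variable [fresh] and all later ones do not occur in [phi]. The variable [fresh] carries the value under
   consideration, the next one is auxiliary, and the pairs after it are the endpoints of the sides of a box. *)
Definition fresh : nat := (code_form phi + n + 1)%nat.
Definition lower (i : nat) : nat := (fresh + 2 + 2 * i)%nat.
Definition upper (i : nat) : nat := (fresh + 3 + 2 * i)%nat.

Fixpoint box_form (k : nat) : form :=
  match k with
  | 0%nat => FTrue
  | S k => FAnd (box_form k) (FAnd (FLtv (lower k) k) (FLtv k (upper k)))
  end.

Definition body_form : form := FAnd phi (box_form n).
Definition const_form (j : nat) : form := FNot (ex_block 0 n (FAnd body_form (FNot (FEqv j fresh)))).
Fixpoint some_const_form (k : nat) : form :=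
  match k with 0%nat => FFalse | S k => FOr (some_const_form k) (const_form k) end.
Definition special_form : form :=
  ex_block (fresh + 2)%nat (n + n)%nat (FAnd (ex_block 0 n body_form) (some_const_form n)).

(* At least [k] special values lie below the value of [fresh]. *)
Fixpoint rank_form (k : nat) : form :=
  match k with
  | 0%nat => FTrue
  | S k => FEx (fresh + 1)%nat (FAnd (FLtv (fresh + 1)%nat fresh)
             (FEx fresh (FAnd (FEqv fresh (fresh + 1)%nat) (FAnd special_form (rank_form k)))))
  end.
Definition nth_form (k : nat) : form := FAnd special_form (FAnd (rank_form k) (FNot (rank_form (S k)))).
(** The oracle expects the value in variable 0, whereas [nth_form] reads it from [fresh]. *)
Definition nth_query (k : nat) : form := FEx fresh (FAnd (FEqv fresh 0) (nth_form k)).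
Definition nth_exists (k : nat) : form := FEx fresh (nth_form k).

Fixpoint selected_form (sel : nat -> nat) (k : nat) : form :=
  match k with
  | 0%nat => FFalse
  | S k => if Nat.eqb (sel k) 1 then FOr (selected_form sel k) (nth_form k) else selected_form sel k
  end.

Fixpoint avoid_form (g : form) (k : nat) : form :=
  match k with 0%nat => FTrue | S k => FAnd (avoid_form g k) (FNot (FEx fresh (FAnd (FEqv fresh k) g))) end.
Definition reduced_form (g : form) : form := FAnd phi (avoid_form g n).
Definition final_form (g : form) : form := ex_block 0 n (reduced_form g).

(** [phi] may mention variables from [n] on, which the theorem reads as 0. This condition keeps them
    so and leaves the variables from [fresh] on free. *)
Definition vanishing (e : nat -> R) := forall i, (n <= i < fresh)%nat -> e i = 0.
Definition cut (e : nat -> R) : nat -> R := fun i => if (i <? n)%nat then e i else 0.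

Lemma cut_supported e : supported n (cut e).
Proof. intros i hi. unfold cut. destruct (Nat.ltb_spec i n); [lia|reflexivity]. Qed.
Lemma cut_below e i : (i < n)%nat -> cut e i = e i.
Proof. intro hi. unfold cut. destruct (Nat.ltb_spec i n); [reflexivity|lia]. Qed.

Lemma holds_phi_cut e : vanishing e -> holds e phi <-> solution n phi (cut e).
Proof.
  intro H. unfold solution. rewrite (holds_code_local phi e (cut e)).
  - split; [split; [apply cut_supported|assumption]|tauto].
  - intros i hi. unfold cut. destruct (Nat.ltb_spec i n); [reflexivity|]. apply H. unfold fresh. lia.
Qed.

Lemma holds_box e k : holds e (box_form k) <-> forall i, (i < k)%nat -> e (lower i) < e i < e (upper i).
Proof.
  induction k as [|k IH]; simpl; [split; [intros; lia|reflexivity]|]. rewrite IH. split.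
  - intros [h1 h2] i hi. destruct (Nat.eq_dec i k) as [->|]; [tauto|apply h1; lia].
  - intro h. split; [intros; apply h; lia|]. apply h. lia.
Qed.

Lemma block_vanishing e y : vanishing e -> vanishing (block 0 n y e).
Proof. intros H i hi. rewrite block_out by lia. auto. Qed.

Lemma holds_body e y : vanishing e ->
  holds (block 0 n y e) body_form <->
  solution n phi (cut y) /\ in_box n (fun i => e (lower i)) (fun i => e (upper i)) (cut y).
Proof.
  intro H. unfold body_form. simpl. rewrite holds_phi_cut, holds_box by now apply block_vanishing.
  replace (cut (block 0 n y e)) with (cut y).
  - apply and_iff_compat_l.
    assert (E : forall i, (i < n)%nat -> block 0 n y e (lower i) = e (lower i) /\ block 0 n y e (upper i) = e (upper i)
      /\ block 0 n y e i = cut y i).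
    { intros i hi. rewrite cut_below by assumption.
      repeat split; [apply block_out|apply block_out|apply block_in]; unfold lower, upper, fresh; lia. }
    split; intros h i hi; specialize (h i hi); destruct (E i hi) as (E1 & E2 & E3);
      rewrite E1, E2, E3 in *; assumption.
  - apply functional_extensionality. intro i. unfold cut. destruct (Nat.ltb_spec i n); [|reflexivity].
    now rewrite block_in by lia.
Qed.

Lemma cut_of_supported y : supported n y -> cut y = y.
Proof.
  intro H. apply functional_extensionality. intro i. unfold cut.
  destruct (Nat.ltb_spec i n); [reflexivity|]. symmetry. auto.
Qed.

Lemma holds_const e j : vanishing e -> (j < n)%nat ->
  holds e (const_form j) <->
  forall z, solution n phi z -> in_box n (fun i => e (lower i)) (fun i => e (upper i)) z -> z j = e fresh.
Proof.
  intros H hj. unfold const_form. simpl. rewrite holds_ex_block. simpl.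
  assert (hf : forall y, block 0 n y e fresh = e fresh) by (intro y; apply block_out; unfold fresh; lia).
  split.
  - intros h z hz hb. apply NNPP. intro hne. apply h. exists z.
    rewrite (holds_body z H), hf, block_in, cut_of_supported by (apply hz || lia). tauto.
  - intros h [y hy]. rewrite (holds_body y H), hf, block_in in hy by lia. destruct hy as [[h1 h2] h3].
    apply h3. rewrite <- (h _ h1 h2). now rewrite cut_below.
Qed.

Lemma holds_some_const e k : vanishing e -> (k <= n)%nat ->
  holds e (some_const_form k) <-> exists j, (j < k)%nat /\
  forall z, solution n phi z -> in_box n (fun i => e (lower i)) (fun i => e (upper i)) z -> z j = e fresh.
Proof.
  intros H. induction k as [|k IH]; intro hk; cbn [some_const_form holds FFalse teval].
  - split; [intro; lra|intros (j & hj & _); lia].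
  - rewrite IH, holds_const by (assumption || lia). split.
    + intros [(j & hj & h)|h]; [exists j|exists k]; split; auto; lia.
    + intros (j & hj & h). destruct (Nat.eq_dec j k) as [->|]; [now right|left; exists j; split; [lia|assumption]].
Qed.

Lemma holds_special e : vanishing e -> holds e special_form <-> special n phi (e fresh).
Proof.
  intro H. unfold special_form, special. rewrite holds_ex_block. cbn [holds].
  assert (hv : forall w, vanishing (block (fresh + 2)%nat (n + n)%nat w e)).
  { intros w i hi. rewrite block_out by lia. auto. }
  assert (hf : forall w, block (fresh + 2)%nat (n + n)%nat w e fresh = e fresh) by (intro w; apply block_out; lia).
  assert (Hbox : forall w y, in_box n (fun i => block (fresh + 2)%nat (n + n)%nat w e (lower i)) (fun i => block (fresh + 2)%nat (n + n)%nat w e (upper i)) y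
     <-> in_box n (fun i => w (lower i)) (fun i => w (upper i)) y).
  { intros w y. unfold in_box, lower, upper. split; intros h i hi; specialize (h i hi); rewrite !block_in in * by lia; assumption. }
  split.
  - intros [w [h1 h2]]. apply holds_ex_block in h1 as [y hy]. rewrite (holds_body y (hv w)) in hy.
    rewrite (holds_some_const (hv w) (le_n n)), hf in h2.
    exists (fun i => w (lower i)), (fun i => w (upper i)). split.
    + exists (cut y). rewrite Hbox in hy. exact hy.
    + destruct h2 as (j & hj & h2). exists j. split; [assumption|]. intros z hz hb. apply h2; [assumption|]. now apply Hbox.
  - intros (l & u & (y & hy1 & hy2) & j & hj & h).
    (* Lower corners sit at even offsets from [fresh + 2], upper corners at odd ones. *)
    set (w := fun i => if Nat.even (i - (fresh + 2)%nat) then l (Nat.div2 (i - (fresh + 2)%nat)) else u (Nat.div2 (i - (fresh + 2)%nat))).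
    assert (hl : forall i, w (lower i) = l i).
    { intro i. unfold w, lower. replace (fresh + 2 + 2 * i - (fresh + 2)%nat)%nat with (2 * i)%nat by lia.
      rewrite Nat.even_even, Nat.div2_double. reflexivity. }
    assert (hu : forall i, w (upper i) = u i).
    { intro i. unfold w, upper. replace (fresh + 3 + 2 * i - (fresh + 2)%nat)%nat with (S (2 * i)) by lia.
      replace (S (2 * i)) with (2 * i + 1)%nat at 1 by lia. rewrite Nat.even_odd, Nat.div2_succ_double. reflexivity. }
    assert (Hbox' : forall z, in_box n (fun i => w (lower i)) (fun i => w (upper i)) z <-> in_box n l u z).
    { intro z. unfold in_box. split; intros k i hi; specialize (k i hi); rewrite hl, hu in *; assumption. }
    exists w. split.
    + apply holds_ex_block. exists y. rewrite (holds_body y (hv w)), cut_of_supported, Hbox, Hbox' by apply hy1. tauto.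
    + apply (holds_some_const (hv w) (le_n n)). exists j. split; [assumption|].
      intros z hz hb. rewrite hf. apply h; [assumption|]. now apply Hbox', Hbox.
Qed.

(** * Numbering the special values in increasing order *)

Fixpoint ranked (k : nat) (c : R) : Prop :=
  match k with 0%nat => True | S k => exists w, w < c /\ special n phi w /\ ranked k w end.

Lemma upd_vanishing e i x : vanishing e -> (fresh <= i)%nat -> vanishing (upd e i x).
Proof. intros H hi j hj. rewrite upd_other by lia. auto. Qed.

Lemma holds_rank k e : vanishing e -> holds e (rank_form k) <-> ranked k (e fresh).
Proof.
  revert e; induction k as [|k IH]; intros e H; [simpl; tauto|]. cbn [rank_form ranked holds FLtv FEqv teval].
  split.
  - intros (w & h1 & x & h2 & h3 & h4). rewrite upd_same, upd_other in h1 by lia.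
    rewrite upd_same, upd_other, upd_same in h2 by lia. subst x.
    assert (hv : vanishing (upd (upd e (fresh + 1)%nat w) fresh w)) by (repeat apply upd_vanishing; auto; lia).
    exists w. split; [assumption|].
    rewrite holds_special, upd_same in h3 by assumption. rewrite IH, upd_same in h4 by assumption. tauto.
  - intros (w & h1 & h2 & h3). exists w. rewrite upd_same, upd_other by lia. split; [assumption|].
    exists w. rewrite upd_same, upd_other, upd_same by lia. split; [reflexivity|].
    assert (hv : vanishing (upd (upd e (fresh + 1)%nat w) fresh w)) by (repeat apply upd_vanishing; auto; lia).
    rewrite holds_special, IH, upd_same by assumption. tauto.
Qed.

Definition nth_special (k : nat) (c : R) : Prop := special n phi c /\ ranked k c /\ ~ ranked (S k) c.

Lemma holds_nth k e : vanishing e -> holds e (nth_form k) <-> nth_special k (e fresh).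
Proof.
  intro H. unfold nth_form, nth_special. cbn [holds]. rewrite holds_special, !holds_rank by assumption. tauto.
Qed.

(** If the values differed, the smaller would witness rank [S k] for the larger. *)
Lemma nth_special_unique k c c' : nth_special k c -> nth_special k c' -> c = c'.
Proof.
  intros (h1 & h2 & h3) (h1' & h2' & h3'). destruct (Rtotal_order c c') as [h|[h|h]]; [|assumption|].
  - exfalso. apply h3'. exists c. auto.
  - exfalso. apply h3. exists c'. auto.
Qed.

Lemma ranked_chain k c : ranked k c -> exists l, length l = k /\ NoDup l /\ forall w, In w l -> special n phi w /\ w < c.
Proof.
  revert c; induction k as [|k IH]; intro c.
  - intros _. exists []. repeat split; [constructor|contradiction|contradiction].
  - intros (w & h1 & h2 & h3). destruct (IH w h3) as (l & hl & hd & H). exists (w :: l). simpl. split; [lia|split].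
    + constructor; [|assumption]. intro hw. destruct (H w hw). lra.
    + intros w' [<-|hw]; [auto|]. destruct (H w' hw). split; [assumption|lra].
Qed.

Lemma list_least (P : R -> Prop) (l : list R) c : In c l -> P c ->
  exists m, In m l /\ P m /\ forall d, In d l -> P d -> m <= d.
Proof.
  revert c; induction l as [|a l IH]; intros c [].
  - subst a. intro hc. destruct (classic (exists d, In d l /\ P d)) as [(d & h1 & h2)|hn].
    + destruct (IH d h1 h2) as (m & m1 & m2 & m3). destruct (Rle_dec c m).
      * exists c. split; [now left|split; [assumption|]]. intros d' [<-|h] hd; [lra|]. specialize (m3 d' h hd). lra.
      * exists m. split; [now right|split; [assumption|]]. intros d' [<-|h] hd; [lra|auto].
    + exists c. split; [now left|split; [assumption|]]. intros d [<-|h] hd; [lra|]. exfalso. eauto.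
  - intro hc. destruct (IH c H hc) as (m & m1 & m2 & m3).
    destruct (classic (P a /\ a < m)) as [[h1 h2]|hn].
    + exists a. split; [now left|split; [assumption|]]. intros d [<-|h] hd; [lra|]. specialize (m3 d h hd). lra.
    + exists m. split; [now right|split; [assumption|]]. intros d [<-|h] hd; [|auto].
      destruct (Rle_dec m a); [assumption|]. exfalso. apply hn. split; [assumption|lra].
Qed.

Lemma special_finite : exists l, forall c, special n phi c -> In c l.
Proof.
  destruct (special_countable n phi) as [s hs].
  apply (@definable_countable_finite _ special_form fresh s); [|exact hs].
  intro c. rewrite holds_special, upd_same; [tauto|].
  intros i hi. rewrite upd_other by lia. reflexivity.
Qed.

Lemma nth_special_none : exists k, forall c, ~ nth_special k c.
Proof.
  destruct special_finite as [l hl]. exists (S (length l)). intros c (_ & h & _).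
  destruct (ranked_chain _ _ h) as (l' & h1 & h2 & h3).
  assert (hle : (length l' <= length l)%nat); [|lia].
  apply NoDup_incl_length; [assumption|]. intros w hw. apply hl. now apply h3.
Qed.

(** The least special value with at least [m] special values below it would have index exactly [m].
    So the first vacant index is the number of special values. *)
Lemma special_nth m c : (forall d, ~ nth_special m d) -> special n phi c -> exists k, (k < m)%nat /\ nth_special k c.
Proof.
  intros hm hc. destruct special_finite as [l hl].
  assert (hr : ~ ranked m c).
  { intro h. destruct (list_least (fun d => special n phi d /\ ranked m d) l c) as (d & h1 & [h2 h3] & h4); auto.
    apply (hm d). split; [assumption|split; [assumption|]]. intros (w & w1 & w2 & w3).
    specialize (h4 w (hl w w2) (conj w2 w3)). lra. }
  clear hm. induction m as [|m IH]; [destruct (hr I)|].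
  destruct (classic (ranked m c)) as [h|h].
  - exists m. split; [lia|]. now repeat split.
  - destruct (IH h) as (k & h1 & h2). exists k. split; [lia|assumption].
Qed.

Lemma holds_selected sel k e : vanishing e ->
  holds e (selected_form sel k) <-> exists i, (i < k)%nat /\ sel i = 1%nat /\ nth_special i (e fresh).
Proof.
  intro H. induction k as [|k IH]; simpl.
  - split; [intro; lra|intros (i & hi & _); lia].
  - destruct (Nat.eqb_spec (sel k) 1) as [e1|e1].
    + cbn [holds]. rewrite IH, holds_nth by assumption. split.
      * intros [(i & h1 & h2 & h3)|h]; [exists i|exists k]; repeat split; auto; try lia; apply h || apply h3.
      * intros (i & h1 & h2 & h3). destruct (Nat.eq_dec i k) as [->|]; [now right|].
        left. exists i. split; [lia|auto].
    + rewrite IH. split; intros (i & h1 & h2 & h3); exists i; (split; [|auto]); [lia|].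
      destruct (Nat.eq_dec i k) as [->|]; [contradiction|lia].
Qed.

Lemma holds_avoid g (G : R -> Prop) k e : vanishing e -> (k <= n)%nat ->
  (forall e, vanishing e -> holds e g <-> G (e fresh)) ->
  holds e (avoid_form g k) <-> forall j, (j < k)%nat -> ~ G (e j).
Proof.
  intros H hk Hg. induction k as [|k IH]; cbn [avoid_form holds FEqv FTrue teval].
  - split; [intros; lia|reflexivity].
  - rewrite IH by lia.
    assert (E : (exists x, upd e fresh x fresh = upd e fresh x k /\ holds (upd e fresh x) g) <-> G (e k)).
    { assert (hx : forall x, holds (upd e fresh x) g <-> G x).
      { intro x. rewrite Hg, upd_same; [tauto|]. now apply upd_vanishing. }
      assert (he : forall x, upd e fresh x k = e k) by (intro x; apply upd_other; unfold fresh; lia).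
      split.
      - intros (x & h1 & h2). rewrite upd_same, he in h1. subst x. now apply hx.
      - intro h. exists (e k). rewrite upd_same, he, hx. tauto. }
    rewrite E. split.
    + intros [h1 h2] j hj. destruct (Nat.eq_dec j k) as [->|]; [assumption|apply h1; lia].
    + intro h. split; [intros; apply h; lia|apply h; lia].
Qed.

Lemma vanishing_of_supported x : supported n x -> vanishing x.
Proof. intros H i hi. apply H. lia. Qed.

Lemma holds_reduced g (G : R -> Prop) x : supported n x ->
  (forall e, vanishing e -> holds e g <-> G (e fresh)) ->
  holds x (reduced_form g) <-> holds x phi /\ forall j, (j < n)%nat -> ~ G (x j).
Proof.
  intros hx Hg. unfold reduced_form. cbn [holds].
  rewrite (@holds_avoid g G n x); auto; [tauto|]. now apply vanishing_of_supported.
Qed.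

Lemma holds_final g : holds (fun _ => 0) (final_form g) <-> exists x, solution n (reduced_form g) x.
Proof.
  unfold final_form, solution. rewrite holds_ex_block.
  assert (E : forall y, block 0 n y (fun _ => 0) = cut y).
  { intro y. apply functional_extensionality. intro i. unfold cut.
    destruct (Nat.ltb_spec i n); [apply block_in|apply block_out]; lia. }
  split.
  - intros [y h]. rewrite E in h. exists (cut y). split; [apply cut_supported|assumption].
  - intros (x & h1 & h2). exists x. now rewrite E, cut_of_supported.
Qed.

Lemma holds_nth_exists k : holds (fun _ => 0) (nth_exists k) <-> exists c, nth_special k c.
Proof.
  unfold nth_exists. cbn [holds].
  assert (E : forall x, holds (upd (fun _ => 0) fresh x) (nth_form k) <-> nth_special k x).
  { intro x. rewrite holds_nth, upd_same; [tauto|]. apply upd_vanishing; [intros i _; reflexivity|lia]. }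
  split; intros [x h]; exists x; now apply E.
Qed.

(** Variable 0 is among the first [n], so the value put there by [env1] does not conflict with
    [vanishing]. In dimension zero there are no special values. *)
Lemma holds_nth_query k x : (0 < n)%nat -> holds (env1 x) (nth_query k) <-> nth_special k x.
Proof.
  intro hn. unfold nth_query. cbn [holds FEqv teval].
  assert (hv : vanishing (env1 x)).
  { intros i hi. unfold env1. destruct (Nat.eqb_spec i 0); [lia|reflexivity]. }
  assert (E : forall y, holds (upd (env1 x) fresh y) (nth_form k) <-> nth_special k y).
  { intro y. rewrite holds_nth, upd_same; [tauto|]. now apply upd_vanishing. }
  assert (E0 : forall y, upd (env1 x) fresh y 0%nat = x) by (intro y; rewrite upd_other by (unfold fresh; lia); reflexivity).
  split.
  - intros (y & h1 & h2). rewrite upd_same, E0 in h1. subst y. now apply E.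
  - intro h. exists x. rewrite upd_same, E0, E. tauto.
Qed.

Lemma special_dim_pos c : special n phi c -> (0 < n)%nat.
Proof. intros (l & u & _ & j & hj & _). lia. Qed.

(** The answers [sel] enter only at indices below [m]; by [special_nth] these cover all special
    values, so the selected ones are exactly the special values in [F]. *)
Theorem final_form_correct (F : R -> Prop) (nu : nat -> R) (m : nat) (sel : nat -> nat) :
  (forall x, F x <-> exists i, nu i = x) ->
  (forall d, ~ nth_special m d) ->
  (forall k c, (k < m)%nat -> nth_special k c -> (sel k = 1%nat <-> F c)) ->
  holds (fun _ => 0) (final_form (selected_form sel m)) <->
  exists xs, length xs = n /\ Forall (fun x => ~ F x) xs /\ holds (fun i => nth i xs 0) phi.
Proof.
  intros HF hm Hsel. destruct special_finite as [l hl].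
  set (G := fun c => special n phi c /\ F c).
  assert (HG : forall e, vanishing e -> holds e (selected_form sel m) <-> G (e fresh)).
  { intros e he. rewrite holds_selected by assumption. unfold G. split.
    - intros (i & h1 & h2 & h3). split; [apply h3|]. now apply (Hsel i).
    - intros [h1 h2]. destruct (special_nth hm h1) as (k & k1 & k2). exists k. split; [assumption|split; [|assumption]].
      now apply (Hsel k (e fresh)). }
  rewrite holds_final.
  rewrite <- (@solution_avoiding n phi (reduced_form (selected_form sel m)) F nu l HF hl).
  - split.
    + intros (x & [h1 h2] & h3). exists (map x (seq 0 n)). split; [now rewrite length_map, length_seq|split].
      * apply Forall_forall. intros c hc. apply in_map_iff in hc as (i & <- & hi). apply in_seq in hi. apply h3. lia.
      * replace (fun i => nth i (map x (seq 0 n)) 0) with x; [assumption|].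
        apply functional_extensionality. intro i. destruct (lt_dec i n) as [hi|hi].
        -- rewrite nth_indep with (d' := x 0%nat) by (rewrite length_map, length_seq; assumption).
           rewrite map_nth, seq_nth by assumption. reflexivity.
        -- rewrite nth_overflow by (rewrite length_map, length_seq; lia). apply h1. lia.
    + intros (xs & h1 & h2 & h3). exists (fun i => nth i xs 0). split; [split|].
      * intros i hi. apply nth_overflow. lia.
      * assumption.
      * intros j hj. rewrite Forall_forall in h2. apply h2, nth_In. lia.
  - intros x hx. exact (@holds_reduced _ G x hx HG).
Qed.
End Builders.

Local Open Scope nat_scope.

(** * The decision procedure *)

(** Arithmetic counterparts of the formula builders. Recursive ones take the number of steps first,
    since [PRec] recurses on its first argument. *)
Definition c_eqv i j := cpair 0 (cpair (cpair 0 i) (cpair 0 j)).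
Definition c_ltv i j := cpair 1 (cpair (cpair 0 i) (cpair 0 j)).
Definition c_not g := cpair 2 g.
Definition c_and g h := cpair 3 (cpair g h).
Definition c_or g h := cpair 4 (cpair g h).
Definition c_ex i g := cpair 5 (cpair i g).
Definition c_block k a g := nat_rect (fun _ => nat) g (fun k r => c_ex (a + k) r) k.
(* In the following functions the argument [q] is the pair of the dimension and the code of the formula. *)
Definition c_fresh q := unpairr q + unpairl q + 1.
Definition c_lower i q := c_fresh q + 2 + 2 * i.
Definition c_upper i q := c_fresh q + 3 + 2 * i.
Definition c_box k q := nat_rect (fun _ => nat) (code_form FTrue)
  (fun k r => c_and r (c_and (c_ltv (c_lower k q) k) (c_ltv k (c_upper k q)))) k.
Definition c_body q := c_and (unpairr q) (c_box (unpairl q) q).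
Definition c_const j q := c_not (c_block (unpairl q) 0 (c_and (c_body q) (c_not (c_eqv j (c_fresh q))))).
Definition c_some_const k q := nat_rect (fun _ => nat) (code_form FFalse) (fun k r => c_or r (c_const k q)) k.
Definition c_special q := c_block (unpairl q + unpairl q) (c_fresh q + 2)
  (c_and (c_block (unpairl q) 0 (c_body q)) (c_some_const (unpairl q) q)).
Definition c_rank k q := nat_rect (fun _ => nat) (code_form FTrue)
  (fun k r => c_ex (c_fresh q + 1) (c_and (c_ltv (c_fresh q + 1) (c_fresh q))
     (c_ex (c_fresh q) (c_and (c_eqv (c_fresh q) (c_fresh q + 1)) (c_and (c_special q) r))))) k.
Definition c_nth k q := c_and (c_special q) (c_and (c_rank k q) (c_not (c_rank (S k) q))).
Definition c_query k q := c_ex (c_fresh q) (c_and (c_eqv (c_fresh q) 0) (c_nth k q)).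
Definition c_exists k q := c_ex (c_fresh q) (c_nth k q).
Definition c_avoid k g q := nat_rect (fun _ => nat) (code_form FTrue)
  (fun k r => c_and r (c_not (c_ex (c_fresh q) (c_and (c_eqv (c_fresh q) k) g)))) k.
Definition c_final g q := c_block (unpairl q) 0 (c_and (unpairr q) (c_avoid (unpairl q) g q)).
(** The factor [1 - (b - 1) - (1 - b)] is 1 if [b] is 1 and 0 otherwise: any other output of the
    oracle is a negative answer. *)
Definition c_select b r g := (1 - (b - 1) - (1 - b)) * c_or r g + (1 - (1 - (b - 1) - (1 - b))) * r.

Section Codes.
Variables (n : nat) (phi : form).
Let q := cpair n (code_form phi).

Lemma c_block_code k a g : c_block k a (code_form g) = code_form (ex_block a k g).
Proof. induction k as [|k IH]; [reflexivity|]. unfold c_block in *. cbn [nat_rect]. rewrite IH. reflexivity. Qed.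
Lemma c_fresh_code : c_fresh q = fresh n phi.
Proof. unfold c_fresh, fresh, q. now rewrite unpairl_cpair, unpairr_cpair. Qed.
Lemma c_box_code k : c_box k q = code_form (box_form n phi k).
Proof.
  induction k as [|k IH]; [reflexivity|]. unfold c_box in *. cbn [nat_rect]. rewrite IH.
  unfold c_lower, c_upper. rewrite c_fresh_code. reflexivity.
Qed.
Lemma c_body_code : c_body q = code_form (body_form n phi).
Proof. unfold c_body. unfold q at 1 2. rewrite unpairl_cpair, unpairr_cpair, c_box_code. reflexivity. Qed.
Lemma c_const_code j : c_const j q = code_form (const_form n phi j).
Proof.
  unfold c_const. rewrite c_body_code, c_fresh_code. unfold q. rewrite unpairl_cpair.
  unfold const_form. cbn [code_form]. rewrite <- c_block_code. reflexivity.
Qed.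
Lemma c_some_const_code k : c_some_const k q = code_form (some_const_form n phi k).
Proof.
  induction k as [|k IH]; [reflexivity|]. unfold c_some_const in *. cbn [nat_rect]. rewrite IH, c_const_code. reflexivity.
Qed.
Lemma c_special_code : c_special q = code_form (special_form n phi).
Proof.
  unfold c_special. rewrite c_body_code, c_fresh_code. unfold q at 1 2 3 4. rewrite unpairl_cpair, c_some_const_code, c_block_code.
  exact (c_block_code (n + n) (fresh n phi + 2) (FAnd (ex_block 0 n (body_form n phi)) (some_const_form n phi n))).
Qed.
Lemma c_rank_code k : c_rank k q = code_form (rank_form n phi k).
Proof.
  induction k as [|k IH]; [reflexivity|]. unfold c_rank in *. cbn [nat_rect]. rewrite IH, c_fresh_code, c_special_code. reflexivity.
Qed.
Lemma c_nth_code k : c_nth k q = code_form (nth_form n phi k).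
Proof. unfold c_nth. rewrite !c_rank_code, c_special_code. reflexivity. Qed.
Lemma c_query_code k : c_query k q = code_form (nth_query n phi k).
Proof. unfold c_query. rewrite c_nth_code, c_fresh_code. reflexivity. Qed.
Lemma c_exists_code k : c_exists k q = code_form (nth_exists n phi k).
Proof. unfold c_exists. rewrite c_nth_code, c_fresh_code. reflexivity. Qed.
Lemma c_avoid_code g k : c_avoid k (code_form g) q = code_form (avoid_form n phi g k).
Proof.
  induction k as [|k IH]; [reflexivity|]. unfold c_avoid in *. cbn [nat_rect]. rewrite IH, c_fresh_code. reflexivity.
Qed.
Lemma c_final_code g : c_final (code_form g) q = code_form (final_form n phi g).
Proof.
  unfold c_final. unfold q at 1 2 3. rewrite unpairl_cpair, unpairr_cpair. fold q. rewrite c_avoid_code.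
  unfold final_form. rewrite <- c_block_code. reflexivity.
Qed.
End Codes.

Lemma c_select_spec b r g : c_select b r g = if Nat.eqb b 1 then c_or r g else r.
Proof.
  unfold c_select. destruct (Nat.eqb_spec b 1) as [->|e]; [cbn [Nat.sub]; lia|].
  replace (1 - (b - 1) - (1 - b)) with 0 by lia. lia.
Qed.

(** * Computability of the formula builders *)

Lemma computable2_c_eqv : computable2 c_eqv. Proof. unfold c_eqv. compute_fun. Qed.
Lemma computable2_c_ltv : computable2 c_ltv. Proof. unfold c_ltv. compute_fun. Qed.
Lemma computable1_c_not : computable1 c_not. Proof. unfold c_not. compute_fun. Qed.
Lemma computable2_c_and : computable2 c_and. Proof. unfold c_and. compute_fun. Qed.
Lemma computable2_c_or : computable2 c_or. Proof. unfold c_or. compute_fun. Qed.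
Lemma computable2_c_ex : computable2 c_ex. Proof. unfold c_ex. compute_fun. Qed.
#[local] Hint Resolve computable2_c_eqv computable2_c_ltv computable1_c_not computable2_c_and computable2_c_or computable2_c_ex : comp.
Lemma computable3_c_block : computable3 c_block.
Proof.
  apply (@computable3_rec (fun a g => g) (fun k r a g => c_ex (a + k) r)); compute_fun.
Qed.
Lemma computable1_c_fresh : computable1 c_fresh. Proof. unfold c_fresh. compute_fun. Qed.
#[local] Hint Resolve computable3_c_block computable1_c_fresh : comp.
Lemma computable2_c_lower : computable2 c_lower. Proof. unfold c_lower. compute_fun. Qed.
Lemma computable2_c_upper : computable2 c_upper. Proof. unfold c_upper. compute_fun. Qed.
#[local] Hint Resolve computable2_c_lower computable2_c_upper : comp.
Lemma computable2_c_box : computable2 c_box.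
Proof.
  apply (@computable2_rec (fun _ => code_form FTrue)
    (fun k r q => c_and r (c_and (c_ltv (c_lower k q) k) (c_ltv k (c_upper k q))))); compute_fun.
Qed.
#[local] Hint Resolve computable2_c_box : comp.
Lemma computable1_c_body : computable1 c_body. Proof. unfold c_body. compute_fun. Qed.
#[local] Hint Resolve computable1_c_body : comp.
Lemma computable2_c_const : computable2 c_const. Proof. unfold c_const. compute_fun. Qed.
#[local] Hint Resolve computable2_c_const : comp.
Lemma computable2_c_some_const : computable2 c_some_const.
Proof.
  apply (@computable2_rec (fun _ => code_form FFalse) (fun k r q => c_or r (c_const k q))); compute_fun.
Qed.
#[local] Hint Resolve computable2_c_some_const : comp.
Lemma computable1_c_special : computable1 c_special. Proof. unfold c_special. compute_fun. Qed.
#[local] Hint Resolve computable1_c_special : comp.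
Lemma computable2_c_rank : computable2 c_rank.
Proof.
  apply (@computable2_rec (fun _ => code_form FTrue) (fun k r q =>
    c_ex (c_fresh q + 1) (c_and (c_ltv (c_fresh q + 1) (c_fresh q))
     (c_ex (c_fresh q) (c_and (c_eqv (c_fresh q) (c_fresh q + 1)) (c_and (c_special q) r)))))); compute_fun.
Qed.
#[local] Hint Resolve computable2_c_rank : comp.
Lemma computable2_c_nth : computable2 c_nth. Proof. unfold c_nth. compute_fun. Qed.
#[local] Hint Resolve computable2_c_nth : comp.
Lemma computable2_c_query : computable2 c_query. Proof. unfold c_query. compute_fun. Qed.
Lemma computable2_c_exists : computable2 c_exists. Proof. unfold c_exists. compute_fun. Qed.
Lemma computable3_c_avoid : computable3 c_avoid.
Proof.
  apply (@computable3_rec (fun _ _ => code_form FTrue) (fun k r g q =>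
    c_and r (c_not (c_ex (c_fresh q) (c_and (c_eqv (c_fresh q) k) g))))); compute_fun.
Qed.
#[local] Hint Resolve computable3_c_avoid : comp.
Lemma computable2_c_final : computable2 c_final. Proof. unfold c_final. compute_fun. Qed.
Lemma computable3_c_select : computable3 c_select. Proof. unfold c_select. compute_fun. Qed.

Lemma eval_comp1 f g args x y : eval g args x -> eval f [x] y -> eval (PComp f [g]) args y.
Proof. intros Hg Hf. apply eComp with [x]; [repeat constructor|]; assumption. Qed.
Lemma eval_comp2 f g h args x1 x2 y : eval g args x1 -> eval h args x2 -> eval f [x1; x2] y -> eval (PComp f [g; h]) args y.
Proof. intros Hg Hh Hf. apply eComp with [x1; x2]; [repeat constructor|]; assumption. Qed.

Local Open Scope R_scope.
Unset Implicit Arguments.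

Theorem theorem7p4 (F : R -> Prop) :
  sufficiently_computable F ->
  exists e : prf, forall (n : nat) (phi : form),
    exists b, eval e [cpair n (code_form phi)] b /\
      (b = 1%nat <->
       exists xs : list R, length xs = n /\ Forall (fun x => ~ F x) xs /\
         holds (fun i => nth i xs 0) phi).
Proof.
  intros [(nu & _ & _ & _ & _ & _ & _ & _ & HF & _) [oracle Horacle]].
  destruct RealClosed.truth_computable as [T HT].
  destruct computable2_c_exists as [ex Hex]. destruct computable2_c_query as [qu Hqu].
  destruct computable2_c_nth as [nt Hnt]. destruct computable2_c_final as [fi Hfi].
  destruct computable3_c_select as [se Hse]. destruct (computable_const (code_form FFalse) 1) as [fa Hfa].
  (* Counts the special values: [PMin] stops at the first index for which the existence sentence is
     false. *)
  set (size := PMin (PComp T [ex])).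
  (* [PRec] passes the index, the code built so far and [q], in this order. The oracle is asked only
     below the count, where the query defines a real; elsewhere no answer is guaranteed. *)
  set (choose := PRec fa (PComp se [PComp oracle [PComp qu [PProj 0; PProj 2]]; PProj 1; PComp nt [PProj 0; PProj 2]])).
  exists (PComp T [PComp fi [PComp choose [size; PProj 0]; PProj 0]]).
  intros n phi. set (q := cpair n (code_form phi)).
  destruct (nth_special_none n phi) as [m0 hm0].
  destruct (least_nat (fun m => forall c, ~ nth_special n phi m c) m0 hm0) as (m & hm & hmin).
  assert (Hsize : eval size [q] m).
  { assert (Ht : forall k, eval (PComp T [ex]) [k; q] (truth (nth_exists n phi k))).
    { intro k. apply eval_comp1 with (c_exists k q); [apply Hex|]. unfold q. rewrite c_exists_code. apply HT. }
    apply eMin.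
    - replace 0%nat with (truth (nth_exists n phi m)); [apply Ht|]. unfold truth.
      destruct (excluded_middle_informative _) as [h|h]; [|reflexivity].
      apply holds_nth_exists in h as [c hc]. destruct (hm c hc).
    - intros z hz. exists (truth (nth_exists n phi z)). split; [|apply Ht].
      rewrite (proj2 (truth_spec _)); [discriminate|]. apply holds_nth_exists.
      apply NNPP. intro hn. apply (hmin z hz). intros c hc. apply hn. now exists c. }
  assert (Hsel : forall k, exists b, (k < m)%nat -> eval oracle [code_form (nth_query n phi k)] b /\
      forall c, nth_special n phi k c -> (b = 1%nat <-> F c)).
  (* Values from index [m] on are placeholders that the recursion never reaches. *)
  { intro k. destruct (lt_dec k m) as [hk|hk]; [|exists 0%nat; tauto].
    assert (hc : exists c, nth_special n phi k c).
    { apply NNPP. intro hn. apply (hmin k hk). intros c hc. apply hn. now exists c. }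
    destruct hc as [c hc].
    destruct (Horacle (nth_query n phi k) c) as (b & hb1 & hb2).
    - intro x. rewrite holds_nth_query by exact (special_dim_pos (proj1 hc)). split.
      + intro hx. exact (nth_special_unique hx hc).
      + now intros ->.
    - exists b. intros _. split; [assumption|]. intros c' hc'. now rewrite (nth_special_unique hc' hc). }
  apply choice in Hsel. destruct Hsel as [sel Hsel].
  assert (Hchoose : forall k, (k <= m)%nat -> eval choose [k; q] (code_form (selected_form n phi sel k))).
  { induction k as [|k IH]; intro hk.
    - apply eRec0; [reflexivity|]. now apply Hfa.
    - eapply eRecS; [apply IH; lia|]. destruct (Hsel k) as [hs _]; [lia|].
      replace (code_form (selected_form n phi sel (S k)))
        with (c_select (sel k) (code_form (selected_form n phi sel k)) (c_nth k q)).
      + apply eComp with [sel k; code_form (selected_form n phi sel k); c_nth k q]; [|apply Hse].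
        constructor; [|constructor; [apply (eProj 1)|constructor; [|constructor]]].
        * apply eval_comp1 with (c_query k q).
          -- apply eval_comp2 with k q; [apply (eProj 0)|apply (eProj 2)|apply Hqu].
          -- unfold q. rewrite c_query_code. assumption.
        * apply eval_comp2 with k q; [apply (eProj 0)|apply (eProj 2)|apply Hnt].
      + rewrite c_select_spec. unfold q. rewrite c_nth_code. cbn [selected_form].
        destruct (Nat.eqb (sel k) 1); reflexivity. }
  exists (truth (final_form n phi (selected_form n phi sel m))). split.
  - apply eval_comp1 with (code_form (final_form n phi (selected_form n phi sel m))); [|apply HT].
    apply eval_comp2 with (code_form (selected_form n phi sel m)) q; [|apply (eProj 0)|].
    + apply eval_comp2 with m q; [exact Hsize|apply (eProj 0)|]. now apply Hchoose.
    + rewrite <- c_final_code. apply Hfi.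
  - rewrite truth_spec. apply (@final_form_correct n phi F nu m sel HF hm).
    intros k c hk hc. now apply (proj2 (Hsel k hk)).
Qed.
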